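(* Let $n > 3$ be an integer with $n \equiv 3 \pmod{18}$ and let $q := n/3$. Then $$\sigma(A_n) = \sum_{i=1}^{q-2} \binom{n}{i} + \frac{1}{6}\,\frac{n!}{q!^3}.$$ Moreover, a minimal covering of $A_n$ (i.e. a family of proper subgroups of $A_n$ with union $A_n$ and of smallest possible size $\sigma(A_n)$) consists of all the intransitive maximal subgroups of type $(S_i \times S_{n-i}) \cap A_n$, for $i = 1,\ldots,q-2$ (the stabilizers in $A_n$ of subsets of $\{1,\ldots,n\}$ of size $i$), together with all the imprimitive maximal subgroups of $A_n$ with $3$ blocks (the stabilizers in $A_n$ of partitions of $\{1,\ldots,n\}$ into $3$ blocks of size $q$), which are isomorphic to $(S_q \wr S_3) \cap A_n$.
   Context: $A_n$ and $S_n$ are the alternating and symmetric groups on $\{1,\ldots,n\}$. For a finite noncyclic group $G$, a covering of $G$ is a family of proper subgroups of $G$ whose union is $G$, and $\sigma(G)$ is the minimal size of a covering of $G$. $S_q \wr S_3$ denotes the wreath product in its imprimitive action on $3q=n$ points. *)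

(* Defs.v *)
From mathcomp Require Import all_boot all_order all_algebra.
From mathcomp Require Import all_fingroup all_solvable.

Set Implicit Arguments.
Unset Strict Implicit.
Unset Printing Implicit Defensive.

Local Open Scope group_scope.

Definition is_covering (gT : finGroupType) (G : {group gT})
    (C : {set {group gT}}) : bool :=
  [forall H in C, H \proper G] && (\bigcup_(H in C) (H : {set gT}) == G).

(* When G is not cyclic the family of all proper subgroups is a covering, so
   the minimum is taken over a nonempty set.  For cyclic G there is no covering
   and the value has no meaning. *)
Definition sigma (gT : finGroupType) (G : {group gT}) : nat :=
  #|[arg min_(C < [set H : {group gT} | H \proper G] | is_covering G C) #|C|]|.

Definition is_minimal_covering (gT : finGroupType) (G : {group gT})
    (C : {set {group gT}}) : bool :=
  is_covering G C && (#|C| == sigma G).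

(* The points {1, ..., n} are represented by 'I_n. *)
Definition subset_stabs (n i : nat) : {set {group {perm 'I_n}}} :=
  [set 'N_('Alt_('I_n))(B | 'P)%G | B : {set 'I_n} & #|B| == i].

Definition is_block_partition (n k m : nat) (P : {set {set 'I_n}}) : bool :=
  [&& partition P [set: 'I_n], #|P| == k & [forall B in P, #|B| == m]].

Definition partition_stabs (n k m : nat) : {set {group {perm 'I_n}}} :=
  [set 'N_('Alt_('I_n))(P | 'P^*)%G
     | P : {set {set 'I_n}} & is_block_partition k m P].

(* Sym(T) wr Sym(I) acting on I * T, the blocks being the sets {i} * T: an
   element permutes the blocks by s and sends the T-coordinate of a point of
   block i through f i. *)
Definition wreath (T I : finType) : {set {perm (I * T)}} :=
  [set p : {perm (I * T)} |
    [exists s : {perm I}, exists f : {ffun I -> {perm T}},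
      forall z : I * T, p z == (s z.1, f z.1 z.2)]].

Lemma wreath_group_set (T I : finType) : group_set (wreath T I).
Proof.
apply/group_setP; split=> [|p r].
  rewrite inE; apply/existsP; exists 1; apply/existsP; exists [ffun=> 1].
  by apply/forallP=> -[i x]; rewrite ffunE !perm1.
rewrite !inE => /existsP[s /existsP[f /forallP pE]].
move=> /existsP[t /existsP[g /forallP rE]].
apply/existsP; exists (s * t); apply/existsP.
exists [ffun i => f i * g (s i)]; apply/forallP=> z.
by rewrite ffunE !permM (eqP (pE z)) (eqP (rE _)).
Qed.

Canonical wreath_group (T I : finType) := Group (wreath_group_set T I).

(* Main.v *)
Require Import Defs.
From mathcomp Require Import all_boot all_order all_algebra.
From mathcomp Require Import all_fingroup all_solvable.
From mathcomp Require Import zify ring lra.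

(* Write n = 3 q, with q = 1 mod 6.

   Covering: an even permutation with no invariant set of size in [1, q - 2]
   has an odd number of cycles, all of length at least q - 1, hence it is an
   n-cycle or has cycle type (q-1, q-1, q+2), (q, q, q) or (q-1, q, q+1).
   Colouring the points along the cycles, modulo 3 in the first two cases and
   modulo 2 off the q-cycle in the last one, gives an invariant partition into
   three blocks.

   Lower bound: linear programming duality.  Let g_0 be an n-cycle and let g_i,
   for 1 <= i <= q - 2, have cycle type (i, q+1, 2q-1-i), or (q-2, q, q+2) when
   i = q - 2.  Let mu_i(H) be the proportion of the S_n-class of g_i that lies
   in H, and M the number of partitions into three blocks.  The members H of a
   covering satisfy sum_H mu_i(H) >= 1 for all i, so it suffices that
     sum_i C(n, i) mu_i(H) + M mu_0(H) <= 1
   for every proper subgroup H.  If H fixes a set or a partition into three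
   blocks, this is a count of the sets or partitions fixed by g_i.  Otherwise
   H is small: |H| <= k! b!^k if H preserves k >= 5 blocks of size b, and
   |H| <= n! / ((n+1)/2)! (Bochert) if H is primitive, since by Jordan's theorem
   it contains no 3-cycle.

   Bochert's bound fails to be enough only for n = 21 and H containing a
   21-cycle.  There |H| <= 36 * 10^9: in a larger H, every set of 13 points
   supports at least |H| / (21 * 20 * ... * 14) > 4 elements, so the minimal
   degree m is at most 13.  For m >= 8, an element g of prime order and degree m has, for suitable
   small I inside its support, commutators [g, h] moving fewer than m points,
   for all h in H fixing supp(g) \ I pointwise; this makes the group of these h
   too small.  For m <= 7, two conjugates of g cannot have supports meeting in
   a single point, and the supports are enumerated as subsets of Z/21. *)

Set Implicit Arguments.
Unset Strict Implicit.
Unset Printing Implicit Defensive.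

Import Order.TTheory GRing.Theory Num.Theory.

(** * Binomial and factorial estimates *)

(** The dual solution is tight on the proposed family: each of its members meets exactly one of the
    chosen classes, in the proportion 1 / C(n, i) or 1 / M. This dictates the g_i. They must be
    even, fix at most one set of each size, fix no set of size at most q - 2 except one of size i,
    and preserve no partition into three blocks. Three cycles of distinct lengths, none the sum of
    the other two, settle the sets; they are even because n is odd. At i = q - 2 the lengths q + 1
    and 2 q - 1 - i coincide, hence the separate type there.

    The residue q = 1 mod 3 enters twice: q + 1 is prime to 3, which keeps g_i from permuting three
    blocks cyclically, and q - 1 and q + 2 are multiples of 3, which allows the colouring modulo 3.

    The obstacle is the primitive groups. Bochert's bound is strong enough from q = 13 on, the next
    value after 7. For q = 7 it only gives 21! / 11!, about 1.28 * 10^12, while the dual constraint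
    at a group containing a 21-cycle is secured only up to an order of about 36.1 * 10^9. The study
    of degree 21 closes this gap. *)

Lemma bin_double n i : 3 * i + 2 <= n -> 2 * 'C(n, i) <= 'C(n, i.+1).
Proof.
move=> le; rewrite -(leq_pmul2l (ltn0Sn i)) mul_bin_left mulnA leq_mul2r.
by apply/orP; right; lia.
Qed.

(** Up to a third of n the coefficients at least double at each step, so each dominates the sum of
    the earlier ones, as in a geometric series. *)
Lemma sum_bin_le n r : 3 * r <= n -> \sum_(1 <= i < r) 'C(n, i) <= 'C(n, r).
Proof.
elim: r => [|[|r] IHr] le; [by rewrite big_geq | by rewrite big_geq |].
rewrite big_nat_recr //=; apply: leq_trans (bin_double _); last by lia.
by rewrite mul2n -addnn leq_add2r IHr //; lia.
Qed.

Lemma bin_mono n a b : a <= b -> 2 * b <= n.+1 -> 'C(n, a) <= 'C(n, b).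
Proof.
move=> ab; rewrite -(subnKC ab); elim: (b - a) => [|d IHd]; first by rewrite addn0.
move=> le; apply: leq_trans (IHd _) _; first by lia.
rewrite addnS -(leq_pmul2l (ltn0Sn (a + d))) mul_bin_left leq_mul2r.
by apply/orP; right; lia.
Qed.

Lemma central_bin_ge q : 2 ^ q * (q`! * q`!) <= (2 * q)`!.
Proof.
elim: q => [//|q IHq]; have -> : 2 * q.+1 = (2 * q).+2 by lia.
rewrite !factS expnS.
have -> : 2 * 2 ^ q * (q.+1 * q`! * (q.+1 * q`!)) = 2 * (q.+1 * q.+1) * (2 ^ q * (q`! * q`!)).
  by move: (2 ^ q) q`! => a f; lia.
by rewrite [X in _ <= X]mulnA; apply: leq_mul => //; nia.
Qed.

Lemma exp2_ge q : 7 <= q -> 2 * q ^ 2 <= 2 ^ q.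
Proof.
move=> q7; rewrite -(subnKC q7); elim: (q - 7) => [//|d IHd].
rewrite addnS [X in _ <= X]expnS; apply: leq_trans (leq_mul (leqnn 2) IHd).
by rewrite !expnS expn0; nia.
Qed.

(** The quotient (3 q)! / q!^3 is C(3 q, q) C(2 q, q), whose second factor is at least 2^q. Through
    this, for imprimitive H, the single inequality |H| q <= q!^3 also controls the classes with
    three cycles. *)
Lemma multinomial_ge q : 7 <= q ->
  q`! ^ 3 * ('C(3 * q, q.-1) * (2 * q ^ 2)) <= (3 * q)`!.
Proof.
move=> q7; have qq : q <= 3 * q by lia.
rewrite -(bin_fact qq) (_ : 3 * q - q = 2 * q); last by lia.
have -> : q`! ^ 3 * ('C(3 * q, q.-1) * (2 * q ^ 2)) =
   'C(3 * q, q.-1) * (q`! * ((2 * q ^ 2) * (q`! * q`!))) by rewrite !expnS expn0; lia.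
apply: leq_mul; first by apply: bin_mono; lia.
rewrite leq_mul2l; apply/orP; right; apply: leq_trans (central_bin_ge q).
by rewrite leq_mul2r exp2_ge ?orbT.
Qed.

Lemma bin_le_exp2 n m : 'C(n, m) <= 2 ^ n.
Proof.
have [le|lt] := leqP m n; last by rewrite bin_small.
rewrite -[2]/(1 + 1) expnDn (bigD1 (inord m)) //= !exp1n !muln1.
by rewrite inordK ?ltnS // leq_addr.
Qed.

Lemma fact_addn n m : (n + m)`! = n`! * \prod_(i < m) (n + i.+1).
Proof.
elim: m => [|m IHm]; first by rewrite addn0 big_ord0 muln1.
by rewrite addnS factS IHm big_ord_recr /= addnS; lia.
Qed.

Lemma fact_addn_le n m : (n + m)`! <= n`! * (n + m) ^ m.
Proof.
rewrite fact_addn leq_mul2l; apply/orP; right.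
have -> : (n + m) ^ m = \prod_(i < m) (n + m) by rewrite prod_nat_const card_ord.
by apply: leq_prod => i _; rewrite leq_add2l.
Qed.

Lemma fact_addn_ge n m : n`! * n.+1 ^ m <= (n + m)`!.
Proof.
rewrite fact_addn leq_mul2l; apply/orP; right.
have -> : n.+1 ^ m = \prod_(i < m) n.+1 by rewrite prod_nat_const card_ord.
by apply: leq_prod => i _; rewrite addnS ltnS leq_addr.
Qed.

(* q = 2 r + 1, so that 3 q = 6 r + 3 and (3 q + 1) / 2 = 3 r + 2. *)
Lemma fact_ineq_bochert r : 6 <= r ->
  (6 * r + 3)`! * (2 * r).+1 <= (2 * r).+1`! ^ 3 * (3 * r + 2)`!.
Proof.
move=> r6; rewrite -(subnKC r6); elim: (r - 6) => [|d].
  have e1 : 6 * 6 + 3 = 20 + 19 by [].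
  have e2 : (2 * 6).+1 = 0 + 13 by [].
  have e3 : 3 * 6 + 2 = 20 by [].
  rewrite addn0 e1 e2 e3 !fact_addn; move: (20`!) => A; rewrite fact0.
  rewrite -mulnA [X in _ <= X]mulnC leq_mul2l; apply/orP; right.
  rewrite !big_ord_recr !big_ord0 /=; clear; rewrite !expnS expn0; lia.
rewrite (addnS 6 d); set s := 6 + d; have s6 : 6 <= s by rewrite leq_addr.
move: s s6 => s s6 IH.
have -> : 6 * s.+1 + 3 = (6 * s + 3) + 6 by lia.
have -> : (2 * s.+1).+1 = (2 * s).+1 + 2 by lia.
have -> : 3 * s.+1 + 2 = (3 * s + 2) + 3 by lia.
move: IH (fact_addn_le (6 * s + 3) 6) (fact_addn_ge (2 * s).+1 2) (fact_addn_ge (3 * s + 2) 3).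
move: (6 * s + 3 + 6)`! ((2 * s).+1 + 2)`! (3 * s + 2 + 3)`! (6 * s + 3)`! (2 * s).+1`! (3 * s + 2)`!.
move=> A' B' C' A B C IH upA loB loC.
have loB3 : (B * (2 * s).+2 ^ 2) ^ 3 <= B' ^ 3 by rewrite leq_exp2r.
apply: leq_trans (leq_mul upA (leqnn _)) _; apply: leq_trans (leq_mul loB3 loC).
set u := 6 * s + 3 + 6; set w := (2 * s).+2; set z := (3 * s + 2).+1.
apply: leq_trans (_ : A * (2 * s).+1 * (2 * u ^ 6) <= _).
  have -> : A * (2 * s).+1 * (2 * u ^ 6) = A * u ^ 6 * (2 * (2 * s).+1) by move: (u ^ 6) => U; clear; lia.
  by rewrite leq_mul2l; apply/orP; right; clear -s6; lia.
have -> : (B * w ^ 2) ^ 3 * (C * z ^ 3) = B ^ 3 * C * (w ^ 6 * z ^ 3).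
  by rewrite expnMn -expnM; move: (B ^ 3) (w ^ (2 * 3)) (z ^ 3) => b1 w1 z1; clear; lia.
apply: leq_mul => //.
(* It remains to see that 2 u^6 <= w^6 z^3: the ratio u / w is at most 10 / 3, and 2 (10 / 3)^6 <
   21^3 <= z^3. *)
have uw : 3 * u <= 10 * w by rewrite /u /w; clear -s6; lia.
have z21 : 21 ^ 3 <= z ^ 3 by rewrite leq_exp2r // /z; clear -s6; lia.
rewrite -(leq_pmul2l (expn_gt0 3 6)) mulnCA -expnMn.
apply: leq_trans (_ : 2 * (10 * w) ^ 6 <= _).
  by rewrite leq_mul2l leq_exp2r.
rewrite expnMn; apply: leq_trans (leq_mul (leqnn (3 ^ 6)) (leq_mul (leqnn (w ^ 6)) z21)).
have -> : 2 * (10 ^ 6 * w ^ 6) = w ^ 6 * (2 * 10 ^ 6) by rewrite mulnA mulnC.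
rewrite [X in _ <= X]mulnCA leq_mul2l; apply/orP; right.
by rewrite !expnS !expn0; clear; lia.
Qed.

(** Again q = 2 r + 1; the cases r = 3 and r >= 6 are q = 7 and q >= 13. *)
Lemma fact_ineq_bin r : 3 <= r -> r != 4 -> r != 5 ->
  'C(6 * r + 3, 2 * r) * (2 * r).+1 ^ 3 * 2 <= (3 * r + 2)`!.
Proof.
move=> r3 r4 r5.
have [r6|] := leqP 6 r; last first.
  move=> lt6; have -> : r = 3 by move: r3 r4 r5 lt6; clear; case: r => [|[|[|[|[|[|r]]]]]].
  (* C(21, 6) = 54264. Here and below large numbers are written as sums and products, since numerals
     of type [nat] are unary. *)
  have -> : 'C(6 * 3 + 3, 2 * 3) = 54 * 1000 + 264.
    have := bin_ffact 21 6; rewrite !ffactnS ffactn0 -[6 * 3 + 3]/21 -[2 * 3]/6.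
    by move: 'C(21, 6) => c; rewrite !factS fact0 /=; clear; lia.
  have -> : 3 * 3 + 2 = 0 + 11 by [].
  rewrite fact_addn fact0 !big_ord_recr big_ord0 /=; clear.
  by rewrite !expnS expn0; lia.
apply: leq_trans (_ : 2 ^ (6 * r + 3) * (2 * r).+1 ^ 3 * 2 <= _).
  by rewrite !leq_mul2r bin_le_exp2 !orbT.
rewrite -(subnKC r6); elim: (r - 6) => [|d].
  have e1 : 3 * 6 + 2 = 0 + 20 by [].
  have e2 : 6 * 6 + 3 = 39 by [].
  rewrite addn0 e1 e2 fact_addn fact0 mul1n.
  have -> : \prod_(i < 20) (0 + i.+1) =
      1*2*3*4*5*6*7*8*9*10*11*12*13*14*15*16*17*18*19*20.
    by rewrite !big_ord_recr big_ord0 /= mul1n.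
  by clear; rewrite !expnS !expn0; lia.
rewrite (addnS 6 d); set s := 6 + d; have s6 : 6 <= s by rewrite leq_addr.
move: s s6 => s s6 IH.
have -> : 6 * s.+1 + 3 = (6 * s + 3) + 6 by clear; lia.
have -> : (2 * s.+1).+1 = (2 * s).+1 + 2 by clear; lia.
have -> : 3 * s.+1 + 2 = (3 * s + 2) + 3 by clear; lia.
move: IH (fact_addn_ge (3 * s + 2) 3); rewrite (expnD 2 (6 * s + 3) 6).
move: (3 * s + 2 + 3)`! (3 * s + 2)`! (2 ^ (6 * s + 3)) => C' C P IH loC.
apply: leq_trans loC; apply: leq_trans (leq_mul IH (leqnn _)).
have -> : P * 2 ^ 6 * ((2 * s).+1 + 2) ^ 3 * 2 = P * 2 * ((4 * ((2 * s).+1 + 2)) ^ 3).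
  by rewrite expnMn; move: (_ ^ 3) => c; rewrite !expnS expn0; clear; lia.
have -> : P * (2 * s).+1 ^ 3 * 2 * (3 * s + 2).+1 ^ 3 = P * 2 * ((2 * s).+1 * (3 * s + 2).+1) ^ 3.
  by rewrite expnMn; move: (_ ^ 3) (_ ^ 3) => c d'; clear; lia.
rewrite leq_mul2l; apply/orP; right; rewrite leq_exp2r //.
by clear -s6; nia.
Qed.

Lemma fact_le_exp n : n`! <= n ^ n.
Proof. by have := fact_addn_le 0 n; rewrite add0n fact0 mul1n. Qed.

(** The left side counts the products of a row permutation and a column permutation of an l by b
    array. The induction compares factor by factor: (l + 1)(s + 1) <= l b + s + 1 for s < b. *)
Lemma block_fact_le l b : b`! ^ l * l`! ^ b <= (l * b)`!.
Proof.
elim: l => [|l IHl]; first by rewrite mul0n fact0 exp1n.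
have key s : s <= b -> (l * b)`! * (l.+1 ^ s * s`!) <= (l * b + s)`!.
  elim: s => [|s IHs] sb; first by rewrite addn0 fact0 !muln1.
  rewrite addnS !factS expnS.
  have -> : (l * b)`! * (l.+1 * l.+1 ^ s * (s.+1 * s`!)) =
     (l.+1 * s.+1) * ((l * b)`! * (l.+1 ^ s * s`!)).
    by move: (_`!) (l.+1 ^ s) (s`!) => x y z; clear; lia.
  apply: leq_mul; last by apply: IHs; apply: ltnW.
  by move: sb; clear; nia.
rewrite mulSn addnC; apply: leq_trans (key b (leqnn b)).
rewrite factS expnMn expnS.
have -> : b`! * b`! ^ l * (l.+1 ^ b * l`! ^ b) = b`! ^ l * l`! ^ b * (l.+1 ^ b * b`!).
  by move: (b`! ^ l) (b`!) (l.+1 ^ b) (l`! ^ b) => x y z t; clear; lia.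
by rewrite leq_mul2r IHl orbT.
Qed.

(** The case of 3 l blocks, where q = l b. Cubing [block_fact_le] leaves (3 l)! l b <= l!^(3 b); as
    (3 l)! <= l!^7 and l b <= l! 2^b, it is enough that 8 + b <= 3 b. *)
Lemma partition_ineq3k l b : 5 <= l -> 4 <= b ->
  b`! ^ (3 * l) * (3 * l)`! * (l * b) <= (l * b)`! ^ 3.
Proof.
move=> l5 b4.
have l3 : (3 * l)`! <= l`! ^ 7.
  rewrite -(subnKC l5); elim: (l - 5) => [|d].
    have -> : 3 * (5 + 0) = 0 + 15 by [].
    rewrite fact_addn fact0 !big_ord_recr big_ord0 addn0 !factS fact0 /=; clear.
    by rewrite !expnS !expn0; lia.
  rewrite (addnS 5 d); move: (5 + d) (leq_addr d 5) => s s5 IH.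
  have -> : 3 * s.+1 = 3 * s + 3 by clear; lia.
  apply: leq_trans (fact_addn_le _ _) _; rewrite factS expnMn mulnC.
  apply: leq_mul => //; have -> : 3 * s + 3 = 3 * s.+1 by clear; lia.
  rewrite expnMn -[7]/(4 + 3) expnD leq_mul2r; apply/orP; right.
  by apply: leq_trans (_ : 6 ^ 4 <= _); rewrite // leq_exp2r.
have key : (b`! ^ l * l`! ^ b) ^ 3 <= (l * b)`! ^ 3 by rewrite leq_exp2r // block_fact_le.
apply: leq_trans key; rewrite expnMn -!expnM [l * 3]mulnC -mulnA leq_mul2l.
apply/orP; right; apply: leq_trans (_ : l`! ^ 7 * (l`! * 2 ^ b) <= _).
  apply: leq_mul => //; apply: leq_mul; last by rewrite ltnW // ltn_expl.
  by case: l l5 {l3} => // l _; rewrite factS leq_pmulr // fact_gt0.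
have l2 : 2 <= l`!.
  by case: l l5 {l3} => [|[|l]] // _; rewrite factS; have := fact_gt0 l.+1; nia.
apply: leq_trans (_ : l`! ^ (7 + (1 + b)) <= _).
  rewrite !expnD expn1; apply: leq_mul => //; apply: leq_mul => //.
  by rewrite leq_exp2r // (leq_trans _ b4).
by rewrite leq_pexp2l ?fact_gt0 //; clear -b4; lia.
Qed.

(** The case of blocks of size 3, where k = q. *)
Lemma partition_ineq1 k : 7 <= k -> 6 ^ k * k`! * k <= k`! ^ 3.
Proof.
move=> k7; suff : 6 ^ k * k <= k`! ^ 2.
  move=> le; rewrite -mulnA [k`! * k]mulnC mulnA [k`! ^ 3]expnSr.
  by rewrite leq_mul2r le orbT.
rewrite -(subnKC k7); elim: (k - 7) => [|d].
  by rewrite addn0 !factS fact0 !expnS !expn0; clear; lia.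
rewrite (addnS 7 d); move: (7 + d) (leq_addr d 7) => s s7 IH.
rewrite factS expnMn expnS mulnC.
have -> : s.+1 * (6 * 6 ^ s) = (6 * s.+1) * 6 ^ s by rewrite mulnA [s.+1 * 6]mulnC.
apply: leq_trans (_ : s.+1 ^ 2 * (6 ^ s * s) <= _); last by rewrite leq_mul2l IH orbT.
rewrite [6 ^ s * s]mulnC mulnA leq_mul2r; apply/orP; right.
by rewrite expnS expn1; clear -s7; nia.
Qed.

(** Induction on the number k of blocks of size 3 c. The right side gains at least (k c)^(3 c), the
    left at most (3 c)^(3 c) (k + 1)^2 / k, and the ratio (k / 3)^(3 c) is large enough since k >= 5
    and 3 c >= 6. *)
Lemma partition_ineq_step k c : 5 <= k -> 2 <= c ->
  (3 * c)`! ^ k * k`! * (k * c) <= (k * c)`! ^ 3 ->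
  (3 * c)`! ^ k.+1 * k.+1`! * (k.+1 * c) <= (k.+1 * c)`! ^ 3.
Proof.
move=> k5 c2 IH; rewrite [k.+1 * c]mulSn [c + k * c]addnC.
have lo : ((k * c)`! * (k * c) ^ c) ^ 3 <= (k * c + c)`! ^ 3.
  rewrite leq_exp2r //; apply: leq_trans (fact_addn_ge _ _).
  by rewrite leq_mul2l; apply/orP; right; case: c c2 {IH} => // c _; rewrite leq_exp2r.
apply: leq_trans lo; rewrite expnMn.
apply: leq_trans (leq_mul IH (leqnn _)).
have up : (3 * c)`! * k.+1 ^ 2 <= k * ((k * c) ^ c) ^ 3.
  apply: leq_trans (leq_mul (fact_le_exp _) (leqnn _)) _.
  have key : 3 ^ (3 * c) * k.+1 ^ 2 <= k * k ^ (3 * c).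
    have -> : 3 * c = 6 + (3 * c - 6) by clear -c2; lia.
    rewrite !expnD mulnAC mulnA; apply: leq_mul; last first.
      by case: (3 * c - 6) => // e; rewrite leq_exp2r // (leq_trans _ k5).
    apply: leq_trans (_ : k * (k * 5 ^ 5) * 1 <= _).
      by rewrite !expnS !expn0; clear -k5; nia.
    by rewrite muln1 leq_mul2l [k ^ 6]expnS leq_mul2l leq_exp2r // k5 !orbT.
  rewrite -expnM [c * 3]mulnC !expnMn mulnA mulnAC leq_mul2r; apply/orP; right.
  exact: key.
have -> : (3 * c)`! ^ k.+1 * k.+1`! * (k * c + c) =
    (3 * c)`! ^ k * k`! * c * ((3 * c)`! * k.+1 ^ 2).
  by rewrite expnS factS; move: ((3 * c)`!) ((3 * c)`! ^ k) k`! => x y z; clear; rewrite !expnS expn0; lia.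
have -> : (3 * c)`! ^ k * k`! * (k * c) * ((k * c) ^ c) ^ 3 =
    (3 * c)`! ^ k * k`! * c * (k * ((k * c) ^ c) ^ 3).
  by rewrite -!mulnA [c * (k * _)]mulnCA.
by rewrite leq_mul2l up orbT.
Qed.

(** If v / u is at least a / b, then a power of v / u exceeds 2 as soon as a smaller power of a / b
    does, which reduces a large exponent to a small one. *)
Lemma exp_ratio a b e f u v : 0 < b -> b <= a -> 0 < e -> a * u <= b * v ->
  b ^ f * 2 <= a ^ f -> u ^ (e + f) * 2 <= v ^ (e + f).
Proof.
move=> b0 ba e0 uv bf; set n := e + f.
have n0 : 0 < n by rewrite /n addn_gt0 e0.
have bn : 0 < b ^ n by rewrite expn_gt0 b0.
rewrite -(leq_pmul2l bn) -(expnMn b v); apply: leq_trans (_ : (a * u) ^ n <= _).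
  rewrite expnMn mulnCA [X in _ <= X]mulnC leq_mul2l; apply/orP; right.
  by rewrite /n !expnD -mulnA; apply: leq_mul => //; rewrite leq_exp2r.
by rewrite leq_exp2r.
Qed.

Lemma partition_ineq5 c : 2 <= c -> (3 * c)`! ^ 5 * 5`! * (5 * c) <= (5 * c)`! ^ 3.
Proof.
move=> c2; rewrite -(subnKC c2); elim: (c - 2) => [|d].
  rewrite addn0 -[3 * 2]/6 -[5 * 2]/(0 + 10) fact_addn fact0 mul1n.
  have -> : \prod_(i < 10) (0 + i.+1) = 1*2*3*4*5*6*7*8*9*10.
    by rewrite !big_ord_recr big_ord0 /= mul1n.
  by rewrite !factS fact0 !expnS !expn0; clear; lia.
rewrite (addnS 2 d); move: (2 + d) (leq_addr d 2) => {c2}c {}c2 IH.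
have -> : 3 * c.+1 = 3 * c + 3 by clear; lia.
have -> : (5 * c.+1)`! = (5 * c + 5)`! by congr (_`!); clear; lia.
move: IH (fact_addn_le (3 * c) 3) (fact_addn_ge (5 * c) 5).
move: (3 * c + 3)`! (5 * c + 5)`! (3 * c)`! (5 * c)`! => A' B' A B IH up lo.
have lo3 : (B * (5 * c).+1 ^ 5) ^ 3 <= B' ^ 3 by rewrite leq_exp2r.
apply: leq_trans lo3.
have up5 : A' ^ 5 <= (A * (3 * c + 3) ^ 3) ^ 5 by rewrite leq_exp2r.
apply: leq_trans (leq_mul (leq_mul up5 (leqnn _)) (leqnn _)) _.
rewrite (expnMn A) (expnMn B) -!expnM; apply: leq_trans (leq_mul IH (leqnn _)).
rewrite -[3 * 5]/15 -[5 * 3]/15.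
(* The ratio (5 c + 1) / (3 c + 3) is smallest at c = 2, where it is 11 / 9, and (11 / 9)^4 > 2. *)
have key : (3 * c + 3) ^ 15 * 2 <= (5 * c).+1 ^ 15.
  by apply: (@exp_ratio 11 9 11 4) => //; clear -c2; lia.
move: key; move: ((3 * c + 3) ^ 15) ((5 * c).+1 ^ 15) (A ^ 5) (5`!) => U V a f key.
apply: leq_trans (_ : a * f * (5 * c) * (U * 2) <= _); last by rewrite leq_mul2l key orbT.
have -> : a * f * (5 * c) * (U * 2) = a * U * f * (5 * (2 * c)) by clear; lia.
by rewrite leq_mul2l leq_mul2l; apply/orP; right; clear -c2; lia.
Qed.

(** As 3 divides k b, it divides k or b. If k = 3 l, then l and b divide q, which is prime to 6, so
    l >= 5 and b >= 4. If b = 3 l, then k = q for l = 1, and otherwise an induction on k starts from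
    5. *)
Lemma partition_ineq k b q : (k * b)%N = 3 * q -> 5 <= k -> 3 <= b -> odd q ->
  ~~ (3 %| q) -> 7 <= q -> b`! ^ k * k`! * q <= q`! ^ 3.
Proof.
move=> kb k5 b3 oq q3 q7.
have : 3 %| k * b by rewrite kb dvdn_mulr.
rewrite Euclid_dvdM // => /orP[] /dvdnP[l E].
  have ql : q = l * b.
    by apply/eqP; rewrite -(eqn_pmul2l (isT : 0 < 3)) -kb E; apply/eqP; clear; lia.
  rewrite E ql [l * 3]mulnC; apply: partition_ineq3k.
    by move: oq q3 k5; rewrite ql E; clear; case: l => [|[|[|[|[|l]]]]] //; [rewrite oddM | rewrite dvdn_mulr | rewrite oddM].
  by move: oq q3 b3; rewrite ql; clear; case: b => [|[|[|[|b]]]] //; rewrite ?dvdn_mull.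
have ql : q = k * l.
  by apply/eqP; rewrite -(eqn_pmul2l (isT : 0 < 3)) -kb E; apply/eqP; clear; lia.
rewrite E ql [l * 3]mulnC; have [l1|l2] := leqP l 1.
  have {l1}l1 : l = 1.
    by move: l1 b3; rewrite E; case: (l) => [|[|]].
  rewrite l1 !muln1; apply: partition_ineq1.
  by move: q7; rewrite ql l1 muln1.
rewrite -(subnKC k5); elim: (k - 5) => [|d IHd]; first by rewrite addn0 partition_ineq5.
by rewrite (addnS 5 d); apply: partition_ineq_step => //; rewrite leq_addr.
Qed.

Local Open Scope group_scope.

(** * Supports and Bochert's bound *)

Section Support.

Variable T : finType.
Implicit Types (s g h : {perm T}) (A B X : {set T}).

Definition supp s : {set T} := [set x | s x != x].

Lemma in_supp s x : (x \in supp s) = (s x != x).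
Proof. by rewrite inE. Qed.

Lemma mem_imperm s A x : (s x \in s @: A) = (x \in A).
Proof. by apply: mem_imset; apply: perm_inj. Qed.

Lemma mem_impermV s A x : (x \in s @: A) = (s^-1 x \in A).
Proof. by rewrite -{1}[x](permKV s) mem_imperm. Qed.

Lemma card_imperm s A : #|s @: A| = #|A|.
Proof. by rewrite card_imset //; apply: perm_inj. Qed.

Lemma imperm_eq s A : (s @: A == A) = (s @: A \subset A).
Proof. by rewrite eqEcard card_imperm leqnn andbT. Qed.

Lemma supp_eq0 s : (supp s == set0) = (s == 1).
Proof.
apply/eqP/eqP=> [s0 | ->]; last by apply/setP=> x; rewrite !inE perm1 eqxx.
apply/permP=> x; rewrite perm1; apply/eqP; apply/negPn; rewrite -in_supp s0.
by rewrite inE.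
Qed.

Lemma supp_gt0 s : (0 < #|supp s|) = (s != 1).
Proof. by rewrite lt0n cards_eq0 supp_eq0. Qed.

Lemma suppJ s h : supp (s ^ h) = h @: supp s.
Proof.
apply/setP=> x; rewrite -[x](permKV h) mem_imset; last exact: perm_inj.
by rewrite !inE permJ (inj_eq perm_inj).
Qed.

Lemma card_suppJ s h : #|supp (s ^ h)| = #|supp s|.
Proof. by rewrite suppJ card_imset //; apply: perm_inj. Qed.

Lemma suppV s : supp s^-1 = supp s.
Proof.
by apply/setP=> x; rewrite !inE (canF_eq (permKV s)) eq_sym.
Qed.

Lemma supp_stable s x : (s x \in supp s) = (x \in supp s).
Proof. by rewrite !inE (inj_eq perm_inj). Qed.

Lemma suppM s h : supp (s * h) \subset supp s :|: supp h.
Proof.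
apply/subsetP=> x; rewrite !inE permM -negb_and; apply: contra.
by case/andP=> /eqP-> /eqP->.
Qed.

Lemma suppX s k : supp (s ^+ k) \subset supp s.
Proof.
apply/subsetP=> x; rewrite !inE; apply: contra => /eqP sx.
by elim: k => [|k IHk]; rewrite ?expg0 ?perm1 // expgSr permM (eqP IHk) sx.
Qed.

Lemma supp_neq1 s : #|supp s| != 1%N.
Proof.
apply/negP=> /cards1P[x sx].
have xs : x \in supp s by rewrite sx set11.
by have := supp_stable s x; rewrite {1}sx xs in_set1 => sxx; rewrite in_supp sxx in xs.
Qed.

Lemma mem_symOn A s : (s \in perm.Sym A) = (supp s \subset A).
Proof.
by rewrite inE /perm_on; apply/subsetP/subsetP=> sA x; move/(_ x): sA; rewrite !inE.
Qed.

Lemma supp_commute g h x : commute g h -> (g x \in supp h) = (x \in supp h).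
Proof. by move=> cgh; rewrite !inE -!permM cgh permM (inj_eq perm_inj). Qed.

(** A point outside the three sets is moved by at most one of g and h, and its preimages under g and
    h lie outside I, so the factors of the commutator cancel. Small intersections of supports thus
    produce elements of small degree, at most 3 |I|. *)
Lemma supp_commg g h (I := supp g :&: supp h) :
  supp [~ g, h] \subset I :|: g @: I :|: h @: I.
Proof.
apply/subsetP=> y; apply: contraLR; rewrite !inE !negb_or -!in_supp.
move=> /andP[/andP[nyI nygI] nyhI]; rewrite in_supp negbK.
have ginv: g^-1 y \notin I by rewrite -mem_impermV.
have hinv: h^-1 y \notin I by rewrite -mem_impermV.
have fixV s x : x \notin supp s -> s^-1 x = x.
  by rewrite -suppV inE negbK => /eqP.
have fixs s x : x \notin supp s -> s x = x by rewrite inE negbK => /eqP.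
have memV s x : (s^-1 x \in supp s) = (x \in supp s).
  by rewrite -{2}[x](permKV s) supp_stable.
apply/eqP; rewrite commgEl /conjg !mulgA !permM.
have [ySg|ySg] := boolP (y \in supp g).
  have yh: y \notin supp h by move: nyI; rewrite ySg.
  have gyh: g^-1 y \notin supp h by move: ginv; rewrite inE memV ySg.
  by rewrite fixV // permKV fixs.
rewrite [g^-1 y]fixV //.
have hyg: h^-1 y \notin supp g.
  have [yh|yh] := boolP (y \in supp h); last by rewrite fixV.
  by move: hinv; rewrite inE memV yh andbT.
by rewrite [g _]fixs // permKV.
Qed.

(** If g and h commuted, g a would be another common point of the supports. *)
Lemma commg_supp1 g h a : supp g :&: supp h = [set a] ->
  [~ g, h] != 1 /\ #|supp [~ g, h]| <= 3.
Proof.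
move=> Ia.
have : a \in supp g :&: supp h by rewrite Ia set11.
rewrite inE => /andP[ag ah].
split.
  apply/negP=> /commgP cgh.
  have gah: g a \in supp g :&: supp h by rewrite inE supp_stable ag supp_commute.
  by move: gah ag; rewrite Ia !inE => ->.
apply: leq_trans (subset_leq_card (supp_commg g h)) _; rewrite Ia !imset_set1.
by rewrite -setUA cardsU1 cards2; lia.
Qed.

(** Only a lower bound for the minimal degree; that it is attained is a separate clause of
    [mindeg_ex]. *)
Definition mindeg (G : {set {perm T}}) m :=
  forall s, s \in G -> s != 1 -> m <= #|supp s|.

Lemma mindeg_inter1 (G : {group {perm T}}) g h : mindeg G 4 ->
  g \in G -> h \in G -> #|supp g :&: supp h| != 1%N.
Proof.
move=> dG gG hG; apply/negP=> /cards1P[a Ia].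
have [n1 le3] := commg_supp1 Ia.
by have := dG _ (groupR gG hG) n1; rewrite leqNgt ltnS le3.
Qed.

(** Take D maximal. If D had fewer than half of the points, its complement would be larger and so
    contain the support of some g != 1 in G. Adding to D a point d moved by g gives an h != 1
    supported in d |: D, which must move d, and the two supports share d alone. *)
Lemma bochert (G : {group {perm T}}) : mindeg G 4 ->
  exists2 D : {set T}, #|T| <= 2 * #|D| & G :&: perm.Sym D = 1.
Proof.
move=> dG.
pose P := [pred D : {set T} | G :&: perm.Sym D == 1].
have P0: P set0.
  rewrite /= -subG1; apply/subsetP=> s; rewrite inE mem_symOn subset0 supp_eq0.
  by rewrite inE => /andP[].
case: (arg_maxnP (fun D : {set T} => #|D|) P0) => D /eqP PD maxD.
exists D => //; rewrite leqNgt; apply/negP=> ltD.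
have cD: #|D| < #|~: D| by have := cardsC D; lia.
have /trivgPn[g /setIP[gG]]: G :&: perm.Sym (~: D) != 1.
  by apply/negP=> /maxD /=; rewrite leqNgt cD.
rewrite mem_symOn => gD; rewrite -supp_eq0 => /set0Pn[d dg].
have dD: d \notin D by move/subsetP: gD => /(_ d dg); rewrite inE.
have /trivgPn[h /setIP[hG]]: G :&: perm.Sym (d |: D) != 1.
  by apply/negP=> /maxD /=; rewrite cardsU1 dD; lia.
rewrite mem_symOn => hD h1.
have dh: d \in supp h.
  apply: contraR h1 => dh; suff: h \in G :&: perm.Sym D by rewrite PD => /set1P->.
  rewrite inE hG mem_symOn; apply/subsetP=> x xh; have := subsetP hD x xh.
  by rewrite !inE => /orP[/eqP xd|//]; rewrite -xd xh in dh.
have := mindeg_inter1 dG gG hG; suff ->: supp g :&: supp h = [set d] by rewrite cards1.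
apply/setP=> x; rewrite in_set1; apply/idP/eqP=> [|->]; last by rewrite inE dg.
rewrite inE => /andP[/(subsetP gD) xD /(subsetP hD)].
by move: xD; rewrite !inE => /negPf-> /orP[/eqP|].
Qed.

(** The product set of G and Sym(A) has at most |T|! elements. *)
Lemma card_symOn_bound (G : {group {perm T}}) A :
  (#|G| * #|A|`! <= #|G :&: perm.Sym A| * #|T|`!)%N.
Proof.
rewrite -(perm.card_Sym A) (mul_cardG G (perm.Sym_group A)) mulnC leq_mul2l.
by rewrite -alt.card_Sym subset_leq_card ?orbT ?subsetT.
Qed.

Lemma bochert_bound (G : {group {perm T}}) m : mindeg G 4 ->
  2 * m <= #|T|.+1 -> (#|G| * m`! <= #|T|`!)%N.
Proof.
move=> dG lem; have [D cD GD] := bochert dG.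
have := card_symOn_bound G D; rewrite GD cards1 mul1n; apply: leq_trans.
by rewrite leq_mul2l; apply/orP; right; apply: leq_fact; lia.
Qed.

End Support.

(** * Primitive groups containing a 3-cycle *)

Section Jordan.

Variable T : finType.
Implicit Types (s g h : {perm T}) (A B X : {set T}) (G : {group {perm T}}).

Definition c3 (x y z : T) : {perm T} := tperm x y * tperm x z.

Lemma c3J x y z g : c3 x y z ^ g = c3 (g x) (g y) (g z).
Proof. by rewrite conjMg !tpermJ. Qed.

Lemma c3V x y z : (c3 x y z)^-1 = c3 x z y.
Proof. by rewrite invMg !tpermV. Qed.

Lemma c3E x y z : x != y -> x != z -> y != z ->
  [/\ c3 x y z x = y, c3 x y z y = z, c3 x y z z = x &
      forall u, u \notin [:: x; y; z] -> c3 x y z u = u].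
Proof.
move=> xy xz yz; rewrite /c3 !permM tpermL tpermR [tperm x y z]tpermD //.
rewrite tpermD // 1?eq_sym // tpermL tpermR; split=> // u.
rewrite !inE !negb_or => /and3P[ux uy uz].
by rewrite permM !tpermD // eq_sym.
Qed.

Lemma c3rot x y z : x != y -> x != z -> y != z -> c3 x y z = c3 y z x.
Proof.
move=> xy xz yz; have [e1 e2 e3 e4] := c3E xy xz yz.
have zx : z != x by rewrite eq_sym.
have yx : y != x by rewrite eq_sym.
have [f1 f2 f3 f4] := c3E yz yx zx.
apply/permP=> u; have [uA|uA] := boolP (u \in [:: x; y; z]).
  by move: uA; rewrite !inE => /or3P[]/eqP->; rewrite ?e1 ?e2 ?e3.
rewrite e4 // f4 //; move: uA; rewrite !inE !negb_or.
by case/and3P=> -> -> ->.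
Qed.

Lemma supp3P s x : #|supp s| = 3 -> x \in supp s ->
  [/\ x != s x, x != s (s x), s x != s (s x), s = c3 x (s x) (s (s x)) &
      supp s = [set x; s x; s (s x)]].
Proof.
move=> s3 xs.
have xy : x != s x by rewrite eq_sym -in_supp.
have yz : s x != s (s x) by rewrite (inj_eq perm_inj).
have xz : x != s (s x).
  apply/negP=> /eqP xz.
  have D: [set x; s x] \subset supp s.
    by apply/subsetP=> u; rewrite !inE => /orP[]/eqP-> //; rewrite -in_supp ?supp_stable.
  have : #|supp s :\: [set x; s x]| = 1%N by rewrite cardsDS // s3 cards2 xy.
  move/eqP/cards1P=> [w Ew].
  have : w \in supp s :\: [set x; s x] by rewrite Ew set11.
  rewrite !inE negb_or => /andP[/andP[wx wsx] ws].
  have : s w \in supp s :\: [set x; s x].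
    rewrite in_setD supp_stable in_supp ws andbT !inE negb_or.
    by rewrite {1}xz !(inj_eq perm_inj) wsx wx.
  by rewrite Ew in_set1 (negPf ws).
have S: supp s = [set x; s x; s (s x)].
  apply/esym/eqP; rewrite eqEcard s3; apply/andP; split.
    apply/subsetP=> u; rewrite !inE -orbA => /or3P[]/eqP->;
    by rewrite -in_supp ?supp_stable.
  by rewrite -setUA cardsU1 cards2 !inE yz negb_or xy xz.
split=> //; have [e1 e2 e3 e4] := c3E xy xz yz.
have ssx: s (s (s x)) = x.
  have : s (s (s x)) \in supp s by rewrite !supp_stable.
  rewrite S !inE !(inj_eq perm_inj) -orbA.
  by rewrite [s (s x) == _]eq_sym [s x == _]eq_sym (negPf xz) (negPf xy) !orbF => /eqP.
apply/permP=> u; have [uA|uA] := boolP (u \in [:: x; s x; s (s x)]).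
  by move: uA; rewrite !inE => /or3P[]/eqP->; rewrite ?e1 ?e2 ?e3.
rewrite e4 //; apply/eqP/negPn; rewrite -in_supp S.
by move: uA; rewrite !inE orbA.
Qed.

Lemma supp2_odd s : #|supp s| = 2 -> odd_perm s.
Proof.
move=> s2; have [x xs] : exists x, x \in supp s by apply/set0Pn; rewrite -cards_eq0 s2.
have xy : x != s x by rewrite eq_sym -in_supp.
have S: supp s = [set x; s x].
  apply/esym/eqP; rewrite eqEcard s2 cards2 xy leqnn andbT.
  by apply/subsetP=> u; rewrite !inE => /orP[]/eqP->; rewrite -in_supp ?supp_stable.
suff -> : s = tperm x (s x) by rewrite odd_tperm.
have ssx: s (s x) = x.
  have : s (s x) \in supp s by rewrite !supp_stable.
  by rewrite S !inE (inj_eq perm_inj) [s x == _]eq_sym (negPf xy) orbF => /eqP.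
apply/permP=> u; case: tpermP => [-> | -> | ux uy] //.
by apply/eqP/negPn; rewrite -in_supp S !inE negb_or; apply/andP; split; apply/eqP.
Qed.

(** Multiplying s by the 3-cycle through s x, x and a third moved point z fixes x and moves no new
    point. Such a z exists because a permutation moving just two points is odd. *)
Lemma Alt_sub_c3 G :
  (forall x y z, x != y -> x != z -> y != z -> c3 x y z \in G) -> 'Alt_T \subset G.
Proof.
move=> G3; apply/subsetP=> s; rewrite Alt_even.
have [k] := ubnP #|supp s|; elim: k s => // k IHk s ltk es.
have [->|s1] := eqVneq s 1; first exact: group1.
have /set0Pn[x xs]: supp s != set0 by rewrite supp_eq0.
have xy : x != s x by rewrite eq_sym -in_supp.
have D: [set x; s x] \subset supp s.
  by apply/subsetP=> u; rewrite !inE => /orP[]/eqP->; rewrite -in_supp ?supp_stable.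
have /set0Pn[z]: supp s :\: [set x; s x] != set0.
  rewrite -cards_eq0 cardsDS // cards2 xy subn_eq0 -ltnNge ltn_neqAle.
  rewrite eq_sym; apply/andP; split.
    by apply: contra es => /eqP /supp2_odd.
  by have := subset_leq_card D; rewrite cards2 xy.
rewrite in_setD !inE negb_or => /andP[/andP[zx zy] zs].
have yx: s x != x by rewrite eq_sym.
have yz: s x != z by rewrite eq_sym.
have xz: x != z by rewrite eq_sym.
have [e1 e2 e3 e4] := c3E yx yz xz.
have tG := G3 _ _ _ yx yz xz; rewrite -(groupMr _ tG); apply: IHk.
  suff /subset_leq_card: supp (s * c3 (s x) x z) \subset supp s :\ x.
    by move: ltk; rewrite (cardsD1 x (supp s)) xs ltnS => lk le; apply: leq_ltn_trans le lk.
  apply/subsetP=> u; rewrite in_setD1 !in_supp permM.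
  have [->|ux] := eqVneq u x; first by rewrite e1 eqxx.
  apply: contra => /eqP su; rewrite su e4 // !inE !negb_or ux /=.
  apply/andP; split; apply/negP=> /eqP uE; move: su; rewrite uE.
    by move/perm_inj/eqP; rewrite (negPf yx).
  by apply/eqP.
by rewrite odd_permM (negPf es) odd_permM !odd_tperm yx yz.
Qed.

Definition is_block G X :=
  [forall g in G, (g @: X == X) || [disjoint g @: X & X]].

Definition prim G :=
  [transitive G, on [set: T] | 'P] &&
  [forall X, is_block G X ==> (#|X| <= 1) || (X == setT)].

Lemma prim_block G X : prim G -> is_block G X -> 1 < #|X| -> X = setT.
Proof.
by move=> /andP[_ /forallP/(_ X)/implyP pG] /pG /orP[|/eqP //]; rewrite leqNgt => /negP.
Qed.

Lemma nblockP G X : prim G -> 1 < #|X| -> X != setT ->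
  exists g x y, [/\ g \in G, x \in X, x \in g @: X, y \in g @: X & y \notin X].
Proof.
move=> pG X1 XT.
have /forall_inPn[g gG]: ~~ is_block G X.
  by apply: contra XT => bX; apply/eqP/(prim_block pG).
rewrite negb_or => /andP[gX /pred0Pn[x /= /andP[xg xX]]].
have /subsetPn[y yg yX]: ~~ (g @: X \subset X).
  by apply: contra gX => sX; rewrite eqEcard sX card_imset //=; apply: perm_inj.
by exists g, x, y.
Qed.

(** Take a largest set X of at least three points all of whose 3-cycles lie in G. If X were not
    everything, primitivity would give a translate g X that meets X and contains a point y outside
    X, and then y |: X would have the same property. *)
Lemma jordan3 G s : prim G -> s \in G -> #|supp s| = 3 -> 'Alt_T \subset G.
Proof.
move=> pG sG s3.
pose Q X := [forall x in X, forall y in X, forall z in X,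
   [&& x != y, x != z & y != z] ==> (c3 x y z \in G)].
have QP X : reflect (forall x y z, x \in X -> y \in X -> z \in X ->
    x != y -> x != z -> y != z -> c3 x y z \in G) (Q X).
  apply: (iffP forall_inP) => [qX x y z xX yX zX xy xz yz | qX x xX].
    by have /forall_inP/(_ y yX)/forall_inP/(_ z zX)/implyP := qX x xX; apply; rewrite xy xz.
  by apply/forall_inP=> y yX; apply/forall_inP=> z zX; apply/implyP=> /and3P[]; apply: qX.
pose P := [pred X : {set T} | (2 < #|X|) && Q X].
have P0: P (supp s).
  rewrite /= s3 /=; apply/QP=> x y z xs ys zs xy xz yz.
  have [n1 n2 n3 sE S] := supp3P s3 xs.
  move: ys zs; rewrite S !inE -!orbA.
  move=> /or3P[]/eqP yE /or3P[]/eqP zE; move: xy xz yz; rewrite yE zE ?eqxx // => _ _ _.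
    by rewrite -sE.
  by rewrite -c3V groupV -sE.
case: (arg_maxnP (fun X : {set T} => #|X|) P0) => X /andP[X2 /QP qX] maxX.
have [XT|XT] := eqVneq X setT.
  by apply: Alt_sub_c3 => x y z; apply: qX; rewrite XT inE.
have [g [x [y [gG xX xg yg yX]]]] := nblockP pG (ltnW X2) XT.
have qg u v w : u \in g @: X -> v \in g @: X -> w \in g @: X ->
    u != v -> u != w -> v != w -> c3 u v w \in G.
  move=> /imsetP[a aX ->] /imsetP[b bX ->] /imsetP[c cX ->].
  by rewrite !(inj_eq perm_inj) -c3J groupJr // => *; apply: qX.
have xy: x != y by apply: contraNneq yX => <-.
(* One 3-cycle through y and two points of X is enough: conjugation by the 3-cycles of X spreads it
   to all pairs. It is found inside g X if g X has a second point in X, and otherwise by conjugating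
   a 3-cycle of X through x with x -> y -> z. *)
have [a [b [aX bX ab abG]]]: exists a b, [/\ a \in X, b \in X, a != b & c3 a b y \in G].
  have /set0Pn[z]: (g @: X) :\: [set x; y] != set0.
    rewrite -cards_eq0 cardsDS ?cards2 ?xy; last first.
      by apply/subsetP=> u; rewrite !inE => /orP[]/eqP->.
    by rewrite card_imset; [lia | apply: perm_inj].
  rewrite !inE negb_or => /andP[/andP[zx zy] zg].
  have [zX|zX] := boolP (z \in X).
    by exists z, x; split=> //; apply: qg.
  have /card_gt1P[u [v [uX vX uv]]]: 1 < #|X :\ x| by move: X2; rewrite (cardsD1 x X) xX.
  move: uX vX; rewrite !inE => /andP[ux uX] /andP[vx vX].
  exists u, v; split=> //.
  have xz: x != z by rewrite eq_sym.
  have yz: y != z by rewrite eq_sym.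
  have [e1 e2 e3 e4] := c3E xy xz yz.
  have tG: c3 x y z \in G by apply: qg.
  have out w : w \in X -> w != x -> w \notin [:: x; y; z].
    by move=> wX wx; rewrite !inE !negb_or wx /=; apply/andP; split;
       [apply: contraNneq yX => <- | apply: contraNneq zX => <-].
  have ->: c3 u v y = c3 u v x ^ c3 x y z by rewrite c3J e1 !e4 ?out.
  by rewrite groupJr // qX.
have nX u : u \in X -> u != y by move=> uX; apply: contraNneq yX => <-.
have swp u v : u \in X -> v \in X -> u != v -> c3 u v y \in G -> c3 v u y \in G.
  move=> uX vX uv; have [uy vy] := (nX u uX, nX v vX).
  have [yu yv vu] : [/\ y != u, y != v & v != u] by split; rewrite eq_sym.
  by rewrite -groupV c3V c3rot // c3rot.
have stp u v w : u \in X -> v \in X -> w \in X -> u != v -> u != w ->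
    c3 u v y \in G -> c3 u w y \in G.
  move=> uX vX wX uv uw uvG; have [<-//|vw] := eqVneq v w.
  apply: (swp); rewrite 1?eq_sym //.
  have wv: w != v by rewrite eq_sym.
  have [e1 e2 e3 e4] := c3E uw uv wv.
  have yo: y \notin [:: u; w; v] by rewrite !inE !negb_or ![y == _]eq_sym !nX.
  have ->: c3 w u y = c3 u v y ^ c3 u w v by rewrite c3J e1 e3 (e4 y yo).
  by rewrite groupJr // qX.
have allG u v : u \in X -> v \in X -> u != v -> c3 u v y \in G.
  move=> uX vX uv; have [va|va] := eqVneq v a.
    move: uv; rewrite va => uv; apply: (swp); rewrite 1?eq_sym //.
    by apply: (stp) abG; rewrite // eq_sym.
  apply: (swp); rewrite 1?eq_sym //; apply: (stp v a u) => //; first by rewrite eq_sym.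
  by apply: (swp); rewrite 1?eq_sym //; apply: (stp) abG; rewrite // eq_sym.
have : P (y |: X).
  apply/andP; split; first by rewrite cardsU1 yX ltnS ltnW.
  apply/QP=> u v w; rewrite !in_setU1.
  move=> /predU1P[->|uX] /predU1P[->|vX] /predU1P[->|wX]; rewrite ?eqxx // => uv uw vw.
  - by rewrite c3rot // allG.
  - rewrite c3rot // c3rot 1?eq_sym // 1?eq_sym //; apply: allG => //.
    by rewrite eq_sym.
  - exact: allG.
  - exact: qX.
by move=> /maxX le; have : #|y |: X| <= #|X| := le; rewrite cardsU1 yX add1n ltnn.
Qed.

End Jordan.

(** * Stabilizers of block partitions *)

Section Transport.

Variables (U T : finType) (f : U -> T) (f' : T -> U).
Hypotheses (fK : cancel f f') (f'K : cancel f' f).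

Lemma transport_inj (p : {perm U}) : injective (fun x => f (p (f' x))).
Proof. by move=> x y /(can_inj fK)/perm_inj/(can_inj f'K). Qed.

Definition transport (p : {perm U}) : {perm T} := perm (@transport_inj p).

Lemma transportE p u : transport p (f u) = f (p u).
Proof. by rewrite permE fK. Qed.

Lemma transportM : {in setT &, {morph transport : p q / p * q}}.
Proof.
by move=> p q _ _; apply/permP=> x; rewrite -[x]f'K permM !transportE permM.
Qed.

Canonical transport_morphism := Morphism transportM.

Lemma injm_transport : 'injm transport.
Proof.
apply/injmP=> p q _ _ E; apply/permP=> u.
by apply: (can_inj fK); rewrite -!transportE E.
Qed.

Lemma odd_transport p : odd_perm (transport p) = odd_perm p.
Proof.
have [ts -> _] := prod_tpermP p; elim: ts => [|[x y] ts IHts].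
  by rewrite !big_nil (morph1 transport_morphism) !odd_perm1.
rewrite !big_cons transportM ?inE // !odd_permM IHts; congr (_ (+) _).
have -> : transport (tperm x y) = tperm (f x) (f y).
  apply/permP=> z; rewrite -[z]f'K transportE.
  have fI := can_inj fK.
  case: (tpermP x y) => [->|->|/eqP nx /eqP ny]; rewrite ?tpermL ?tpermR //.
  by rewrite tpermD // (inj_eq fI) eq_sym.
by rewrite !odd_tperm (inj_eq (can_inj fK)).
Qed.

End Transport.

Lemma mem_stabset (T : finType) (B : {set T}) (s : {perm T}) :
  (s \in 'N(B | 'P)) = (s @: B == B).
Proof.
by rewrite -astab1_set; apply/astab1P/eqP => /= sB; rewrite -[RHS]sB.
Qed.

Lemma setactP (T : finType) (B : {set T}) (s : {perm T}) : ('P^*)%act B s = s @: B.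
Proof. by []. Qed.

Lemma mem_stabpart (T : finType) (P : {set {set T}}) (s : {perm T}) :
  (s \in 'N(P | 'P^*)) = [forall B in P, s @: B \in P].
Proof.
apply/idP/forall_inP => [/astabsP sP B BP | sP]; first by rewrite -setactP sP.
by rewrite !inE /=; apply/subsetP=> B BP; rewrite inE; apply: sP.
Qed.

(** * Partitions into k blocks of size b *)

Section Uniform.

Variable T : finType.
Implicit Types (P : {set {set T}}) (B : {set T}) (s : {perm T}).

(** The condition [is_block_partition] over an arbitrary type of points; for ['I_n] the two are
    convertible. *)
Definition unif k b P :=
  [&& partition P [set: T], #|P| == k & [forall B in P, #|B| == b]].

Lemma unifP k b P : reflect [/\ partition P [set: T], #|P| = k &
  forall B, B \in P -> #|B| = b] (unif k b P).
Proof.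
apply: (iffP and3P) => [[pP /eqP cP /forall_inP bP] | [pP cP bP]]; split=> //.
- by move=> B /bP/eqP.
- exact/eqP.
by apply/forall_inP=> B /bP/eqP.
Qed.

Lemma unif_card k b P : unif k b P -> (k * b)%N = #|T|.
Proof.
case/unifP=> pP <- bP; rewrite -cardsT (card_partition pP).
by rewrite -sum_nat_const; apply: eq_bigr => B /bP->.
Qed.

Lemma part_ex P x : partition P [set: T] -> exists2 B, B \in P & x \in B.
Proof.
move=> pP; exists (pblock P x).
  by rewrite pblock_mem // (cover_partition pP) inE.
by rewrite mem_pblock (cover_partition pP) inE.
Qed.

Lemma part_uniq P A B x : partition P [set: T] -> A \in P -> B \in P ->
  x \in A -> x \in B -> A = B.
Proof.
case/and3P=> _ tP _ AP BP xA xB.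
by rewrite -(def_pblock tP AP xA) (def_pblock tP BP xB).
Qed.

(** Numbering the blocks, and the points in each block, identifies T with a k by b grid. The last
    clause says that the blocks are the rows, without naming the block of index i. *)
Lemma unif_coord k b P (x0 : T) : unif k b P ->
  exists (f : 'I_k * 'I_b -> T) (f' : T -> 'I_k * 'I_b),
    [/\ cancel f f', cancel f' f &
        forall i j B, B \in P -> f (i, j) \in B -> forall z, f z \in B = (z.1 == i)].
Proof.
move=> uP; have [pP cP bP] := unifP _ _ _ uP.
pose Bl i := nth set0 (enum P) i.
have BlP i : i < k -> Bl i \in P.
  by move=> ik; rewrite -mem_enum mem_nth // -cardE cP.
pose f (z : 'I_k * 'I_b) := nth x0 (enum (Bl z.1)) z.2.
have fB z : f z \in Bl z.1.
  by rewrite -mem_enum mem_nth // -cardE bP ?BlP.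
have BlE i i' : i < k -> i' < k -> Bl i = Bl i' -> i = i'.
  move=> ik ik' /eqP; rewrite nth_uniq ?enum_uniq -?cardE ?cP //.
  by move/eqP.
have fI : injective f.
  move=> [i j] [i' j'] E.
  have ii: i = i'.
    apply/val_inj/(BlE _ _ (ltn_ord i) (ltn_ord i')).
    apply: (part_uniq pP (BlP _ (ltn_ord i)) (BlP _ (ltn_ord i')) (fB (i, j))).
    by rewrite E; apply: (fB (i', j')).
  move: E; rewrite -ii /f /= => /eqP.
  rewrite nth_uniq ?enum_uniq -?cardE ?bP ?BlP //.
  by move/eqP/val_inj->.
have cT : #|T| <= #|{: 'I_k * 'I_b}| by rewrite card_prod !card_ord (unif_card uP).
have [f' fK f'K] := inj_card_bij fI cT.
exists f, f'; split=> // i j B BP fzB z.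
have BE: B = Bl i.
  exact: (part_uniq pP BP (BlP _ (ltn_ord i)) fzB (fB (i, j))).
apply/idP/eqP=> [zB | zi]; last by rewrite BE -zi fB.
apply/val_inj/(BlE _ _ (ltn_ord z.1) (ltn_ord i)).
apply: (part_uniq pP (BlP _ (ltn_ord z.1)) (BlP _ (ltn_ord i)) (fB z)).
by rewrite -BE.
Qed.

Lemma wreath_coord k b P (f : 'I_k * 'I_b -> T) f' (fK : cancel f f') (f'K : cancel f' f) :
  unif k b P ->
  (forall i j B, B \in P -> f (i, j) \in B -> forall z, f z \in B = (z.1 == i)) ->
  0 < b ->
  forall p, (transport fK f'K p \in 'N(P | 'P^*)) = (p \in wreath 'I_b 'I_k).
Proof.
move=> uP fP b0 p; have [pP cP bP] := unifP _ _ _ uP.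
set t := transport _ _ p.
pose j0 := Ordinal b0.
have tE z : t (f z) = f (p z) by apply: transportE.
rewrite mem_stabpart inE; apply/forall_inP/existsP=> [tP | [s /existsP[g /forallP pE]] B BP].
  have key z z' : z.1 = z'.1 -> (p z).1 = (p z').1.
    move=> zz; have [B BP zB] := part_ex (f z) pP.
    have tB := tP B BP.
    have z'B: f z' \in B by rewrite (fP z.1 z.2 B BP) -?surjective_pairing ?zz.
    have := fP (p z).1 (p z).2 _ tB; rewrite -surjective_pairing -tE mem_imperm => /(_ zB (p z')).
    by rewrite -tE mem_imperm z'B => /esym/eqP.
  pose s0 i := (p (i, j0)).1.
  have s0I : injective s0.
    suff : forall y, exists x, s0 x = y.
      move=> sur; have ysur y : y \in codom s0.
        by have [x <-] := sur y; apply: codom_f.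
      apply/injectiveP/card_uniqP; rewrite size_map -cardT.
      by apply: eq_card => y; rewrite ysur.
    move=> y; exists (p^-1 (y, j0)).1.
    by rewrite /s0 (key _ (p^-1 (y, j0))) //= permKV.
  pose g0 i j := (p (i, j)).2.
  have g0I i : injective (g0 i).
    move=> j j' E; suff : (i, j) = (i, j') by case.
    apply: (@perm_inj _ p); rewrite [LHS]surjective_pairing [RHS]surjective_pairing.
    by rewrite -/(g0 i j) E (key (i, j) (i, j')).
  exists (perm s0I); apply/existsP; exists [ffun i => perm (@g0I i)].
  apply/forallP=> -[i j]; rewrite ffunE !permE /= /s0 (key _ (i, j)) //.
  by rewrite -surjective_pairing.
have {}pE z : p z = (s z.1, g z.1 z.2) by apply/eqP.
have [x xB] : exists x, x \in B by apply/set0Pn; rewrite -cards_eq0 bP // -lt0n.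
have xE : x = f ((f' x).1, (f' x).2) by rewrite -surjective_pairing f'K.
have [C CP tC] := part_ex (t x) pP.
suff -> : t @: B = C by [].
have fBi := fP _ _ _ BP (etrans (congr1 _ (esym xE)) xB).
rewrite xE tE -surjective_pairing [p _]surjective_pairing in tC.
have fCi := fP _ _ _ CP tC.
apply/setP=> y; rewrite mem_impermV -[y]f'K fCi.
rewrite -[f' y](permKV p); set z := p^-1 _.
by rewrite -tE permK fBi !pE /= (inj_eq perm_inj).
Qed.

End Uniform.

Lemma card_wreath k b : 0 < b -> #|wreath 'I_b 'I_k| = (k`! * b`! ^ k)%N.
Proof.
move=> b0; pose F (u : {perm 'I_k} * {ffun 'I_k -> {perm 'I_b}}) (z : 'I_k * 'I_b) :=
  (u.1 z.1, u.2 z.1 z.2).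
have FI u : injective (F u).
  move=> [i j] [i' j'] [/perm_inj ii]; rewrite /= ii => /perm_inj jj.
  by rewrite jj.
pose h u := perm (@FI u).
have hI : injective h.
  move=> [s g] [s' g'] E.
  have E' z : F (s, g) z = F (s', g') z by rewrite -!(permE (@FI _)) -!/(h _) E.
  congr pair.
    by apply/permP=> i; have [] := E' (i, Ordinal b0).
  apply/ffunP=> i; apply/permP=> j; have [_] := E' (i, j); exact.
have -> : wreath 'I_b 'I_k = h @: setT.
  apply/setP=> p; rewrite inE; apply/existsP/imsetP=> [[s /existsP[g /forallP pE]] | [[s g] _ ->]].
    by exists (s, g); rewrite ?inE //; apply/permP=> z; rewrite permE; apply/eqP.
  by exists s; apply/existsP; exists g; apply/forallP=> z; rewrite permE.
rewrite card_imset // cardsT card_prod card_ffun card_ord.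
have cS m : #|{: {perm 'I_m}}| = m`!.
  by rewrite -[in RHS](card_ord m) -alt.card_Sym cardsT.
by rewrite !cS.
Qed.

Section Uniform2.

Variable T : finType.
Implicit Types (P : {set {set T}}) (B : {set T}) (s : {perm T}).

Lemma stabpart_isog k b P : 0 < #|T| -> unif k b P ->
  'N(P | 'P^*) :&: 'Alt_T \isog wreath 'I_b 'I_k :&: 'Alt_('I_k * 'I_b) /\
  #|'N(P | 'P^*)| = (k`! * b`! ^ k)%N.
Proof.
move=> /card_gt0P[x0 _] uP; have [f [f' [fK f'K fP]]] := unif_coord x0 uP.
have b0 : 0 < b by apply: leq_ltn_trans (ltn_ord (f' x0).2).
have wE := wreath_coord fK f'K uP fP b0.
set t := transport_morphism fK f'K.
have inj := injm_transport fK f'K.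
have surj s : exists p, t p = s.
  have fI := can_inj fK; exists (transport f'K fK s); apply/permP=> x.
  by rewrite -[x]f'K /= transportE transportE !f'K.
have tI : {in setT &, injective t} by apply/injmP.
have imE (A : {set {perm 'I_k * 'I_b}}) (C : {set {perm T}}) :
    (forall p, (t p \in C) = (p \in A)) -> t @* A = C.
  move=> AC; rewrite morphimE setTI; apply/setP=> s; apply/imsetP/idP.
    by case=> p pA ->; rewrite AC.
  by have [p <-] := surj s; rewrite AC => pA; exists p.
split; last first.
  rewrite -(card_wreath k b0) -(imE _ _ wE) card_injm ?subsetT //.
have -> : 'N(P | 'P^*) :&: 'Alt_T = t @* (wreath 'I_b 'I_k :&: 'Alt_('I_k * 'I_b)).
  apply/esym/imE => p; rewrite in_setI [in RHS]in_setI; congr (_ && _); first exact: wE.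
  by rewrite !Alt_even /= odd_transport.
by rewrite isog_sym sub_isog ?subsetT.
Qed.

Lemma unif_orbit k b P P' : unif k b P -> unif k b P' ->
  exists s : {perm T}, P' = [set s @: (B : {set T}) | B in P].
Proof.
move=> uP uP'.
(* The coordinates need a point of T as a default value; when T is empty both partitions are
   empty. *)
have [T0|/card_gt0P[x0 _]] := posnP #|T|.
  have P0 Q : partition Q [set: T] -> Q = set0.
    case/and3P=> _ _ nQ; apply/setP=> B; rewrite inE.
    apply: contraNF nQ => BQ; suff <- : B = set0 by [].
    by apply/setP=> x; have := fintype0 x T0.
  have [pP _ _] := unifP _ _ _ uP; have [pP' _ _] := unifP _ _ _ uP'.
  by exists 1; rewrite (P0 _ pP) (P0 _ pP') imset0.
have [f [f' [fK f'K fP]]] := unif_coord x0 uP.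
have [g [g' [gK g'K gP]]] := unif_coord x0 uP'.
have hI : injective (fun x => g (f' x)) by move=> x y /(can_inj gK)/(can_inj f'K).
exists (perm hI).
have [pP cP bP] := unifP _ _ _ uP; have [pP' cP' bP'] := unifP _ _ _ uP'.
apply/esym/eqP; rewrite eqEcard cP' card_imset ?cP ?leqnn ?andbT; last first.
  by apply: imset_inj; apply: perm_inj.
have b0 : 0 < b by apply: leq_ltn_trans (ltn_ord (f' x0).2).
apply/subsetP=> _ /imsetP[B BP ->].
have [x xB] : exists x, x \in B by apply/set0Pn; rewrite -cards_eq0 bP // -lt0n.
have xE : x = f ((f' x).1, (f' x).2) by rewrite -surjective_pairing f'K.
have [C CP gC] := part_ex (g (f' x)) pP'.
suff -> : perm hI @: B = C by [].
have fBi := fP _ _ _ BP (etrans (congr1 _ (esym xE)) xB).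
rewrite [f' x]surjective_pairing in gC.
have gCi := gP _ _ _ CP gC.
apply/setP=> y; rewrite -[y](permKV (perm hI)) mem_imperm permE gCi.
by rewrite -fBi f'K.
Qed.

Lemma unif_im k b P s : unif k b P -> unif k b (('P^*^*)%act P s).
Proof.
move=> uP; have [pP cP bP] := unifP _ _ _ uP; apply/unifP; split.
- apply/and3P; split.
  + rewrite eqEsubset subsetT; apply/subsetP=> x _.
    have [B BP xB] := part_ex (s^-1 x) pP.
    by apply/bigcupP; exists (s @: B); [apply: imset_f | rewrite mem_impermV].
  + apply/trivIsetP=> _ _ /imsetP[A AP ->] /imsetP[B BP ->] AB.
    rewrite /= !setactP; apply/pred0P=> x /=; apply/negP=> /andP[].
    rewrite !mem_impermV => xA xB.
    by rewrite (part_uniq pP AP BP xA xB) eqxx in AB.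
  + apply/imsetP=> -[B BP] /esym/eqP; rewrite setactP imset_eq0 => /eqP B0.
    by case/and3P: pP; rewrite -B0 BP.
- by rewrite card_imset //; apply: imset_inj; apply: perm_inj.
by move=> _ /imsetP[B BP ->]; rewrite setactP card_imset ?bP //; apply: perm_inj.
Qed.

Lemma card_unif k b P : 0 < #|T| -> unif k b P ->
  (#|[set Q : {set {set T}} | unif k b Q]| * (k`! * b`! ^ k) = #|T|`!)%N.
Proof.
move=> T0 uP; have [_ <-] := stabpart_isog T0 uP.
have -> : [set Q : {set {set T}} | unif k b Q] = orbit ('P^*^*)%act 'Sym_T P.
  apply/setP=> Q; rewrite inE; apply/idP/orbitP => [uQ | [s _ <-]].
    by have [s ->] := unif_orbit uP uQ; exists s; rewrite ?inE.
  exact: unif_im.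
rewrite -alt.card_Sym mulnC.
have <- : 'C_('Sym_T)[P | 'P^*^*] = 'N(P | 'P^*) by rewrite astab1_set setTI.
by rewrite mulnC card_orbit_stab.
Qed.

End Uniform2.

(** * Maximality of the stabilizers *)

Section Systems.

Variable T : finType.
Implicit Types (P Q : {set {set T}}) (X B : {set T}) (s g h : {perm T}).
Implicit Types (G K H : {group {perm T}}).

Lemma transP G (x0 : T) :
  reflect (forall x y, exists2 g, g \in G & g x = y) [transitive G, on [set: T] | 'P].
Proof.
apply: (iffP idP) => [tG x y | tG].
  by have [g gG ->] := atransP2 tG (in_setT x) (in_setT y); exists g.
apply/imsetP; exists x0; rewrite ?inE //; apply/esym/setP=> y; rewrite inE.
by have [g gG <-] := tG x0 y; apply/orbitP; exists g.
Qed.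

Lemma blockP G X : reflect (forall g x, g \in G -> x \in X -> g x \in X -> g @: X = X)
  (is_block G X).
Proof.
apply: (iffP forall_inP) => [bX g x gG xX gxX | bX g gG].
  case/orP: (bX g gG) => [/eqP // | /pred0P/(_ (g x))].
  by rewrite /= mem_imperm xX gxX.
have [//|ne] := boolP (g @: X == X); apply/pred0P=> y /=; apply/negP=> /andP[].
by case/imsetP=> x xX -> gx; rewrite (bX g x) ?eqxx in ne.
Qed.

Lemma blockJ G X h : h \in G -> is_block G X -> is_block G (h @: X).
Proof.
move=> hG /blockP bX; apply/blockP=> g _ gG /imsetP[x xX ->].
rewrite mem_impermV -!permM => hx.
have := bX (h * (g * h^-1)) x; rewrite !groupM ?groupV // => /(_ isT xX).
move=> /(_ hx) E; rewrite -[in RHS]E -!imset_comp.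
by apply: eq_imset => y /=; rewrite !permM permKV.
Qed.

(** The blocks are the translates of a set X that violates primitivity; transitivity makes them
    cover T. *)
Lemma trans_nprim G (x0 : T) : [transitive G, on [set: T] | 'P] -> ~~ prim G ->
  exists k b P, [/\ unif k b P, G \subset 'N(P | 'P^*), 1 < k & 1 < b].
Proof.
move=> tG; rewrite /prim tG /= negb_forall => /existsP[X].
rewrite negb_imply negb_or -ltnNge => /and3P[bX X1 XT].
have [x xX] : exists x, x \in X by apply/set0Pn; rewrite -card_gt0 ltnW.
have {}tG := elimT (transP G x0) tG; have bX' := elimT (blockP G X) bX.
pose P := [set (g : {perm T}) @: X | g in G].
have PE g h y : g \in G -> h \in G -> y \in g @: X -> y \in h @: X -> g @: X = h @: X.
  move=> gG hG; rewrite !mem_impermV => yg yh.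
  have E := bX' (g * h^-1) (g^-1 y).
  rewrite groupM ?groupV // permM permKV in E.
  have {}E := E isT yg yh.
  rewrite -[in RHS]E -imset_comp; apply: eq_imset => z /=.
  by rewrite permM permKV.
have cP B : B \in P -> #|B| = #|X|.
  by case/imsetP=> g gG ->; rewrite card_imset //; apply: perm_inj.
have pP : partition P [set: T].
  apply/and3P; split.
  - rewrite eqEsubset subsetT; apply/subsetP=> y _.
    have [g gG gx] := tG x y; apply/bigcupP; exists (g @: X); first exact: imset_f.
    by rewrite -gx mem_imperm.
  - apply/trivIsetP=> _ _ /imsetP[g gG ->] /imsetP[h hG ->] gh.
    apply/pred0P=> y /=; apply/negP=> /andP[yg yh].
    by rewrite (PE g h y) ?eqxx in gh.
  by apply/negP=> /cP; rewrite cards0 => E; rewrite -E in X1.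
have uP : unif #|P| #|X| P by apply/unifP.
exists #|P|, #|X|, P; split=> //.
  apply/subsetP=> g gG; rewrite mem_stabpart; apply/forall_inP=> _ /imsetP[h hG ->].
  apply/imsetP; exists (h * g); rewrite ?groupM // -imset_comp.
  by apply: eq_imset => y /=; rewrite permM.
have := unif_card uP; have : #|X| < #|T|.
  by rewrite -cardsT; apply: proper_card; rewrite properT.
by case: #|P| => [|[|?]] //; lia.
Qed.

Lemma ntrans_stab G (x0 : T) : ~~ [transitive G, on [set: T] | 'P] ->
  exists B, [/\ G \subset 'N(B | 'P), B != set0 & B != setT].
Proof.
move=> ntG; exists (orbit 'P G x0); split.
- by apply: acts_orbit; apply: subsetT.
- by apply/set0Pn; exists x0; apply: orbit_refl.
by apply: contra ntG => /eqP E; apply/imsetP; exists x0; rewrite ?inE.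
Qed.

Lemma stabsetC G B : G \subset 'N(B | 'P) -> G \subset 'N(~: B | 'P).
Proof. by rewrite astabsC. Qed.

Lemma acts_mem B s x : s \in 'N(B | 'P) -> (s x \in B) = (x \in B).
Proof. by rewrite mem_stabset => /eqP sB; rewrite -{1}sB mem_imperm. Qed.

Lemma supp_stabset s B : supp s \subset B -> s \in 'N(B | 'P).
Proof.
move=> sB; rewrite mem_stabset imperm_eq.
apply/subsetP=> _ /imsetP[x xB ->].
have [xs|] := boolP (x \in supp s); last by rewrite inE negbK => /eqP->.
by apply: (subsetP sB); rewrite supp_stable.
Qed.

Lemma supp_stabset' s B : [disjoint supp s & B] -> s \in 'N(B | 'P).
Proof.
move=> dB; rewrite -astabsC; apply: supp_stabset.
by rewrite subsets_disjoint setCK.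
Qed.

Lemma supp_tperm (x y : T) : supp (tperm x y) \subset [set x; y].
Proof.
apply/subsetP=> z; rewrite !inE; case: tpermP => [->|->|]; rewrite ?eqxx ?orbT //.
Qed.

Lemma supp_c3 (x y z : T) : supp (c3 x y z) \subset [set x; y; z].
Proof.
apply: subset_trans (suppM _ _) _; rewrite subUset.
apply/andP; split; apply: subset_trans (supp_tperm _ _) _;
by apply/subsetP=> u; rewrite !inE => /orP[]->; rewrite ?orbT.
Qed.

Lemma card_supp_c3 (x y z : T) : x != y -> x != z -> y != z -> #|supp (c3 x y z)| = 3.
Proof.
move=> xy xz yz; have [e1 e2 e3 _] := c3E xy xz yz.
suff -> : supp (c3 x y z) = [set x; y; z].
  by rewrite -setUA cardsU1 cards2 !inE negb_or xy xz yz.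
apply/eqP; rewrite eqEsubset supp_c3; apply/subsetP=> u; rewrite !inE -orbA.
by case/or3P=> /eqP->; rewrite ?e1 ?e2 ?e3 // eq_sym.
Qed.

Lemma c3_even (x y z : T) : x != y -> x != z -> c3 x y z \in 'Alt_T.
Proof. by move=> xy xz; rewrite Alt_even odd_permM !odd_tperm xy xz. Qed.

Lemma ex_outside X (A : {set T}) : #|A| < #|X| -> exists2 x, x \in X & x \notin A.
Proof.
move=> AX; have /subsetPn[x xX xA] : ~~ (X \subset A).
  by apply: contraL AX => /subset_leq_card; rewrite leqNgt.
by exists x.
Qed.

Lemma ex_seq_outside X (l : seq T) : size l < #|X| -> exists2 x, x \in X & x \notin l.
Proof.
move=> lX; have [|x xX] := @ex_outside X [set y in l].
  by apply: leq_ltn_trans lX; rewrite cardsE card_size.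
by rewrite inE => xl; exists x.
Qed.

Lemma block_half G X : [transitive G, on [set: T] | 'P] -> is_block G X ->
  #|T| < 2 * #|X| -> X = setT.
Proof.
move=> tG bX X2; have [x xX] : exists x, x \in X by apply/set0Pn; rewrite -card_gt0; lia.
have {}tG := elimT (transP G x) tG.
apply/setP=> y; rewrite inE; have [g gG <-] := tG x y.
have /orP[/eqP E|dX] := forall_inP bX g gG; first by rewrite -E mem_imperm.
have : #|g @: X :|: X| <= #|T| by rewrite -cardsT subset_leq_card ?subsetT.
rewrite cardsU (eqP (_ : g @: X :&: X == set0)) ?setI_eq0 // cards0.
by rewrite card_imset; [lia | apply: perm_inj].
Qed.

(* The 3-cycle fixes u, hence maps the block X to itself. *)
Lemma block_grow G X u v w z : is_block G X -> u \in X -> v \in X ->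
  v != w -> v != z -> w != z -> u \notin [:: v; w; z] -> c3 v w z \in G -> w \in X.
Proof.
move=> /blockP bX uX vX vw vz wz uo cG; have [e1 _ _ e4] := c3E vw vz wz.
have <- : c3 v w z @: X = X by apply: (bX _ u); rewrite ?e4.
by rewrite -{1}e1 mem_imperm.
Qed.

Section MaxSet.

Variable B : {set T}.
Hypotheses (B0 : B != set0) (B2 : 2 * #|B| < #|T|) (T7 : 6 < #|T|).

Let C := ~: B.
Let C4 : 3 < #|C|.
Proof. by have := cardsC B; rewrite -/C; lia. Qed.

Let C2 : #|T| < 2 * #|C|.
Proof. by have := cardsC B; rewrite -/C; lia. Qed.

Let c3C x y z : x \in C -> y \in C -> z \in C -> x != y -> x != z ->
  c3 x y z \in 'N_('Alt_T)(B | 'P).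
Proof.
move=> xC yC zC xy xz; rewrite inE c3_even //=; apply: supp_stabset'.
rewrite disjoints_subset; apply: subset_trans (supp_c3 _ _ _) _.
by apply/subsetP=> u; rewrite !inE -orbA => /or3P[]/eqP->; rewrite -in_setC.
Qed.

(** An overgroup K is transitive, since every point can be carried into the complement C of B. It is
    primitive: a block with two points can be moved so as to meet C, and then the 3-cycles on C drag
    all of C into it, which is more than half of the points. As K contains 3-cycles, [jordan3]
    applies. *)
Lemma stabset_maximal : maximal 'N_('Alt_T)(B | 'P) 'Alt_T.
Proof.
set N := 'N_('Alt_T)(B | 'P).
have /set0Pn[b0 b0B] := B0.
have [c0 c0C _] := @ex_seq_outside C [::] (ltn_trans (isT : 0 < 3) C4).
have b0c0 : b0 != c0 by apply: contraTneq c0C => <-; rewrite inE b0B.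
have [c1 c1C] := @ex_seq_outside C [:: c0] (ltn_trans (isT : 1 < 3) C4).
rewrite inE => c10; have c01 : c0 != c1 by rewrite eq_sym.
have b0c1 : b0 != c1 by apply: contraTneq c1C => <-; rewrite inE b0B.
apply/maxgroupP; split.
  apply/properP; split; first exact: subsetIl.
  exists (c3 b0 c0 c1); first exact: c3_even.
  have [e1 _ _ _] := c3E b0c0 b0c1 c01.
  rewrite inE negb_and; apply/orP; right; apply/negP=> /(acts_mem b0).
  by rewrite e1 b0B => c0B; rewrite inE c0B in c0C.
move=> K /andP[KA nAK] NK; apply/eqP; rewrite eqEsubset NK andbT subsetI KA /=.
apply/negPn/negP=> nKB; case/negP: nAK.
have [k kK] := subsetPn nKB; rewrite mem_stabset => kB.
have [b1 b1B kb1] : exists2 b1, b1 \in B & k b1 \in C.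
  have : ~~ (k @: B \subset B).
    by apply: contra kB => ss; rewrite eqEcard ss card_imset ?leqnn //; apply: perm_inj.
  by case/subsetPn=> _ /imsetP[b bB ->] kb; exists b; rewrite ?inE.
have toC x : exists2 g, g \in K & g x \in C.
  have [xC|] := boolP (x \in C); first by exists 1; rewrite ?perm1 ?group1.
  rewrite inE negbK => xB; have [->|xb1] := eqVneq x b1; first by exists k.
  (* The transposition inside C makes the exchange of x and b1 even. *)
  pose t := tperm x b1 * tperm c0 c1.
  have xc : (x != c0) && (x != c1) by apply/andP; split; apply: contraTneq xB => ->; rewrite -in_setC.
  have bc : (b1 != c0) && (b1 != c1) by apply/andP; split; apply: contraTneq b1B => ->; rewrite -in_setC.
  exists (t * k).
    rewrite groupM //; apply: (subsetP NK).
    rewrite inE Alt_even odd_permM !odd_tperm xb1 c01 /= groupM //.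
      apply: supp_stabset; apply: subset_trans (supp_tperm _ _) _.
      by apply/subsetP=> u; rewrite !inE => /orP[]/eqP->.
    apply: supp_stabset'; rewrite disjoints_subset; apply: subset_trans (supp_tperm _ _) _.
    by apply/subsetP=> u; rewrite !inE => /orP[]/eqP->; rewrite -in_setC.
  case/andP: bc => bc0 bc1.
  by rewrite !permM tpermL tpermD 1?eq_sym.
have inC x y : x \in C -> y \in C -> exists2 g, g \in K & g x = y.
  move=> xC yC; have [->|xy] := eqVneq x y; first by exists 1; rewrite ?perm1 ?group1.
  have [z zC] := @ex_seq_outside C [:: x; y] (ltn_trans (isT : 2 < 3) C4).
  rewrite !inE negb_or => /andP[zx zy]; rewrite eq_sym in zx; rewrite eq_sym in zy.
  exists (c3 x y z); first by apply: (subsetP NK); apply: c3C.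
  by have [->] := c3E xy zx zy.
have tK : [transitive K, on [set: T] | 'P].
  apply/(transP K b0) => x y; have [g gK gx] := toC x; have [h hK hy] := toC y.
  have [f fK fE] := inC _ _ gx hy; exists (g * f * h^-1); rewrite ?groupM ?groupV //.
  by rewrite !permM fE permK.
have pK : prim K.
  rewrite /prim tK; apply/forallP=> X; apply/implyP=> bX.
  have [//|X1] := leqP #|X| 1; apply/eqP.
  have [x xX] : exists x, x \in X by apply/set0Pn; rewrite -card_gt0 ltnW.
  have [g gK ] := toC x; set u := g x => uC.
  have := blockJ gK bX; set Y := g @: X => bY.
  have uY : u \in Y by rewrite mem_imperm.
  suff YT : #|T| < 2 * #|Y|.
    have cXY : #|Y| = #|X| by rewrite card_imperm.
    by apply: (block_half tK bX); rewrite -cXY.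
  have Y1 : 1 < #|Y| by rewrite card_imperm.
  suff CY : C \subset Y by apply: leq_trans C2 _; rewrite leq_mul2l subset_leq_card.
  have [v vY vu] := @ex_seq_outside Y [:: u] Y1.
  rewrite inE in vu; have uv : u != v by rewrite eq_sym.
  have [w [wY wC wu]] : exists w, [/\ w \in Y, w \in C & w != u].
    have [vC|] := boolP (v \in C); first by exists v.
    rewrite inE negbK => vB.
    have [w wC] := @ex_seq_outside C [:: u] (ltn_trans (isT : 1 < 3) C4).
    rewrite inE => wu; have uw : u != w by rewrite eq_sym.
    have [z zC] := @ex_seq_outside C [:: u; w] (ltn_trans (isT : 2 < 3) C4).
    rewrite !inE negb_or => /andP[zu zw]; rewrite eq_sym in zu; rewrite eq_sym in zw.
    exists w; split=> //; apply: (block_grow bY vY uY uw zu zw).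
      rewrite !inE !negb_or vu /=.
      by apply/andP; split; apply: contraTneq vB => ->; rewrite -in_setC.
    by apply: (subsetP NK); apply: c3C.
  have uw : u != w by rewrite eq_sym.
  apply/subsetP=> y yC; have [->//|yu] := eqVneq y u; have [->//|yw] := eqVneq y w.
  have [z zC] := @ex_seq_outside C [:: u; w; y] C4.
  rewrite !inE !negb_or => /and3P[zu zw zy].
  rewrite eq_sym in yw; rewrite eq_sym in zw; rewrite eq_sym in zy.
  apply: (block_grow bY uY wY yw zw zy).
    by rewrite !inE !negb_or uw eq_sym yu eq_sym.
  by apply: (subsetP NK); apply: c3C.
have [c2 c2C] := @ex_seq_outside C [:: c0; c1] (ltn_trans (isT : 2 < 3) C4).
rewrite !inE negb_or => /andP[c20 c21]; rewrite eq_sym in c20; rewrite eq_sym in c21.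
apply: (jordan3 pK _ (card_supp_c3 c01 c20 c21)).
by apply: (subsetP NK); apply: c3C.
Qed.

End MaxSet.

End Systems.

(** * Overgroups of the stabilizer of a block partition *)

Section MaxPart.

Variable T : finType.
Implicit Types (P Q : {set {set T}}) (X B : {set T}) (s g h : {perm T}).
Implicit Types (G K H : {group {perm T}}).

Lemma supp_stabpart P B s : partition P [set: T] -> B \in P -> supp s \subset B ->
  s \in 'N(P | 'P^*).
Proof.
move=> pP BP sB; rewrite mem_stabpart; apply/forall_inP=> B' B'P.
suff : s \in 'N(B' | 'P) by rewrite mem_stabset => /eqP->.
have [->|BB'] := eqVneq B' B; first exact: supp_stabset.
apply: supp_stabset'; apply/pred0P=> x /=; apply/negP=> /andP[/(subsetP sB) xB xB'].
by rewrite (part_uniq pP BP B'P xB xB') eqxx in BB'.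
Qed.

Lemma swap_blocks k b P B1 B2 : unif k b P -> B1 \in P -> B2 \in P -> B1 != B2 ->
  exists h, [/\ h \in 'N(P | 'P^*), h @: B1 = B2 &
                forall x, x \notin B1 -> x \notin B2 -> h x = x].
Proof.
move=> uP B1P B2P B12; have [pP cP bP] := unifP _ _ _ uP.
have dj x : x \in B1 -> x \notin B2.
  by move=> x1; apply/negP=> x2; rewrite (part_uniq pP B1P B2P x1 x2) eqxx in B12.
(* [m A C] matches the points of A with those of C in the order of their enumerations. *)
pose m (A C : {set T}) x := nth x (enum C) (index x (enum A)).
have mP A C x : A \in P -> C \in P -> x \in A -> (m A C x \in C) /\ m C A (m A C x) = x.
  move=> AP CP xA.
  have ix : index x (enum A) < size (enum C).
    by rewrite -cardE bP // -(bP A AP) cardE index_mem mem_enum.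
  split; first by rewrite -mem_enum mem_nth.
  rewrite /m index_uniq ?enum_uniq // (set_nth_default x) ?nth_index ?mem_enum //.
  by rewrite -cardE bP // -(bP C CP) cardE.
pose f x := if x \in B1 then m B1 B2 x else if x \in B2 then m B2 B1 x else x.
have fK : involutive f.
  move=> x; rewrite {2}/f; case: ifP => x1.
    have [m2 mm] := mP _ _ _ B1P B2P x1.
    by rewrite /f (negbTE (contraL (dj _) m2)) m2.
  case: ifP => x2; last by rewrite /f x1 x2.
  have [m2 mm] := mP _ _ _ B2P B1P x2.
  by rewrite /f m2.
exists (perm (inv_inj fK)).
have hE x : perm (inv_inj fK) x = f x by rewrite permE.
have h12 : perm (inv_inj fK) @: B1 = B2.
  apply/setP=> y; apply/imsetP/idP=> [[x x1 ->] | y2].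
    by rewrite hE /f x1; have [] := mP _ _ _ B1P B2P x1.
  exists (f y); rewrite ?hE ?fK //.
  by rewrite /f y2 (negbTE (contraL (dj _) y2)); have [] := mP _ _ _ B2P B1P y2.
have h21 : perm (inv_inj fK) @: B2 = B1.
  rewrite -h12 -imset_comp -[RHS]imset_id; apply: eq_imset => x /=.
  by rewrite !hE fK.
split=> // [|x x1 x2]; last by rewrite hE /f (negPf x1) (negPf x2).
rewrite mem_stabpart; apply/forall_inP=> B BP.
have [->|n1] := eqVneq B B1; first by rewrite h12.
have [->|n2] := eqVneq B B2; first by rewrite h21.
suff -> : perm (inv_inj fK) @: B = B by [].
apply/eqP; rewrite imperm_eq.
apply/subsetP=> _ /imsetP[x xB ->]; rewrite hE /f.
case: ifP => x1; first by rewrite (part_uniq pP BP B1P xB x1) eqxx in n1.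
by case: ifP => x2 //; rewrite (part_uniq pP BP B2P xB x2) eqxx in n2.
Qed.

Variables (k b : nat) (P : {set {set T}}).
Hypotheses (uP : unif k b P) (k1 : 1 < k) (b3 : 3 < b).

Let pP : partition P [set: T]. Proof. by case/unifP: uP. Qed.
Let cP : #|P| = k. Proof. by case/unifP: uP. Qed.
Let bP B : B \in P -> #|B| = b. Proof. by case/unifP: uP => _ _; apply. Qed.

Let N := 'N_('Alt_T)(P | 'P^*).

Lemma c3_stabpart B x y z : B \in P -> x \in B -> y \in B -> z \in B ->
  x != y -> x != z -> c3 x y z \in N.
Proof.
move=> BP xB yB zB xy xz; rewrite inE c3_even //=.
apply: (supp_stabpart pP BP); apply: subset_trans (supp_c3 _ _ _) _.
by apply/subsetP=> u; rewrite !inE -orbA => /or3P[]/eqP->.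
Qed.

(** An exchange of blocks may be odd. A transposition inside B that avoids the point p repairs the
    parity and keeps p in place. *)
Lemma even_correct B p h : B \in P -> h \in 'N(P | 'P^*) ->
  exists t, [/\ h * t \in N, supp t \subset B & t p = p].
Proof.
move=> BP hN; have [ev|od] := boolP (odd_perm h); last first.
  exists 1; rewrite mulg1 perm1; split=> //; first by apply/setIP; rewrite Alt_even od.
  by apply/subsetP=> x; rewrite inE perm1 eqxx.
have [|a aB] := @ex_seq_outside _ B [:: p]; first by rewrite bP // (ltn_trans _ b3).
have [|c cB] := @ex_seq_outside _ B [:: p; a]; first by rewrite bP // (ltn_trans _ b3).
rewrite !inE negb_or => /andP[cp ca] ap.
have st : supp (tperm a c) \subset B.
  apply: subset_trans (supp_tperm _ _) _.
  by apply/subsetP=> u; rewrite !inE => /orP[]/eqP->.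
exists (tperm a c); split=> //; last by rewrite tpermD.
apply/setIP; split; first by rewrite Alt_even odd_permM ev odd_tperm eq_sym ca.
by rewrite groupM // (supp_stabpart pP BP).
Qed.

Lemma stabpart_trans : 0 < #|T| -> [transitive 'N_('Alt_T)(P | 'P^*), on [set: T] | 'P].
Proof.
move=> /card_gt0P[x0 _]; apply/(transP _ x0) => x y.
have same B u v : B \in P -> u \in B -> v \in B -> exists2 g, g \in N & g u = v.
  move=> BP uB vB; have [->|uv] := eqVneq u v; first by exists 1; rewrite ?perm1 ?group1.
  have [|z zB] := @ex_seq_outside _ B [:: u; v]; first by rewrite bP // (ltn_trans _ b3).
  rewrite !inE negb_or => /andP[zu zv]; rewrite eq_sym in zu; rewrite eq_sym in zv.
  exists (c3 u v z); first exact: (c3_stabpart BP).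
  by have [->] := c3E uv zu zv.
have [A AP xA] := part_ex x pP; have [B BP yB] := part_ex y pP.
have [AB|AB] := eqVneq A B; first by apply: (same B) => //; rewrite -AB.
have [h [hN hA _]] := swap_blocks uP AP BP AB.
have [t [htN tB tp]] := even_correct (h x) BP hN.
have hxB : h x \in B by rewrite -hA mem_imperm.
have [g gN gE] := same B _ _ BP hxB yB.
by exists (h * t * g); [apply: groupM | rewrite !permM tp].
Qed.

Lemma stabpart_proper : N \proper 'Alt_T.
Proof.
apply/properP; split; first exact: subsetIl.
have /card_gt1P[A [B [AP BP AB]]] : 1 < #|P| by rewrite cP.
have [|u uA _] := @ex_seq_outside _ A [::]; first by rewrite bP // (ltn_trans _ b3).
have [|v vA] := @ex_seq_outside _ A [:: u]; first by rewrite bP // (ltn_trans _ b3).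
have [|w wB _] := @ex_seq_outside _ B [::]; first by rewrite bP // (ltn_trans _ b3).
rewrite inE => vu; have uv : u != v by rewrite eq_sym.
have neB z : z \in A -> z != w.
  by move=> zA; apply: contraNneq AB => zw; rewrite (part_uniq pP AP BP zA) // zw.
have [uw vw] := (neB u uA, neB v vA).
have [e1 e2 _ _] := c3E uv uw vw.
exists (c3 u v w); first exact: c3_even.
rewrite inE negb_and mem_stabpart; apply/orP; right; apply/negP=> /forall_inP/(_ A AP) cA.
have AE : c3 u v w @: A = A.
  by apply: (part_uniq pP cA AP (x := v)); rewrite // -{1}e1 mem_imperm.
have wA : w \in A by rewrite -AE -{1}e2 mem_imperm.
by rewrite (part_uniq pP AP BP wA wB) eqxx in AB.
Qed.

(** A nontrivial block of an overgroup K is itself a block of P ([key]). So if K is imprimitive, the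
    translates of its block are the members of P, and K preserves P. Otherwise K is primitive and
    contains a 3-cycle. *)
Lemma stabpart_maximal : maximal N 'Alt_T.
Proof.
apply/maxgroupP; split; first exact: stabpart_proper.
have /card_gt1P[A0 [_ [A0P _ _]]] : 1 < #|P| by rewrite cP.
have [|u0 u0A _] := @ex_seq_outside _ A0 [::]; first by rewrite bP // (ltn_trans _ b3).
have T0 : 0 < #|T| by apply/card_gt0P; exists u0.
have tN := elimT (transP _ u0) (stabpart_trans T0).
move=> K /andP[KA nAK] NK; apply/eqP; rewrite eqEsubset NK andbT subsetI KA /=.
apply/negPn/negP=> nKP; case/negP: nAK.
have tK : [transitive K, on [set: T] | 'P].
  by apply/(transP K u0) => x y; have [g gN gx] := tN x y; exists g; rewrite ?(subsetP NK).
have others B l : B \in P -> size l < 4 -> exists2 x, x \in B & x \notin l.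
  by move=> BP l4; apply: ex_seq_outside; rewrite bP // (leq_trans l4).
have disj B B' x : B \in P -> B' \in P -> B != B' -> x \in B -> x \notin B'.
  move=> BP B'P ne xB; apply/negP=> xB'.
  by rewrite (part_uniq pP BP B'P xB xB') eqxx in ne.
have grow Y B u v : is_block K Y -> u \in Y -> v \in Y -> B \in P -> v \in B ->
    u != v -> B \subset Y.
  move=> bY uY vY BP vB uv; apply/subsetP=> w wB.
  have [->//|wu] := eqVneq w u; have [->//|wv] := eqVneq w v.
  have [z zB] := others B [:: u; v; w] BP isT.
  rewrite !inE !negb_or => /and3P[zu zv zw].
  rewrite eq_sym in wv; rewrite eq_sym in zv; rewrite eq_sym in zw.
  apply: (block_grow bY uY vY wv zv zw).
    by rewrite !inE !negb_or uv eq_sym wu eq_sym.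
  by apply/(subsetP NK)/(c3_stabpart BP).
have key Y : is_block K Y -> 1 < #|Y| -> Y != setT -> Y \in P.
  move=> bY Y1 YT; have /card_gt1P[u [v [uY vY uv]]] := Y1.
  have [B BP vB] := part_ex v pP.
  have BY := grow _ _ _ _ bY uY vY BP vB uv.
  suff -> : Y = B by [].
  apply/eqP; rewrite eqEsubset BY andbT; apply/subsetP=> y yY.
  have [B1 B1P yB1] := part_ex y pP.
  apply: contraNT YT => yB; rewrite eqEsubset subsetT; apply/subsetP=> z _.
  have BB1 : B != B1 by apply: contraNneq yB => ->.
  have vy : v != y by apply: contraNneq yB => <-.
  have B1Y := grow _ _ _ _ bY vY yY B1P yB1 vy.
  have [B2 B2P zB2] := part_ex z pP.
  have [E|ne1] := eqVneq B2 B1; first by rewrite (subsetP B1Y) // -E.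
  have [E|ne] := eqVneq B2 B; first by rewrite (subsetP BY) // -E.
  have B12 : B1 != B2 by rewrite eq_sym.
  (* An element of N exchanging B1 and B2 and fixing v in Y maps Y to itself, hence carries B1,
     contained in Y, onto B2. *)
  have [h [hN h12 hfix]] := swap_blocks uP B1P B2P B12.
  have [t [htN tB tp]] := even_correct v BP hN.
  have htv : (h * t) v = v.
    by rewrite permM hfix ?tp //; apply: (disj B) => //; rewrite eq_sym.
  have := elimT (blockP K Y) bY _ v (subsetP NK _ htN); rewrite htv => /(_ vY vY) <-.
  have [w wB1 wz] : exists2 w, w \in B1 & h w = z.
    by move: zB2; rewrite -h12 => /imsetP[w w1 ->]; exists w.
  have tz : t z = z.
    apply/eqP/negPn; rewrite -in_supp; apply/negP=> /(subsetP tB).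
    by apply/negP; apply: (disj B2).
  by rewrite -tz -wz -permM mem_imperm (subsetP B1Y).
have pK : prim K.
  rewrite /prim tK; apply/forallP=> X; apply/implyP=> bX.
  have [//|X1] := leqP #|X| 1; apply/negPn/negP=> XT; case/negP: nKP.
  have [x xX] : exists x, x \in X by apply/set0Pn; rewrite -card_gt0 ltnW.
  have gX g : g \in K -> g @: X \in P.
    move=> gK; apply: key; first exact: blockJ.
      by rewrite card_imperm.
    apply: contra XT => /eqP gXT; rewrite eqEcard subsetT -gXT card_imset ?leqnn //.
    exact: perm_inj.
  apply/subsetP=> f fK; rewrite mem_stabpart; apply/forall_inP=> B BP.
  have [y yB _] := others B [::] BP isT.
  have [g gN gx] := tN x y; have gK := subsetP NK g gN.
  have <- : g @: X = B.
    by apply: (part_uniq pP (gX g gK) BP (x := y)); rewrite // -gx mem_imperm.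
  have -> : f @: (g @: X) = (g * f) @: X.
    by rewrite -imset_comp; apply: eq_imset => w /=; rewrite permM.
  by apply: gX; rewrite groupM.
have [v vA] := others A0 [:: u0] A0P isT.
have [w wA] := others A0 [:: u0; v] A0P isT.
rewrite !inE !negb_or => /andP[wu wv] vu.
rewrite eq_sym in wu; rewrite eq_sym in wv; rewrite eq_sym in vu.
apply: (jordan3 pK _ (card_supp_c3 vu wu wv)).
by apply/(subsetP NK)/(c3_stabpart A0P).
Qed.

End MaxPart.

(** * Primitive groups of degree 21 *)

Section MinDegree.

Variable T : finType.
Implicit Types (X B F I D : {set T}) (s g h : {perm T}).
Implicit Types (G K H L : {group {perm T}}).

Lemma expg_fix s k x : s x = x -> (s ^+ k) x = x.
Proof. by move=> sx; elim: k => [|k IH]; rewrite ?perm1 // expgSr permM IH. Qed.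

Lemma commute_fix g h k x : commute g h -> h ((g ^+ k) x) = (g ^+ k) x -> h x = x.
Proof.
move=> cgh; rewrite -permM (commuteX2 k 1 cgh : commute _ _) permM.
by move/perm_inj.
Qed.

Lemma prime_cycle_fix p g i x : prime p -> g ^+ p = 1 -> ~~ (p %| i) ->
  (g ^+ i) x = x -> g x = x.
Proof.
move=> p_pr gp pi gix; have i0 : 0 < i by case: i pi gix => //; rewrite dvdn0.
have [u v e _] := egcdnP p i0; have := coprime_sym i p; rewrite (prime_coprime _ p_pr) pi.
move=> /eqP ip; rewrite ip in e.
have : (g ^+ (u * i)) x = x by rewrite mulnC expgM expg_fix.
by rewrite e expgD mulnC expgM gp expg1n mul1g expg1.
Qed.

Lemma prime_dvd_supp p g : prime p -> g ^+ p = 1 -> p %| #|supp g|.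
Proof.
move=> p_pr gp; have pg : p.-group <[g]>.
  by rewrite /pgroup -orderE (@pnat_dvd _ (p ^ 1)) ?expn1 ?pnat_id ?order_dvdn ?gp.
have ac : [acts <[g]>, on supp g | 'P].
  rewrite gen_subG sub1set mem_stabset eqEcard card_imset ?leqnn ?andbT; last exact: perm_inj.
  by apply/subsetP=> _ /imsetP[x xS ->]; rewrite supp_stable.
have := pgroup_fix_mod pg ac.
suff -> : 'Fix_(supp g | 'P)(<[g]>) = set0 by rewrite cards0 mod0n => /eqP.
apply/setP=> x; rewrite in_set0; apply/setIP=> -[xg /afixP/(_ g (cycle_id g))].
by move=> gx; move: xg; rewrite in_supp => /eqP[]; exact: gx.
Qed.

(** A power of prime order of an element with smallest support has, by minimality, the same
    support. *)
Lemma mindeg_ex G : G :!=: 1 -> exists m, mindeg G m /\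
  exists g p, [/\ g \in G, g != 1, #|supp g| = m, prime p & g ^+ p = 1].
Proof.
case/trivgPn=> g0 g0G g01.
have P0 : [pred g | (g \in G) && (g != 1)] g0 by rewrite /= g0G.
case: (arg_minnP (fun g => #|supp g|) P0) => g /andP[gG g1] gmin.
exists #|supp g|; split; first by move=> s sG s1; apply: gmin; rewrite /= sG.
have o1 : 1 < #[g] by rewrite ltn_neqAle eq_sym order_eq1 g1 order_gt0.
have [pp pd] := (pdiv_prime o1, pdiv_dvd #[g]); set p := pdiv _ in pp pd *.
have oX : #[g ^+ (#[g] %/ p)] = p.
  by rewrite orderXdiv ?dvdn_div // divnA // ?mulnK // ?mulKn ?order_gt0.
have gX1 : g ^+ (#[g] %/ p) != 1 by rewrite -order_eq1 oX; case: p pp {pd oX} => [|[]].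
exists (g ^+ (#[g] %/ p)), p; split; rewrite ?groupX //; last by rewrite -{2}oX expg_order.
apply/eqP; rewrite eqn_leq subset_leq_card ?suppX //=.
by apply: gmin; rewrite /= groupX.
Qed.

(** The commutator is supported on I, g I and h I. Nothing is known of h I but its size, so only the
    overlap of I with g I can be exploited. *)
Lemma comm_small G m g h I : mindeg G m -> g \in G -> h \in G ->
  supp h \subset ~: supp g :|: I -> #|I :|: g @: I| + #|I| < m -> commute g h.
Proof.
move=> dG gG hG hI lt; apply/commgP; apply: contraTT lt => n1.
rewrite -leqNgt; apply: leq_trans (dG _ (groupR gG hG) n1) _.
apply: leq_trans (subset_leq_card (supp_commg g h)) _.
set J := _ :&: _; have JI : J \subset I.
  by apply/subsetP=> x /setIP[xg /(subsetP hI)]; rewrite !inE -in_supp xg.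
apply: leq_trans (leq_card_setU _ _) _; apply: leq_add.
  by apply: subset_leq_card; apply: setUSS => //; apply: imsetS.
by rewrite card_imset ?subset_leq_card //; apply: perm_inj.
Qed.

Lemma order_lb G D : (#|G| <= #|G :&: perm.Sym D| * (#|T| ^_ (#|T| - #|D|)))%N.
Proof.
have cD := max_card (mem D); have := card_symOn_bound G D.
rewrite -(ffact_fact (leq_subr #|D| #|T|)) subKn // mulnA leq_pmul2r //.
exact: fact_gt0.
Qed.

(** An element of L != 1 fixes at most |F| - m points of F, so L acts freely on the tuples of |F| -
    m + 1 distinct points of F. *)
Lemma free_dvd L m F : mindeg L m -> L \subset perm.Sym F ->
  #|L| %| #|F| ^_ (#|F| - m).+1.
Proof.
move=> dL LF; set k := (_ - _).+1.
pose U := [set t : k.-tuple T | all (mem F) t & uniq t].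
have cU : #|U| = #|F| ^_ k by rewrite card_uniq_tuples.
have ac : [acts L, on U | 'P * k].
  apply/subsetP=> s sL; rewrite !inE; apply/subsetP=> t; rewrite !inE.
  case/andP=> tF ut; rewrite map_inj_uniq ?ut ?andbT; last exact: perm_inj.
  have sF : supp s \subset F by rewrite -mem_symOn (subsetP LF).
  apply/allP=> _ /mapP[x xt ->]; rewrite /= /aperm (acts_mem x (supp_stabset sF)).
  exact: (allP tF).
rewrite -cU -(acts_sum_card_orbit ac); apply: dvdn_sum => _ /imsetP[t tU ->].
rewrite card_orbit; have -> : 'C_L[t | 'P * k] = 1; last by rewrite indexg1.
apply/eqP; rewrite -subG1; apply/subsetP=> s /setIP[sL /astab1P st]; apply/set1P/eqP.
apply: contraT => s1; have := dL s sL s1.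
move: tU; rewrite inE => /andP[/allP tF ut].
have fx x : x \in t -> s x = x.
  move=> xt; have E : [seq aperm y s | y <- t] = t := congr1 val st.
  have := congr1 (fun l => nth x l (index x t)) E.
  by rewrite (nth_map x) ?index_mem // nth_index.
have sF : supp s \subset F by rewrite -mem_symOn (subsetP LF).
have tD : [set y in t] \subset F :\: supp s.
  apply/subsetP=> y; rewrite !inE => yt; rewrite (fx y yt) eqxx /=.
  exact: tF.
have := subset_leq_card tD; rewrite cardsE (card_uniqP ut) size_tuple.
rewrite cardsDS // /k; have := subset_leq_card sF; lia.
Qed.

End MinDegree.

(** * Elements of prime order and their cycles *)

Section MinDegree2.

Variable T : finType.
Implicit Types (X B F I D : {set T}) (s g h : {perm T}).
Implicit Types (G K H L : {group {perm T}}).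

Lemma invol_odd s : s ^+ 2 = 1 -> odd_perm s = odd (#|supp s|./2).
Proof.
have [k] := ubnP #|supp s|; elim: k s => // k IHk s ltk s2.
have [->|s1] := eqVneq s 1.
  by rewrite odd_perm1 (eqP (_ : supp 1 == set0)) ?supp_eq0 // cards0.
have /set0Pn[x xs]: supp s != set0 by rewrite supp_eq0.
have ss y : s (s y) = y by rewrite -permM -expg2 s2 perm1.
have xy : x != s x by rewrite eq_sym -in_supp.
pose t := tperm x (s x) * s.
have tE y : t y = if y \in [set x; s x] then y else s y.
  rewrite /t permM !inE; case: tpermP => [->|->|/eqP/negPf-> /eqP/negPf->] //.
    by rewrite eqxx ss.
  by rewrite eqxx orbT.
have t2 : t ^+ 2 = 1.
  apply/permP=> y; rewrite expg2 permM perm1 !tE !inE.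
  have [->|yx] := eqVneq y x; first by rewrite /= eqxx.
  have [->|ysx] := eqVneq y (s x); first by rewrite /= eqxx orbT.
  rewrite /= (inj_eq perm_inj) (negPf yx) orbF.
  by rewrite (can2_eq ss ss) (negPf ysx) ss.
have st : supp t = supp s :\: [set x; s x].
  by apply/setP=> y; rewrite inE tE in_setD in_supp; case: ifP; rewrite ?eqxx.
have D : [set x; s x] \subset supp s.
  by apply/subsetP=> u; rewrite !inE => /orP[]/eqP->; rewrite -in_supp ?supp_stable.
have ct : #|supp s| = #|supp t|.+2.
  rewrite st cardsDS // cards2 xy; have := subset_leq_card D; rewrite cards2 xy.
  by case: #|supp s| => [|[|c]] //=; rewrite subn2.
have -> : s = tperm x (s x) * t by rewrite /t mulgA tperm2 mul1g.
have tk : #|supp t| < k by move: ltk; rewrite ct ltnS => /ltnW.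
by rewrite odd_permM odd_tperm xy IHk // {2}/t mulgA tperm2 mul1g ct.
Qed.

Lemma cycle_escape p g I y : prime p -> g ^+ p = 1 -> y \in supp g -> #|I| < p ->
  exists k, (g ^+ k) y \notin I.
Proof.
move=> p_pr gp yS Ip; pose f (i : 'I_p) := (g ^+ i) y.
have fI : injective f.
  have wl (i j : 'I_p) : i <= j -> f i = f j -> i = j.
    move=> ij; rewrite /f -{1}(subnKC ij) addnC expgD permM => /perm_inj/esym E.
    apply/val_inj/eqP; rewrite eqn_leq ij -subn_eq0 /=.
    apply: contraTT yS => d0; rewrite in_supp negbK.
    apply/eqP/(prime_cycle_fix p_pr gp _ E); apply/negP=> /dvdn_leq.
    rewrite lt0n d0 => /(_ isT); rewrite leqNgt => /negP[].
    by apply: leq_ltn_trans (leq_subr _ _) (ltn_ord j).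
  move=> i j E; case/orP: (leq_total i j) => ij; first exact: wl.
  by apply/esym/wl.
have /subsetPn[_ /imsetP[i _ ->] ni] : ~~ (f @: setT \subset I).
  apply: contraTN Ip => /subset_leq_card.
  by rewrite card_imset // cardsT card_ord leqNgt.
by exists i.
Qed.

(** By [comm_small] such an h commutes with g, so together with y it moves the whole g-cycle of y.
    This is impossible if the cycle leaves I, because outside I the support of g is fixed by h. *)
Lemma comm_stab_sub G m g I I' : mindeg G m -> g \in G ->
  #|I :|: g @: I| + #|I| < m ->
  (forall y, y \in supp g -> y \in I -> y \notin I' -> exists k, (g ^+ k) y \notin I) ->
  G :&: perm.Sym (~: supp g :|: I) \subset perm.Sym (~: supp g :|: I').
Proof.
move=> dG gG lt esc; apply/subsetP=> h /setIP[hG]; rewrite !mem_symOn => hI.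
have cgh := comm_small dG gG hG hI lt.
apply/subsetP=> y yh; rewrite in_setU; apply: contraT.
rewrite negb_or inE negbK => /andP[yS yI'].
have yI : y \in I by have := subsetP hI y yh; rewrite !inE -in_supp yS.
have [k kI] := esc y yS yI yI'.
move: yh; rewrite in_supp => /eqP[]; apply: (commute_fix cgh (k := k)).
apply/eqP/negPn; rewrite -in_supp; apply/negP=> /(subsetP hI).
rewrite in_setU (negPf kI) orbF inE => /negP[].
by elim: k {kI} => [|k IHk]; rewrite ?perm1 // expgSr permM supp_stable.
Qed.

Lemma mindeg_triv G m D : mindeg G m -> #|D| < m -> G :&: perm.Sym D = 1.
Proof.
move=> dG Dm; apply/eqP; rewrite -subG1; apply/subsetP=> h /setIP[hG].
rewrite mem_symOn => /subset_leq_card hD; apply/set1P/eqP; apply: contraT => h1.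
by have := leq_ltn_trans (leq_trans (dG h hG h1) hD) Dm; rewrite ltnn.
Qed.

(** Consecutive points on a cycle of g. For such a set I the union of I and g I has at most one
    point more than I, the best overlap short of a whole cycle. *)
Definition interval g a t : {set T} := [set (g ^+ (i : 'I_t)) a | i in setT].

Lemma card_interval_le g a t : #|interval g a t| <= t.
Proof. by apply: leq_trans (leq_imset_card _ _) _; rewrite cardsT card_ord. Qed.

Lemma interval_next g a t : interval g a t :|: g @: interval g a t \subset interval g a t.+1.
Proof.
apply/subsetP=> x; rewrite in_setU => /orP[/imsetP[i _ ->]|/imsetP[_ /imsetP[i _ ->] ->]].
  by apply/imsetP; exists (widen_ord (leqnSn t) i).
by apply/imsetP; exists (lift ord0 i); rewrite // lift0 expgSr permM.
Qed.

Lemma card_interval p g a t : prime p -> g ^+ p = 1 -> a \in supp g -> t <= p ->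
  #|interval g a t| = t.
Proof.
move=> p_pr gp aS; elim: t => [|t IHt] tp.
  by apply/eqP; rewrite cards_eq0; apply/eqP/setP=> x; rewrite inE; apply/imsetP=> -[[]].
apply/eqP; rewrite eqn_leq card_interval_le /=.
have := IHt (ltnW tp) => ct; rewrite -{1}ct.
have sub : interval g a t \subset interval g a t.+1.
  exact: subset_trans (subsetUl _ _) (interval_next g a t).
apply: proper_card; rewrite properEneq sub andbT; apply/eqP=> E.
have [k] : exists k, (g ^+ k) a \notin interval g a t.
  by apply: (cycle_escape p_pr gp aS); rewrite ct.
case/negP; elim: k => [|k IHk].
  by rewrite E; apply/imsetP; exists ord0.
rewrite expgSr permM E; apply: (subsetP (interval_next g a t)).
by rewrite in_setU mem_imperm IHk orbT.
Qed.

Lemma interval_sub g a t : a \in supp g -> interval g a t \subset supp g.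
Proof.
move=> aS; apply/subsetP=> _ /imsetP[i _ ->].
by elim: (val i) => [|k IHk]; rewrite ?perm1 // expgSr permM supp_stable.
Qed.

Lemma interval_stab G m p g a t : mindeg G m -> g \in G -> prime p -> g ^+ p = 1 ->
  a \in supp g -> t < p -> t + t + 1 < m ->
  G :&: perm.Sym (~: supp g :|: interval g a t) \subset perm.Sym (~: supp g).
Proof.
move=> dG gG p_pr gp aS tp tm; rewrite -[in X in _ \subset X](setU0 (~: supp g)).
have ct := card_interval p_pr gp aS (ltnW tp).
apply: (comm_stab_sub dG gG) => [|y yS _ _].
  apply: leq_ltn_trans tm; rewrite ct -addnA [t + 1]addnC addnA leq_add2r addn1.
  by rewrite -(card_interval p_pr gp aS tp) subset_leq_card ?interval_next.
by apply: (cycle_escape p_pr gp yS); rewrite ct.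
Qed.

End MinDegree2.

(** * Lower bounds for pointwise stabilizers in degree 21 *)

Section Degree21.

Variable T : finType.
Hypothesis cT : #|T| = 21.
Implicit Types (X B F I D : {set T}) (s g h : {perm T}).
Variable G : {group {perm T}}.
Hypotheses (GA : G \subset 'Alt_T) (bigG : 36 * (1000 * 1000 * 1000) < #|G|).

(** The instances below are 36 * 10^9 divided by 21 ^_ k and rounded down, the last one to 250
    thousand. *)
Lemma lb D k : (#|D| + k)%N = 21 ->
  36 * (1000 * 1000 * 1000) < #|G :&: perm.Sym D| * (21 ^_ k).
Proof.
move=> cD; apply: leq_trans bigG _; have := order_lb G D.
by rewrite cT -[in X in _ ^_ X]cD addKn.
Qed.

Lemma lb13 D : #|D| = 13 -> 4 < #|G :&: perm.Sym D|.
Proof. by move=> cD; have := @lb D 8; rewrite cD => /(_ erefl); rewrite !ffactnS ffactn0 /=; move: #|_ :&: _| => K; clear; lia. Qed.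

Lemma lb15 D : #|D| = 15 -> 921 < #|G :&: perm.Sym D|.
Proof. by move=> cD; have := @lb D 6; rewrite cD => /(_ erefl); rewrite !ffactnS ffactn0 /=; move: #|_ :&: _| => K; clear; lia. Qed.

Lemma lb16 D : #|D| = 16 -> 14 * 1000 + 742 < #|G :&: perm.Sym D|.
Proof. by move=> cD; have := @lb D 5; rewrite cD => /(_ erefl); rewrite !ffactnS ffactn0 /=; move: #|_ :&: _| => K; clear; lia. Qed.

Lemma lb17 D : #|D| = 17 -> 250 * 1000 < #|G :&: perm.Sym D|.
Proof. by move=> cD; have := @lb D 4; rewrite cD => /(_ erefl); rewrite !ffactnS ffactn0 /=; move: #|_ :&: _| => K; clear; lia. Qed.

End Degree21.

(** * Jordan sets with more than half of the points *)

Section JordanSet.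

Variable T : finType.
Implicit Types (X Y B F I D : {set T}) (s g h : {perm T}).
Variable G : {group {perm T}}.

(** A primitive Jordan set: the subgroup of G supported on X is primitive on X. *)
Definition jordan_set X :=
  (forall x y, x \in X -> y \in X -> exists2 h, h \in G :&: perm.Sym X & h x = y) /\
  (forall Y, Y \subset X -> 1 < #|Y| -> Y != X ->
     exists2 h, h \in G :&: perm.Sym X & h @: Y != Y /\ ~~ [disjoint h @: Y & Y]).

Lemma symOnJ X h f : f \in G -> h \in G :&: perm.Sym X -> h ^ f \in G :&: perm.Sym (f @: X).
Proof.
move=> fG /setIP[hG]; rewrite mem_symOn => hX; apply/setIP; split; first exact: groupJ.
by rewrite mem_symOn suppJ imsetS.
Qed.

Lemma symOnS X Y h : X \subset Y -> h \in G :&: perm.Sym X -> h \in G :&: perm.Sym Y.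
Proof.
move=> XY /setIP[hG]; rewrite mem_symOn => hX; apply/setIP; split=> //.
by rewrite mem_symOn (subset_trans hX).
Qed.

(** The subgroups supported on X and on h X generate a group that is transitive on s |: X. The
    former fixes s and is transitive on X, so the group is 2-transitive on s |: X, hence primitive
    there. *)
Lemma jordan_set_step X (s : T) h : h \in G -> jordan_set X -> s \notin X -> 1 < #|X| ->
  h @: X \subset s |: X -> s \in h @: X -> jordan_set (s |: X).
Proof.
move=> hG [tX _] sX X1 hX shX.
have sub : X \subset s |: X by apply: subsetUr.
have toX x : x \in s |: X -> exists2 f, f \in G :&: perm.Sym (s |: X) & f x \in X.
  case/setU1P=> [->|xX]; last by exists 1; rewrite ?perm1 ?group1.
  have /set0Pn[y /setD1P[ys yhX]] : (h @: X) :\ s != set0.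
    rewrite -card_gt0; have := cardsD1 s (h @: X); rewrite shX card_imset; last exact: perm_inj.
    by move: X1; lia.
  have [f fX fy] : exists2 f, f \in G :&: perm.Sym X & f (h^-1 s) = h^-1 y.
    by apply: tX; rewrite -mem_impermV.
  exists (f ^ h); first by apply: symOnS hX (symOnJ hG fX).
  rewrite -{1}[s](permKV h) permJ fy permKV.
  by have := subsetP hX y yhX; rewrite !inE (negPf ys).
have tX' x y : x \in s |: X -> y \in s |: X ->
    exists2 f, f \in G :&: perm.Sym (s |: X) & f x = y.
  move=> /toX[f fX fx] /toX[k kX ky]; have [l lX lE] := tX _ _ fx ky.
  exists (f * l * k^-1); last by rewrite !permM lE permK.
  by rewrite !groupM ?groupV // (symOnS sub).
split=> // Y YX Y1 YnX.
have [/exists_inP[f fX /andP[f1 f2]]|nf] :=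
  boolP [exists f in G :&: perm.Sym (s |: X), (f @: Y != Y) && ~~ [disjoint f @: Y & Y]].
  by exists f.
have stabY f y : f \in G :&: perm.Sym (s |: X) -> y \in Y -> f y \in Y -> f @: Y = Y.
  move=> fX yY fyY; apply/eqP; apply: contraNT nf => fY; apply/exists_inP; exists f => //.
  by rewrite fY; apply/pred0Pn; exists (f y); rewrite /= mem_imperm yY.
case/negP: YnX; rewrite eqEsubset YX /=.
have [x xY] : exists x, x \in Y by apply/set0Pn; rewrite -card_gt0 ltnW.
have sX' : s \in s |: X by rewrite setU11.
have [f fX fx] := tX' x s (subsetP YX x xY) sX'.
have sfY : s \in f @: Y by rewrite -fx mem_imperm.
have [y yfY ys] : exists2 y, y \in f @: Y & y \notin [:: s].
  by apply: ex_seq_outside; rewrite card_imset //; apply: perm_inj.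
have fYX : f @: Y \subset s |: X.
  have := fX; rewrite inE mem_symOn => /andP[_ /supp_stabset].
  by rewrite mem_stabset => /eqP <-; apply: imsetS.
have yX : y \in X.
  by have := subsetP fYX y yfY; move: ys; rewrite !inE => /negPf->.
suff : s |: X \subset f @: Y.
  by move/subset_leq_card; rewrite card_imset => [le|]; [rewrite (eqP (_ : Y == s |: X)) // eqEcard YX | apply: perm_inj].
apply/subsetP=> z /setU1P[->//|zX].
have [k kX ky] := tX _ _ yX zX.
have ks : k s = s.
  by apply/eqP/negPn; rewrite -in_supp; apply: contra sX; move: kX; rewrite inE mem_symOn => /andP[_ /subsetP]; apply.
have kX' := symOnS sub kX.
have := stabY (f * k * f^-1) (f^-1 s); rewrite !groupM ?groupV // !permM permKV ks.
rewrite -mem_impermV sfY => /(_ isT isT isT) E.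
have -> : f @: Y = k @: (f @: Y).
  rewrite -{1}E -!imset_comp; apply: eq_imset => w /=.
  by rewrite !permM permKV.
by rewrite -ky mem_imperm.
Qed.

(** A Jordan set with more than half of the points grows by one point s at a time. As soon as s is a
    point of the support of g, the group supported on s |: X has an element whose support meets that
    of g in s alone, against [mindeg_inter1]. *)
Lemma jordan_set_triv X g : mindeg G 4 -> prim G -> 1 < #|X| -> #|T| < 2 * #|X| ->
  jordan_set X -> g \in G -> supp g \subset ~: X -> g = 1.
Proof.
move=> dG pG X1 X2 jX gG gX; apply/eqP; apply: contraT => g1.
have [k] := ubnP (#|T| - #|X|); elim: k X X1 X2 jX gX => // k IHk X X1 X2 jX gX ltk.
have [tX bX] := jX.
have /set0Pn[d dS] : supp g != set0 by rewrite supp_eq0.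
have dX : d \notin X by have := subsetP gX d dS; rewrite inE.
have XT : X != setT by apply: contraNneq dX => ->; rewrite inE.
have [h0 [_ [y0 [h0G _ _ y0h y0X]]]] := nblockP pG X1 XT.
have P0 : [pred h : {perm T} | (h \in G) && (h @: X != X)] h0.
  by rewrite /= h0G; apply: contraNneq y0X => <-.
(* Choosing h with X minus h X as small as possible will force this difference to be a single
   point. *)
case: (arg_minnP (fun h : {perm T} => #|X :\: h @: X|) P0) => h /andP[hG hX] hmin.
have chX f : #|(f : {perm T}) @: X| = #|X| by rewrite card_imperm.
set Y := X :\: h @: X in hmin.
have Y0 : 0 < #|Y|.
  rewrite card_gt0 setD_eq0; apply: contra hX => ss.
  by rewrite eq_sym eqEcard ss chX leqnn.
have cI f : (#|X :\: f @: X| + #|X :&: f @: X| = #|X|)%N by rewrite addnC cardsID.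
have cI' : (#|h @: X :\: X| = #|Y|)%N.
  have := cardsID X (h @: X); rewrite chX setIC -[RHS](cI h) addnC.
  by move/eqP; rewrite eqn_add2r => /eqP.
have cI2 : (#|h @: X :\: X| + #|X| <= #|T|)%N.
  have d0 : (h @: X :\: X) :&: X = set0.
    by apply/setP=> u; rewrite in_setI in_setD in_set0; case: (u \in X); rewrite ?andbF.
  by rewrite -cardsUI d0 cards0 addn0 max_card.
have Y1 : #|Y| <= 1.
  rewrite leqNgt; apply/negP=> Y1.
  have YX : Y != X.
    apply/eqP=> E; move: cI2; rewrite cI' E leqNgt => /negP[].
    by rewrite addnn -mul2n.
  have [f fX [f1 f2]] := bX Y (subsetDl _ _) Y1 YX.
  have [fG fs] := setIP fX; rewrite mem_symOn in fs.
  have fE z : (f z \in X) = (z \in X) by apply/acts_mem/supp_stabset.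
  (* Here f Y differs from Y and meets it. The image under h of X minus l X lies in f Y minus Y,
     which is smaller than Y, against the choice of h. *)
  pose l := h * f * h^-1.
  have lX u : (u \in l @: X) = (h u \in f @: (h @: X)).
    by rewrite !mem_impermV /l !invMg invgK !permM.
  have Pl : (l \in G) && (l @: X != X).
    rewrite !groupM ?groupV //=; apply: contra f1 => /eqP E.
    apply/eqP/setP=> u; rewrite mem_impermV !in_setD.
    have -> : (f^-1 u \in h @: X) = (u \in h @: X).
      have := lX (h^-1 u); rewrite E permKV -mem_impermV => ->.
      by rewrite -mem_impermV.
    by rewrite -(fE (f^-1 u)) permKV.
  have := hmin l Pl; rewrite leqNgt => /negP[].
  rewrite -(card_imset (mem (X :\: l @: X)) (@perm_inj _ h)) -/Y.
  apply: leq_ltn_trans (_ : #|f @: Y :\: Y| < _).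
    apply: subset_leq_card; apply/subsetP=> _ /imsetP[u /setDP[uX ul] ->].
    move: ul; rewrite lX => ul; have hu : h u \in h @: X by rewrite mem_imperm.
    have nhu : h u \notin Y by rewrite in_setD hu.
    rewrite in_setD nhu mem_impermV in_setD -mem_impermV ul /=.
    rewrite -(fE (f^-1 _)) permKV; apply: contraR ul => nX.
    rewrite mem_impermV; suff -> : f^-1 (h u) = h u by [].
    apply: (canLR (permK f)); apply/esym/eqP/negPn; rewrite -in_supp.
    by apply: contra nX; apply: (subsetP fs).
  have cf : #|f @: Y| = #|Y| by rewrite card_imperm.
  rewrite -[X in _ < X]cf -(cardsID Y (f @: Y)) -[X in X < _]add0n ltn_add2r card_gt0.
  by rewrite setI_eq0.
have {}Y1 : #|Y| = 1%N by apply/eqP; rewrite eqn_leq Y1.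
have /eqP/cards1P[s sE] : #|h @: X :\: X| = 1%N by rewrite cI'.
have : s \in h @: X :\: X by rewrite sE set11.
case/setDP=> shX sX.
have hsX : h @: X \subset s |: X.
  apply/subsetP=> u uh; rewrite in_setU1; have [uX|uX] := boolP (u \in X); first by rewrite orbT.
  by rewrite orbF -in_set1 -sE in_setD uX.
have jsX := jordan_set_step hG jX sX X1 hsX shX.
have csX : #|s |: X| = #|X|.+1 by rewrite cardsU1 sX.
(* If g moves s, an f supported on s |: X that moves s gives the contradiction; otherwise s |: X is
   still disjoint from the support of g. *)
have [sS|sS] := boolP (s \in supp g).
  have [z zX zs] : exists2 z, z \in s |: X & z \notin [:: s].
    by apply: ex_seq_outside; rewrite csX ltnS ltnW.
  have [f fX fs] := jsX.1 s z (setU11 _ _) zX.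
  have [fG] := setIP fX; rewrite mem_symOn => fsX.
  have := mindeg_inter1 dG gG fG.
  suff -> : supp g :&: supp f = [set s] by rewrite cards1.
  apply/setP=> u; rewrite in_setI in_set1; apply/andP/eqP=> [[ug uf]|->].
    have := subsetP fsX u uf; have := subsetP gX u ug.
    by rewrite !inE => /negPf->; rewrite orbF => /eqP.
  by split=> //; rewrite in_supp fs; move: zs; rewrite inE.
apply: (IHk (s |: X)) => //; rewrite ?csX.
- by rewrite ltnS ltnW.
- by apply: (leq_trans X2); rewrite leq_mul2l leqnSn.
- apply/subsetP=> u uS; rewrite !inE negb_or.
  have := subsetP gX u uS; rewrite inE => ->; rewrite andbT.
  by apply: contraNneq sS => <-.
have XT' : #|X| < #|T| by rewrite -cardsT; apply: proper_card; rewrite properT.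
by move: ltk; rewrite -(subnSK XT').
Qed.

End JordanSet.

Section PrimeCycle.

Variable T : finType.
Implicit Types (X Y B F I D : {set T}) (s g h y : {perm T}).
Implicit Types (G K H L : {group {perm T}}).

Lemma ex_subset_card X k : k <= #|X| -> exists2 D : {set T}, D \subset X & #|D| = k.
Proof.
move=> kX; exists [set x in take k (enum X)].
  by apply/subsetP=> x; rewrite inE => /mem_take; rewrite mem_enum.
rewrite cardsE (card_uniqP _) ?take_uniq ?enum_uniq // size_take -cardE.
by move: kX; rewrite leq_eqVlt => /orP[/eqP->|->] //; rewrite ltnn.
Qed.

Lemma mem_expg_supp g k x : ((g ^+ k) x \in supp g) = (x \in supp g).
Proof. by elim: k => [|k IH]; rewrite ?perm1 // expgSr permM supp_stable. Qed.

Lemma card_porbit_le p g a : prime p -> g ^+ p = 1 -> #|porbit g a| <= p.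
Proof.
move=> p_pr gp; rewrite porbit.unlock; apply: leq_trans (leq_imset_card _ _) _.
by rewrite -orderE dvdn_leq ?prime_gt0 // order_dvdn gp.
Qed.

Lemma interval_porbit g a t : interval g a t \subset porbit g a.
Proof. by apply/subsetP=> _ /imsetP[i _ ->]; apply: mem_porbit. Qed.

Lemma porbit_interval p g a : prime p -> g ^+ p = 1 -> a \in supp g ->
  porbit g a = interval g a p.
Proof.
move=> p_pr gp aS; apply/esym/eqP; rewrite eqEcard interval_porbit /=.
by rewrite (card_interval p_pr gp aS) // card_porbit_le.
Qed.

Lemma porbit_step g a x : (g x \in porbit g a) = (x \in porbit g a).
Proof. by rewrite -!eq_porbit_mem -[g x]/((g ^+ 1) x) porbit_perm. Qed.

Lemma porbit_disj g a b x : b \notin porbit g a -> x \in porbit g a -> x \notin porbit g b.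
Proof.
move=> nb; rewrite -!eq_porbit_mem in nb * => /eqP->.
by rewrite eq_sym.
Qed.

Lemma interval_escape p g a t (J : {set T}) (y : T) : prime p -> g ^+ p = 1 -> a \in supp g -> t < p ->
  [disjoint porbit g a & J] -> y \in interval g a t ->
  exists k, (g ^+ k) y \notin interval g a t :|: J.
Proof.
move=> p_pr gp aS tp dJ yI; have yS := subsetP (interval_sub t aS) y yI.
have [k kI] : exists k, (g ^+ k) y \notin interval g a t.
  by apply: (cycle_escape p_pr gp yS); rewrite (card_interval p_pr gp aS) // ltnW.
exists k; rewrite in_setU (negPf kI) /=.
apply: contraL (dJ) => kJ; apply/pred0Pn; exists ((g ^+ k) y); rewrite /= kJ andbT.
rewrite -eq_porbit_mem porbit_perm eq_porbit_mem.
exact: (subsetP (interval_porbit g a t)).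
Qed.

(** A single cycle of prime length p: a proper subset Y stable under the power of y that takes u to
    v in Y would contain the whole cycle, since that power is again a p-cycle. *)
Lemma prime_jordan_set G p y : prime p -> y \in G -> y ^+ p = 1 -> #|supp y| = p ->
  jordan_set G (supp y).
Proof.
move=> p_pr yG yp cy; have p0 := prime_gt0 p_pr.
have yKX k : y ^+ k \in G :&: perm.Sym (supp y).
  by rewrite inE groupX // mem_symOn suppX.
have tX u v : u \in supp y -> v \in supp y -> exists k, (y ^+ k) u = v.
  move=> uX vX; have : v \in interval y u p.
    suff -> : interval y u p = supp y by [].
    by apply/eqP; rewrite eqEcard interval_sub //= cy (card_interval p_pr yp uX).
  by case/imsetP=> i _ ->; exists i.
split=> [u v uX vX|Y YX Y1 YnX].
  by have [k <-] := tX u v uX vX; exists (y ^+ k).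
have /card_gt1P[u [v [uY vY uv]]] := Y1.
have [uX vX] := (subsetP YX u uY, subsetP YX v vY).
have [k kv] := tX u v uX vX; exists (y ^+ k) => //.
split; last by apply/pred0Pn; exists v; rewrite /= vY -kv mem_imperm uY.
apply/eqP=> E.
have ukS : u \in supp (y ^+ k) by rewrite in_supp kv eq_sym.
have kp : (y ^+ k) ^+ p = 1 by rewrite expgAC yp expg1n.
have cY : #|Y| < p by rewrite -cy; apply: proper_card; rewrite properEneq YnX.
have [i] := cycle_escape p_pr kp ukS cY.
case/negP; elim: i => [|i IH]; first by rewrite perm1.
by rewrite expgSr permM -E mem_imperm.
Qed.

Lemma orbit_stab_le K (X : {set T}) a (M : {set {perm T}}) :
  (forall h, h \in K -> h a \in X) -> (forall h, h \in K -> h a = a -> h \in M) ->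
  #|K| <= #|X| * #|M|.
Proof.
move=> KX KM; rewrite -(card_orbit_stab 'P K a); apply: leq_mul.
  by apply: subset_leq_card; apply/subsetP=> _ /orbitP[h hK <-]; apply: KX.
apply: subset_leq_card; apply/subsetP=> h /setIP[hK /astab1P ha]; exact: KM.
Qed.

End PrimeCycle.

(** * Degree 21: minimal degree at least 8 *)

Section Degree21.

Variable T : finType.
Hypothesis cT : #|T| = 21.
Implicit Types (X B F I D : {set T}) (s h : {perm T}).
Variable G : {group {perm T}}.
Hypotheses (GA : G \subset 'Alt_T) (pG : prim G).
Hypothesis bigG : 36 * (1000 * 1000 * 1000) < #|G|.
Variables (m p : nat) (g : {perm T}).
Hypotheses (dG : mindeg G m) (gG : g \in G) (g1 : g != 1) (cg : #|supp g| = m).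
Hypotheses (p_pr : prime p) (gp : g ^+ p = 1) (m7 : 7 < m).

(** F is the set of fixed points of g, and L the pointwise stabilizer of the support of g. *)
Let F := ~: supp g.
Let L := G :&: perm.Sym F.

Let cF : (#|F| + m)%N = 21. Proof. by rewrite -cg addnC cardsC. Qed.

Lemma mindeg_le13 : m <= 13.
Proof.
have [|D _ cD] := @ex_subset_card _ [set: T] 13; first by rewrite cardsT cT.
have /trivgPn[h /setIP[hG]] : G :&: perm.Sym D != 1.
  by apply: contraTneq (lb13 cT bigG cD) => ->; rewrite cards1.
rewrite mem_symOn -cD => /subset_leq_card hD h1.
exact: leq_trans (dG hG h1) hD.
Qed.

Lemma dvd_m : p \in primes m.
Proof.
rewrite mem_primes p_pr -cg prime_dvd_supp // andbT supp_gt0 g1 //.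
Qed.

Lemma card_FU I : I \subset supp g -> #|F :|: I| = (21 - m + #|I|)%N.
Proof.
move=> IS; rewrite cardsU (_ : F :&: I = set0) ?cards0 ?subn0; last first.
  by apply/eqP; rewrite setI_eq0 disjoint_sym disjoints_subset setCK.
by rewrite -cF addnK.
Qed.

(** As F together with I has 13 points, [lb13] gives nontrivial elements supported there. By
    [comm_stab_sub] they are supported on F and I', fewer than m points. *)
Lemma no_triv I I' : I \subset supp g -> I' \subset supp g ->
  #|I :|: g @: I| + #|I| < m -> (21 - m + #|I|)%N = 13 -> 21 - m + #|I'| < m ->
  (forall y, y \in supp g -> y \in I -> y \notin I' -> exists k, (g ^+ k) y \notin I) ->
  False.
Proof.
move=> IS I'S lt c13 c' esc.
have cD : #|F :|: I| = 13 by rewrite card_FU.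
have := lb13 cT bigG cD; suff -> : G :&: perm.Sym (F :|: I) = 1 by rewrite cards1.
apply/eqP; rewrite -subG1 -(mindeg_triv dG (D := F :|: I')) ?card_FU //.
by rewrite subsetI subsetIl (comm_stab_sub dG).
Qed.

Lemma supp_pt : exists a, a \in supp g.
Proof. by apply/set0Pn; rewrite supp_eq0. Qed.

Lemma other_pt (l : seq T) : size l * p < m ->
  exists2 b, b \in supp g & forall a, a \in l -> b \notin porbit g a.
Proof.
move=> lm; pose U l := [set x | has (fun a => x \in porbit g a) l].
have cU k : #|U k| <= size k * p.
  elim: k => [|a k IHk].
    by rewrite leqn0 cards_eq0; apply/eqP/setP=> x; rewrite !inE.
  apply: leq_trans (_ : #|porbit g a :|: U k| <= _).
    by apply: subset_leq_card; apply/subsetP=> x; rewrite !inE.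
  apply: leq_trans (leq_card_setU _ _) _; rewrite /= mulSn; apply: leq_add => //.
  exact: card_porbit_le.
have [|b bS nb] := @ex_outside _ (supp g) (U l).
  by rewrite cg; apply: leq_ltn_trans lm.
by exists b => // a al; apply: contra nb => ab; rewrite inE; apply/hasP; exists a.
Qed.

(** Here I is an interval of t = m - 8 points and I' is empty. *)
Lemma interval13 t : t < p -> t + t + 1 < m -> (21 - m + t)%N = 13 -> 21 - m < m -> False.
Proof.
move=> tp tm c13 lt; have [a aS] := supp_pt.
have ct := card_interval p_pr gp aS (ltnW tp).
apply: (@no_triv (interval g a t) set0); rewrite ?cards0 ?addn0 ?ct ?sub0set ?interval_sub //.
  apply: leq_ltn_trans tm; rewrite -addnA [t + 1]addnC addnA leq_add2r addn1.
  by rewrite -(card_interval p_pr gp aS tp) subset_leq_card ?interval_next.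
by move=> y yS _ _; apply: (cycle_escape p_pr gp yS); rewrite ct.
Qed.

Lemma no_m13 : m = 13 -> False.
Proof.
move=> mE; apply: (@interval13 5); rewrite ?mE //.
by have := dvd_m; rewrite mE inE => /eqP->.
Qed.

Lemma no_m11 : m = 11 -> False.
Proof.
move=> mE; apply: (@interval13 3); rewrite ?mE //.
by have := dvd_m; rewrite mE inE => /eqP->.
Qed.

(** The set I must have 4 points, but the cycles are too short for an interval of that size, so I is
    spread over several cycles with |I :|: g @: I| = 6. *)
Lemma no_m12 : m = 12 -> False.
Proof.
move=> mE; have [a aS] := supp_pt.
have leP x := card_porbit_le x p_pr gp.
have [/eqP p2|/eqP p3] : p == 2 \/ p == 3.
  by apply/orP; have := dvd_m; rewrite mE !inE.
(* A whole 2-cycle and one point from each of two others. Four points in different 2-cycles would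
   give 8 + 4, which is not below 12. The whole cycle cannot be left, so it becomes I', and 9 + 2 <
   12. *)
- have [|b bS /(_ a)] := @other_pt [:: a]; first by rewrite p2 mE.
  rewrite mem_head => /(_ isT) ba.
  have [|c cS cN] := @other_pt [:: a; b]; first by rewrite p2 mE.
  have [ca cb] : c \notin porbit g a /\ c \notin porbit g b.
    by split; apply: cN; rewrite !inE eqxx ?orbT.
  have bneqc : b != c by apply: contraNneq cb => <-; rewrite porbit_id.
  have ca2 : #|porbit g a| = 2.
    by rewrite (porbit_interval p_pr gp aS) (card_interval p_pr gp aS) // p2.
  have paS : porbit g a \subset supp g.
    by rewrite (porbit_interval p_pr gp aS) interval_sub.
  have cI : #|porbit g a :|: [set b; c]| = 4.
    rewrite cardsU ca2 cards2 bneqc (_ : _ :&: _ = set0) ?cards0 //.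
    apply/setP=> x; rewrite !inE; apply/negP=> /andP[xa /orP[]/eqP xE].
      by rewrite xE (negPf ba) in xa.
    by rewrite xE (negPf ca) in xa.
  apply: (@no_triv (porbit g a :|: [set b; c]) (porbit g a)).
  + by rewrite subUset paS; apply/subsetP=> x; rewrite !inE => /orP[]/eqP->; rewrite -in_supp.
  + exact: paS.
  + rewrite cI mE; apply: leq_ltn_trans (_ : 6 + 4 < 12); rewrite // leq_add2r.
    apply: leq_trans (subset_leq_card (_ : _ \subset porbit g a :|: porbit g b :|: porbit g c)) _.
      apply/subsetP=> x; rewrite in_setU => /orP[|/imsetP[{}x + ->]].
        by rewrite !inE => /or3P[->//|/eqP->|/eqP->]; rewrite porbit_id ?orbT.
      rewrite !in_setU !porbit_step !inE.
      by move=> /or3P[->//|/eqP->|/eqP->]; rewrite porbit_id ?orbT.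
    apply: leq_trans (leq_card_setU _ _) _; rewrite -[6]/(4 + 2); apply: leq_add; last by rewrite -p2.
    apply: leq_trans (leq_card_setU _ _) _; rewrite -[4]/(2 + 2); apply: leq_add; by rewrite -p2.
  + by rewrite cI mE.
  + by rewrite ca2 mE.
  move=> y yS; rewrite !inE => /or3P[->//|/eqP yE|/eqP yE] _; exists 1%N; rewrite expg1 yE !inE negb_or porbit_step.
    rewrite ba negb_or -in_supp bS /=.
    by apply: contraNneq cb => <-; rewrite -[g b]/((g ^+ 1) b) mem_porbit.
  rewrite ca negb_or -in_supp cS andbT /=.
  by apply: contraNneq cb => E; rewrite -porbit_step E porbit_id.
(* Two points from each of two 3-cycles; both cycles leave I, so I' is empty. *)
have [|b bS /(_ a)] := @other_pt [:: a]; first by rewrite p3 mE.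
rewrite mem_head => /(_ isT) ba.
have i2 x : x \in supp g -> #|interval g x 2| = 2.
  by move=> xS; rewrite (card_interval p_pr gp xS) // p3.
have dab : [disjoint porbit g a & porbit g b].
  by apply/pred0P=> x /=; apply/andP=> -[xa xb]; have := porbit_disj ba xa; rewrite xb.
have dI x y : [disjoint porbit g x & porbit g y] -> [disjoint porbit g x & interval g y 2].
  by move=> d; apply: disjointWr d; apply: interval_porbit.
have cI : #|interval g a 2 :|: interval g b 2| = 4.
  rewrite cardsU !i2 // (_ : _ :&: _ = set0) ?cards0 //.
  by apply/eqP; rewrite setI_eq0; apply: disjointWl (interval_porbit _ _ _) (dI _ _ dab).
apply: (@no_triv (interval g a 2 :|: interval g b 2) set0).
+ by rewrite subUset !interval_sub.
+ exact: sub0set.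
+ rewrite cI mE; apply: leq_ltn_trans (_ : 6 + 4 < 12); rewrite // leq_add2r.
  apply: leq_trans (subset_leq_card (_ : _ \subset porbit g a :|: porbit g b)) _.
    apply/subsetP=> x; rewrite in_setU => /orP[|/imsetP[{}x + ->]].
      by rewrite !in_setU => /orP[]/(subsetP (interval_porbit _ _ _))->; rewrite ?orbT.
    rewrite !in_setU !porbit_step.
    by move=> /orP[]/(subsetP (interval_porbit _ _ _))->; rewrite ?orbT.
  by apply: leq_trans (leq_card_setU _ _) _; rewrite -[6]/(3 + 3); apply: leq_add; rewrite -p3.
+ by rewrite cI mE.
+ by rewrite cards0 mE.
move=> y yS; rewrite in_setU => /orP[yI|yI] _.
  by apply: (interval_escape p_pr gp aS _ (dI _ _ dab) yI); rewrite p3.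
rewrite setUC; apply: (interval_escape p_pr gp bS _ (dI _ _ _) yI); rewrite ?p3 //.
by rewrite disjoint_sym.
Qed.

(** For p = 2, five transpositions form an odd permutation. For p = 5, F has 11 points and L need
    not be trivial; but an interval of 4 points puts more than 921 elements into L, while [free_dvd]
    allows at most 11 * 10. *)
Lemma no_m10 : m = 10 -> False.
Proof.
move=> mE; have [a aS] := supp_pt.
have [/eqP p2|/eqP p5] : p == 2 \/ p == 5.
  by apply/orP; have := dvd_m; rewrite mE !inE.
  have := subsetP GA g gG; rewrite Alt_even invol_odd ?cg ?mE //.
  by rewrite -p2 gp.
have i4 : #|interval g a 4| = 4 by rewrite (card_interval p_pr gp aS) // p5.
have := @lb15 _ cT _ bigG (F :|: interval g a 4).
rewrite card_FU ?interval_sub // mE i4 => /(_ erefl).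
rewrite ltnNge => /negP[]; apply: leq_trans (_ : #|L| <= _).
  apply: subset_leq_card; rewrite subsetI subsetIl (interval_stab dG gG p_pr gp aS) //.
    by rewrite p5.
  by rewrite mE.
have := free_dvd (L := [group of L]) (m := m) (F := F) _ (subsetIr _ _).
have -> : #|F| = 11 by move: cF; rewrite mE => /eqP; rewrite -[21]/(11 + 10)%N eqn_add2r => /eqP.
move=> /(_ (fun s sL => dG (subsetP (subsetIl _ _) s sL))); rewrite mE.
by move=> /dvdn_leq => /(_ isT) le; apply: leq_trans le _.
Qed.

(** An element of order q in L is a single q-cycle, as 2 q > 21. Its support is a Jordan set with
    more than half of the points and disjoint from the support of g, so [jordan_set_triv] would give
    g = 1. *)
Lemma no_prime_L q : prime q -> 21 < 2 * q -> ~~ (q %| #|L|).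
Proof.
move=> q_pr q21; apply/negP=> /(Cauchy q_pr)[y yL oy].
have [yG] := setIP yL; rewrite mem_symOn => yF.
have yq : y ^+ q = 1 by rewrite -oy expg_order.
have y1 : y != 1 by rewrite -order_gt1 oy prime_gt1.
have sy : #|supp y| = q.
  have /dvdnP[[|[|c]] E] := prime_dvd_supp q_pr yq; rewrite ?mul1n // in E *.
    by move/eqP: E; rewrite cards_eq0 supp_eq0 (negPf y1).
  have := max_card (mem (supp y)); rewrite cT E leqNgt => /negP[].
  by apply: leq_trans q21 _; rewrite leq_mul2r orbT.
have G4 : mindeg G 4 by move=> s sG s1; apply: leq_trans (dG sG s1); apply: leq_trans m7.
have := jordan_set_triv G4 pG _ _ (prime_jordan_set q_pr yG yq sy) gG.
rewrite sy cT prime_gt1 // => /(_ isT q21) g1'; move: g1; rewrite g1' ?eqxx //.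
by rewrite subsetC.
Qed.

Lemma dG_L : mindeg L m.
Proof. by move=> s /setIP[sG _]; apply: dG. Qed.

(** The pointwise stabilizer of the part of the support of g outside I. For m = 9 and m = 8 the
    count |I :|: g @: I| + |I| only reaches m, so not every element of K I need commute with g. *)
Let K I := G :&: perm.Sym (F :|: I).

Lemma L_sub_K I : L \subset K I.
Proof.
apply/subsetP=> h /setIP[hG]; rewrite mem_symOn => hF; apply/setIP; split=> //.
by rewrite mem_symOn (subset_trans hF) ?subsetUl.
Qed.

Lemma K_image I h : h \in K I -> I \subset supp g -> h @: I \subset F :|: I.
Proof.
move=> /setIP[_]; rewrite mem_symOn => /supp_stabset; rewrite mem_stabset => /eqP E IS.
by rewrite -E; apply: imsetS; apply: subsetUr.
Qed.

(* [g, h] is supported on I :|: g I :|: h I, so when h does not commute with g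
   minimality of the degree leaves no room for h I to meet I. *)
Lemma K_dichotomy I h : I \subset supp g -> h \in K I ->
  #|I :|: g @: I| + #|I| <= m -> commute g h \/ [disjoint h @: I & I].
Proof.
move=> IS /setIP[hG]; rewrite mem_symOn => hI le.
have [/commgP cgh|n1] := boolP ([~ g, h] == 1); [by left | right].
set J := I :|: g @: I.
have le2 : m <= #|J :|: h @: I|.
  apply: leq_trans (dG (groupR gG hG) n1) _.
  apply: leq_trans (subset_leq_card (supp_commg g h)) _; apply: subset_leq_card.
  have JI : supp g :&: supp h \subset I.
    by apply/subsetP=> x /setIP[xg /(subsetP hI)]; rewrite !inE -in_supp xg.
  by rewrite !setUSS ?imsetS.
have chI : #|h @: I| = #|I| by rewrite card_imperm.
have J0 : J :&: h @: I = set0.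
  apply/eqP; rewrite -cards_eq0 -leqn0 -(leq_add2l #|J :|: h @: I|) addn0 cardsUI chI.
  exact: leq_trans le le2.
rewrite -setI_eq0 -subset0 -J0 setIC; apply: setSI; exact: subsetUl.
Qed.

Let C I := 'C_(K I)[g].

Lemma mem_C I h : h \in C I -> h \in K I /\ commute g h.
Proof. by case/setIP=> hK /cent1P; split. Qed.

Lemma C_fix I h x k : h \in C I -> x \in supp g -> (g ^+ k) x \notin I -> h x = x.
Proof.
move=> /mem_C[/setIP[_]]; rewrite mem_symOn => hI cgh xS kI.
apply: (commute_fix cgh (k := k)); apply/eqP/negPn; rewrite -in_supp.
apply/negP=> /(subsetP hI); rewrite in_setU (negPf kI) orbF inE.
by rewrite mem_expg_supp xS.
Qed.

Lemma C_image I h x : h \in C I -> x \in supp g -> h x != x -> h x \in I.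
Proof.
move=> /mem_C[/setIP[_]]; rewrite mem_symOn => hI cgh xS hx.
have hxS : h x \in supp g by rewrite (supp_commute _ (esym cgh)).
have : h x \in F :|: I by apply: (subsetP hI); rewrite supp_stable in_supp.
by rewrite in_setU inE hxS.
Qed.

Lemma C_sub_L I h : h \in C I -> (forall x, x \in I -> h x = x) -> h \in L.
Proof.
move=> /mem_C[/setIP[hG]]; rewrite mem_symOn => hI _ hx.
apply/setIP; split=> //; rewrite mem_symOn; apply/subsetP=> x xh.
have := subsetP hI x xh; rewrite in_setU => /orP[//|xI].
by rewrite in_supp hx ?eqxx in xh.
Qed.

(** By [K_dichotomy] an element h of K I with h I meeting I lies in C I, and C I preserves I. So O,
    the set of translates of I under K I, consists of disjoint sets packed into F and I, and C I
    contains the stabilizer of I. *)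
Lemma card_K_le I : I \subset supp g -> 0 < #|I| -> #|I :|: g @: I| + #|I| <= m ->
  exists O : {set {set T}},
   [/\ #|K I| <= #|O| * #|C I|, (#|O| * #|I| = #|cover O|)%N, cover O \subset F :|: I,
       (forall A, A \in O -> #|A| = #|I|) &
       I \in O /\ forall h A, h \in K I -> A \in O -> h @: A \in O].
Proof.
move=> IS I0 le; set O := orbit 'P^* (K I) I.
have OP A : A \in O -> exists2 h, h \in K I & A = h @: I.
  by case/orbitP=> h hK <-; exists h.
have cO A : A \in O -> #|A| = #|I|.
  by case/OP=> h hK ->; rewrite card_imset //; apply: perm_inj.
have stabC h : h \in K I -> ~~ [disjoint h @: I & I] -> h \in C I.
  move=> hK nd; have [cgh|d] := K_dichotomy IS hK le; last by rewrite d in nd.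
  by apply/setIP; split=> //; apply/cent1P.
have CI h : h \in C I -> h @: I = I.
  move=> hC; have [hK cgh] := mem_C hC.
  have E : I = supp g :&: (F :|: I).
    by rewrite setIUr setICr set0U; apply/esym/setIidPr.
  apply/eqP; rewrite imperm_eq.
  rewrite {2}E subsetI K_image // andbT; apply/subsetP=> _ /imsetP[x xI ->].
  by rewrite (supp_commute _ (esym cgh)) (subsetP IS).
exists O; split=> //.
- rewrite -(card_orbit_stab 'P^* [group of K I] I) leq_mul2l; apply/orP; right.
  apply: subset_leq_card; apply/subsetP=> h /setIP[hK /astab1P hI].
  apply: stabC => //; rewrite -setI_eq0 (_ : h @: I = I) ?setIid -?card_gt0 //.
- have tO : trivIset O.
    apply/trivIsetP=> _ _ /OP[h hK ->] /OP[k kK ->]; apply: contraR => nd.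
    have [x /= /andP[xh xk]] := pred0Pn nd.
    have hkC : h * k^-1 \in C I.
      apply: stabC; first by rewrite groupM ?groupV.
      have xk' : k^-1 x \in I by rewrite -mem_impermV.
      apply/pred0Pn; exists (k^-1 x); rewrite /= xk' andbT.
      rewrite mem_impermV invMg invgK permM permKV.
      by rewrite -mem_impermV.
    have -> : h @: I = k @: ((h * k^-1) @: I).
      by rewrite -imset_comp; apply: eq_imset => w /=; rewrite permM permKV.
    by rewrite CI.
  by rewrite -(eqP tO) -sum_nat_const; apply: eq_bigr => A /cO ->.
- by rewrite /cover; apply/bigcupsP=> _ /OP[h hK ->]; apply: K_image.
split; first exact: orbit_refl.
move=> h A hK /OP[k kK ->]; apply/orbitP; exists (k * h); first by rewrite groupM.
by rewrite /= !setactP -imset_comp; apply: eq_imset => x /=; rewrite permM.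
Qed.

Lemma cardF_eq k : (k + m)%N = 21 -> #|F| = k.
Proof. by move=> E; apply/eqP; rewrite -(eqn_add2r m) cF E. Qed.

(** Here p = 3 and I is a 3-cycle with one further point b. Four translates of I fit into 16 points.
    An element of C I fixes b, since g b is not in I, and is determined up to L by the image of a.
    As 11 does not divide |L|, |L| <= 12 * 10 * 9, and 4 * 3 * 1080 is less than 14742. *)
Lemma no_m9 : m = 9 -> False.
Proof.
move=> mE; have [a aS] := supp_pt.
have p3 : p = 3 by have := dvd_m; rewrite mE inE => /eqP.
have [|b bS /(_ a)] := @other_pt [:: a]; first by rewrite p3 mE.
rewrite mem_head => /(_ isT) ba.
have gb x : (g x \in [set b]) = (x == g^-1 b) by rewrite in_set1 (can2_eq (permK g) (permKV g)).
have ca : #|porbit g a| = 3.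
  by rewrite (porbit_interval p_pr gp aS) (card_interval p_pr gp aS) // p3.
pose I := porbit g a :|: [set b].
have cI : #|I| = 4 by rewrite /I setUC cardsU1 ba ca.
have IS : I \subset supp g.
  rewrite /I subUset (porbit_interval p_pr gp aS) interval_sub //=.
  by rewrite sub1set.
have cIg : #|I :|: g @: I| + #|I| <= m.
  rewrite cI mE; apply: leq_trans (_ : 5 + 4 <= 9); rewrite // leq_add2r.
  apply: leq_trans (subset_leq_card (_ : _ \subset porbit g a :|: [set b; g b])) _.
    apply/subsetP=> x; rewrite in_setU => /orP[|/imsetP[{}x + ->]].
      by rewrite !inE => /orP[]->; rewrite ?orbT.
    by rewrite !inE => /orP[|/eqP->]; rewrite ?porbit_step ?eqxx ?orbT // => ->.
  apply: leq_trans (leq_card_setU _ _) _; rewrite ca -[5]/(3 + 2) leq_add2l.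
  by rewrite cards2; case: (_ != _).
have I0 : 0 < #|I| by rewrite cI.
have [O [leK cO covO _ _]] := card_K_le IS I0 cIg.
have := @lb16 _ cT _ bigG (F :|: I); rewrite card_FU // mE cI => /(_ erefl).
have O4 : #|O| <= 4.
  rewrite -(leq_pmul2r (isT : 0 < 4)) -{1}cI cO (leq_trans (subset_leq_card covO)) //.
  by rewrite card_FU // mE cI.
have hb h : h \in C I -> h b = b.
  move=> hC; apply: (C_fix (k := 1) hC) => //; rewrite expg1 /I !inE negb_or porbit_step ba.
  by rewrite -in_supp bS.
have C3 : #|C I| <= 3 * #|L|.
  rewrite -ca; apply: (@orbit_stab_le _ [group of C I] _ a) => h hC.
    have [->|hna] := eqVneq (h a) a; first exact: porbit_id.
    have := C_image hC aS hna; rewrite /I !inE => /orP[//|/eqP hab].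
    by move: ba; rewrite -(perm_inj (etrans hab (esym (hb h hC)))) porbit_id.
  move=> ha; apply: (C_sub_L hC) => x; rewrite /I !inE => /orP[|/eqP->]; last exact: hb.
  rewrite (porbit_interval p_pr gp aS) => /imsetP[i _ ->].
  have [_ cgh] := mem_C hC; rewrite -permM (commuteX2 i 1 cgh : commute _ _) permM.
  by rewrite expg1 ha.
have L1 : #|L| <= 12 * 10 * 9.
  have := free_dvd (L := [group of L]) (F := F) dG_L (subsetIr _ _).
  rewrite (cardF_eq (k := 12)) ?mE // !ffactnS ffactn0 /= muln1.
  rewrite (mulnCA 12) Gauss_dvdr ?mulnA; first by move/dvdn_leq; apply.
  by rewrite coprime_sym prime_coprime // no_prime_L.
rewrite ltnNge => /negP[]; apply: leq_trans leK _.
apply: leq_trans (leq_mul O4 (leq_trans C3 (leq_mul (leqnn 3) L1))) _.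
by clear; lia.
Qed.

(** Here p = 2 and I consists of two 2-cycles, so |C I| <= 8 |L|. As 11 and 13 do not divide |L|,
    |L| <= 8640. Three translates of I give at most 24 * 8640 < 250000; with four translates a
    factor 5 of |L| has to be removed as well. *)
Lemma no_m8 : m = 8 -> False.
Proof.
move=> mE; have [a aS] := supp_pt.
have p2 : p = 2 by have := dvd_m; rewrite mE inE => /eqP.
have [|c cS /(_ a)] := @other_pt [:: a]; first by rewrite p2 mE.
rewrite mem_head => /(_ isT) ca.
have cp x : x \in supp g -> #|porbit g x| = 2.
  by move=> xS; rewrite (porbit_interval p_pr gp xS) (card_interval p_pr gp xS) // p2.
have ps x : x \in supp g -> porbit g x \subset supp g.
  by move=> xS; rewrite (porbit_interval p_pr gp xS) interval_sub.
pose I := porbit g a :|: porbit g c.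
have dI : porbit g a :&: porbit g c = set0.
  apply/setP=> x; rewrite !inE; apply/negP=> /andP[xa xc].
  by have := porbit_disj ca xa; rewrite xc.
have cI : #|I| = 4 by rewrite /I cardsU dI !cp // cards0.
have IS : I \subset supp g by rewrite /I subUset !ps.
have cIg : #|I :|: g @: I| + #|I| <= m.
  suff -> : I :|: g @: I = I by rewrite cI mE.
  apply/setUidPl/subsetP=> _ /imsetP[x + ->].
  by rewrite /I !in_setU !porbit_step.
have I0 : 0 < #|I| by rewrite cI.
have [O [leK cO covO cOA [IO KO]]] := card_K_le IS I0 cIg.
have := @lb17 _ cT _ bigG (F :|: I); rewrite card_FU // mE cI => /(_ erefl).
have cFI : #|F :|: I| = 17 by rewrite card_FU // mE cI.
have hp h x y : commute g h -> h x = x -> x \in supp g -> y \in porbit g x -> h y = y.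
  move=> cgh hx xS; rewrite (porbit_interval p_pr gp xS) => /imsetP[i _ ->].
  by rewrite -permM (commuteX2 i 1 cgh : commute _ _) permM expg1 hx.
have C8 : #|C I| <= 4 * (2 * #|L|).
  rewrite -{1}cI; apply: leq_trans (@orbit_stab_le _ [group of C I] I a 'C_(C I)[a | 'P] _ _) _.
  - move=> h hC; have [->|hna] := eqVneq (h a) a; first by rewrite in_setU porbit_id.
    exact: (C_image hC aS hna).
  - by move=> h hC ha; apply/setIP; split=> //; apply/astab1P.
  rewrite leq_mul2l; apply/orP; right; rewrite -(cp c cS).
  apply: (@orbit_stab_le _ [group of 'C_(C I)[a | 'P]] _ c) => h /setIP[hC /astab1P ha].
    have [->|hnc] := eqVneq (h c) c; first exact: porbit_id.
    have := C_image hC cS hnc; rewrite /I in_setU => /orP[hca|//].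
    have [_ cgh] := mem_C hC.
    have := hp h a (h c) cgh ha aS hca => /perm_inj E.
    by rewrite E eqxx in hnc.
  move=> hc; have [_ cgh] := mem_C hC.
  apply: (C_sub_L hC) => x; rewrite /I in_setU => /orP[]; [exact: (hp h a x cgh)|exact: (hp h c x cgh)].
have L1 : #|L| %| 5 * (12 * 2 * 9 * 8).
  have := free_dvd (L := [group of L]) (F := F) dG_L (subsetIr _ _).
  rewrite (cardF_eq (k := 13)) ?mE // !ffactnS ffactn0 /= muln1.
  rewrite Gauss_dvdr; last by rewrite coprime_sym prime_coprime // no_prime_L.
  rewrite (mulnCA 12) Gauss_dvdr; last by rewrite coprime_sym prime_coprime // no_prime_L.
  by rewrite !mulnA.
have O4 : #|O| <= 4.
  have : #|O| * 4 <= 17 by rewrite -{1}cI cO -cFI subset_leq_card.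
  by case: #|O| => [|[|[|[|[|k]]]]].
rewrite ltnNge => /negP[]; apply: leq_trans leK _.
have [O3|O3] := leqP #|O| 3.
  have L2 : #|L| <= 5 * (12 * 2 * 9 * 8) by apply: dvdn_leq.
  apply: leq_trans (leq_mul O3 (leq_trans C8 (leq_mul (leqnn 4) (leq_mul (leqnn 2) L2)))) _.
  by clear; lia.
have {O3 O4}O4 : #|O| = 4 by apply/eqP; rewrite eqn_leq O4.
suff L5 : ~~ (5 %| #|L|).
  have L2 : #|L| <= 12 * 2 * 9 * 8.
    by apply: dvdn_leq => //; rewrite -(@Gauss_dvdr _ 5) // coprime_sym prime_coprime.
  apply: leq_trans (leq_mul (eq_leq O4) (leq_trans C8 (leq_mul (leqnn 4) (leq_mul (leqnn 2) L2)))) _.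
  by clear; lia.
(* An element y of order 5 fixes each of the four translates and, as these have only 4 points, each
   of their points. Of the 17 points just one remains for its support. *)
apply/negP=> /(Cauchy (isT : prime 5))[y yL oy].
have y5 : y ^+ 5 = 1 by rewrite -oy expg_order.
have yK : y \in K I by apply: (subsetP (L_sub_K I)).
have yg : 5.-group <[y]> by rewrite /pgroup -orderE oy pnat_id.
have yO : [acts <[y]>, on O | 'P^*].
  rewrite gen_subG sub1set mem_stabpart; apply/forall_inP=> A; exact: KO.
have fO : 'Fix_(O | 'P^*)(<[y]>) = O.
  apply/eqP; rewrite eqEcard subsetIl /=; have := pgroup_fix_mod yg yO; rewrite O4.
  have := subset_leq_card (subsetIl O 'Fix_('P^*)(<[y]>)); rewrite O4.
  by case: #|_| => [|[|[|[|[|k]]]]].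
have dO : [disjoint supp y & cover O].
  apply/pred0P=> x /=; apply/andP=> -[xy /bigcupP[A AO xA]].
  have yA : y @: A = A.
    by have : A \in 'Fix_(O | 'P^*)(<[y]>) by [rewrite fO]; case/setIP=> _ /afixP/(_ y (cycle_id y)).
  have [|k] := cycle_escape (isT : prime 5) y5 xy (_ : #|A| < 5).
    by rewrite cOA // cI.
  by case/negP; elim: k => [|k IHk]; rewrite ?perm1 // expgSr permM -yA mem_imperm.
have : supp y \subset (F :|: I) :\: cover O.
  rewrite subsetD dO andbT; case/setIP: yL => _; rewrite mem_symOn => yF.
  exact: subset_trans yF (subsetUl _ _).
move/subset_leq_card; rewrite cardsDS // cFI -cO O4 cI => s1.
have : #|supp y| != 0%N by rewrite cards_eq0 supp_eq0 -order_gt1 oy.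
by have := supp_neq1 y; case: #|supp y| s1 => [|[|k]].
Qed.

Lemma no_mindeg8 : False.
Proof.
have := mindeg_le13; rewrite leq_eqVlt => /predU1P[/no_m13//|].
rewrite ltnS leq_eqVlt => /predU1P[/no_m12//|].
rewrite ltnS leq_eqVlt => /predU1P[/no_m11//|].
rewrite ltnS leq_eqVlt => /predU1P[/no_m10//|].
rewrite ltnS leq_eqVlt => /predU1P[/no_m9//|].
rewrite ltnS leq_eqVlt => /predU1P[/no_m8//|].
by rewrite ltnNge m7.
Qed.

End Degree21.

(** * Degree 21: enumeration of subsets of Z/21 *)

Fixpoint bitseqs (n m : nat) : seq bitseq :=
  if n is n'.+1 then
    [seq false :: b | b <- bitseqs n' m] ++
    (if m is m'.+1 then [seq true :: b | b <- bitseqs n' m'] else [::])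
  else if m is 0 then [:: [::]] else [::].

Lemma mem_bitseqs n m (b : bitseq) : size b = n -> count id b = m -> b \in bitseqs n m.
Proof.
elim: n m b => [|n IHn] m [|c b] //= => [_ <- //|[sb]].
case: c => /=; last first.
  by rewrite add0n => cb; rewrite mem_cat map_f ?IHn.
case: m => [|m]; first by rewrite add1n.
by rewrite add1n => -[cb]; rewrite mem_cat map_f ?IHn ?orbT.
Qed.

Fixpoint meet_count (b c : bitseq) : nat :=
  match b, c with
  | u :: b', v :: c' => if u && v then (meet_count b' c').+1 else meet_count b' c'
  | _, _ => 0
  end.

Lemma meet_count_map (A : Type) (f h : A -> bool) (l : seq A) :
  meet_count (map f l) (map h l) = count (fun k => f k && h k) l.
Proof. by elim: l => //= k l ->; case: (_ && _). Qed.

(* A bit sequence of length 21 stands for a subset of Z/21, rot for translation,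
   and [every3 0] tests for a subset of 3 Z/21.  [bad] lists sizes that the
   intersection of the supports of two conjugates cannot have. *)
Definition has_shift (bad : seq nat) (b c : bitseq) : bool :=
  has (fun i => meet_count b (seq.rot i c) \in bad) (iota 1 20).

Fixpoint every3 (j : nat) (b : bitseq) : bool :=
  if b is u :: b' then (if j is 0 then every3 2 b' else ~~ u && every3 j.-1 b') else true.

(** [head] tests that 0 is in the set. The exception occurs: in 3 Z/21 the difference sets with
    parameters (7, 4, 2) meet their translates in 0, 2 or 4 points. *)
Lemma check4 : all (fun b => head false b ==> has_shift [:: 1%N] b b || every3 0 b)
  (bitseqs 21 4).
Proof. by vm_compute. Qed.

(** Five points of 3 Z/21 meet their other translates in 0, 3 or 4 points; the size 4 is ruled out
    in [no_m5]. *)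
Lemma check5 : all (fun b => head false b ==> has_shift [:: 1%N; 4] b b) (bitseqs 21 5).
Proof. by vm_compute. Qed.

(** The second exception, period 7, consists of two cosets of 7 Z/21; such a set meets its
    translates in multiples of 3. *)
Lemma check6 : all (fun b => head false b ==>
   [|| has_shift [:: 1%N] b b, every3 0 b | seq.rot 7 b == b]) (bitseqs 21 6).
Proof. by vm_compute. Qed.

(** Sets of the two exceptional types cannot both occur as supports of conjugates. *)
Lemma check6_mixed :
  let l := [seq b <- bitseqs 21 6 | head false b] in
  all (fun b => all (fun c => has_shift [:: 1%N] b c) [seq c <- l | seq.rot 7 c == c])
    [seq b <- l | every3 0 b].
Proof. by vm_compute. Qed.

(** The size 2 is ruled out in [no_m7]; the exception is the subgroup 3 Z/21 itself. *)
Lemma check7 : all (fun b => head false b ==> has_shift [:: 1%N; 2] b b || every3 0 b)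
  (bitseqs 21 7).
Proof. by vm_compute. Qed.

(** * Supports of the conjugates of an element of a primitive group *)

Section Conjugates.

Variable T : finType.
Implicit Types (X Y B F I D : {set T}) (s g h : {perm T}).
Variable G : {group {perm T}}.
Hypothesis (pG : prim G).

Lemma prim_classes (E : rel T) : equivalence_rel E ->
  (forall h u v, h \in G -> E u v -> E (h u) (h v)) ->
  (forall u v, E u v -> u = v) \/ (forall u v, E u v).
Proof.
move=> /equivalence_relP[rE tE] GE.
have [/forallP E1|] := boolP [forall u, forall v, E u v ==> (u == v)].
  by left=> u v uv; apply/eqP; apply: (implyP (forallP (E1 u) v)).
rewrite negb_forall => /existsP[u0]; rewrite negb_forall => /existsP[v0].
rewrite negb_imply => /andP[uv0 nuv]; right.
pose X := [set v | E u0 v].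
have XT : X = setT.
  apply: (prim_block pG).
    apply/blockP=> h w hG; rewrite !inE => uw uhw.
    have sub : h @: X \subset X.
      apply/subsetP=> _ /imsetP[z + ->]; rewrite !inE => uz.
      have := GE h w z hG; rewrite -(tE _ _ uw) => /(_ uz).
      by rewrite (tE _ _ uhw).
    by apply/eqP; rewrite eqEcard sub card_imset ?leqnn //; apply: perm_inj.
  apply: leq_trans (_ : #|[set u0; v0]| <= _); first by rewrite cards2 nuv.
  by apply: subset_leq_card; apply/subsetP=> w; rewrite !inE => /orP[]/eqP-> //; rewrite rE.
have all0 v : E u0 v by have := in_setT v; rewrite -XT inE.
by move=> u v; rewrite -(tE _ _ (all0 u)).
Qed.

Variables (m : nat) (g : {perm T}).
Hypotheses (gG : g \in G) (g1 : g != 1).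

(** The conjugates of g generate a subgroup normalized by G. Its orbits are the classes of an
    invariant equivalence, so by primitivity it is transitive; but by hypothesis it preserves every
    cycle of y. *)
Lemma conj_cover (y : {perm T}) :
  (forall h u, h \in G -> u \in supp (g ^ h) -> supp (g ^ h) \subset porbit y u) ->
  forall u, porbit y u = setT.
Proof.
move=> sub u.
pose H := <<class_support [set g] G>>.
have nH h : h \in G -> H :^ h = H.
  move=> hG; rewrite -genJ; congr <<_>>.
  apply/setP=> z; rewrite mem_conjg; apply/imset2P/imset2P=> -[a f /set1P-> fG E].
    exists g (f * h); rewrite ?set11 ?groupM // conjgM -E conjgKV //.
  by exists g (f * h^-1); rewrite ?set11 ?groupM ?groupV // conjgM -E.
have hH : H \subset 'N(porbit y u | 'P).
  rewrite gen_subG; apply/subsetP=> _ /imset2P[_ h /set1P-> hG ->].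
  rewrite mem_stabset imperm_eq.
  apply/subsetP=> _ /imsetP[w wu ->].
  have [ws|] := boolP (w \in supp (g ^ h)); last by rewrite inE negbK => /eqP->.
  have := subsetP (sub h w hG ws) ((g ^ h) w); rewrite supp_stable => /(_ ws).
  by rewrite -!eq_porbit_mem in wu * => /eqP->.
have [] := @prim_classes (fun a b => orbit 'P H a == orbit 'P H b).
- by apply/equivalence_relP; split=> [a|a b /eqP E c] //; rewrite E.
- move=> h a b hG /eqP/esym E.
  have : b \in orbit 'P H a by rewrite -E orbit_refl.
  case/orbitP=> f fH fa; apply/eqP/esym.
  apply/orbit_eqP/orbitP; exists (f ^ h).
    by have : f ^ h \in H :^ h; [rewrite memJ_conjg | rewrite nH].
  by rewrite /= /aperm permJ -fa.
- move=> E1; have /set0Pn[a ag] : supp g != set0 by rewrite supp_eq0.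
  have : a = g a.
    apply: E1; apply/eqP/esym/orbit_eqP/orbitP; exists g => //.
    apply: mem_gen; apply/imset2P; exists g 1; rewrite ?set11 ?group1 ?conjg1 //.
  by move/eqP; rewrite eq_sym; move: ag; rewrite in_supp => /negPf->.
move=> E; apply/setP=> v; rewrite inE; have /eqP/orbit_eqP/orbitP[h hH' <-] := E v u.
by rewrite /= /aperm (acts_mem _ (subsetP hH h hH')) porbit_id.
Qed.

(** Lying in the same supports of conjugates is a G-invariant equivalence. It is not universal, so
    it is equality, and y moves each point within its class. *)
Lemma conj_period (y : {perm T}) : (forall h, h \in G -> y @: supp (g ^ h) = supp (g ^ h)) ->
  supp g != setT -> y = 1.
Proof.
move=> per gT.
pose E a b := [forall h in G, (a \in supp (g ^ h)) == (b \in supp (g ^ h))].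
have [] := @prim_classes E.
- apply/equivalence_relP; split=> [a|a b /forall_inP ab c].
    by apply/forall_inP.
  by apply: eq_forallb => h; case: (boolP (h \in G)) => //= hG; rewrite (eqP (ab h hG)).
- move=> f a b fG /forall_inP ab; apply/forall_inP=> h hG.
  have -> : g ^ h = (g ^ (h * f^-1)) ^ f by rewrite -conjgM mulgKV.
  by rewrite suppJ !mem_imperm ab // groupM ?groupV.
- move=> E1; apply/permP=> a; rewrite perm1; apply/esym/E1/forall_inP=> h hG.
  by rewrite -{2}(per h hG) mem_imperm.
move=> Eall; case/negP: gT; rewrite eqEsubset subsetT; apply/subsetP=> b _.
have /set0Pn[a ag] : supp g != set0 by rewrite supp_eq0.
by have /forall_inP/(_ 1 (group1 G)) := Eall a b; rewrite conjg1 ag => /eqP <-.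
Qed.

End Conjugates.

(** * Degree 21: minimal degree at most 7 *)

Section Degree21.

Variable T : finType.
Hypothesis cT : #|T| = 21.
Implicit Types (X B F I D : {set T}) (s h : {perm T}).
Variable G : {group {perm T}}.
Hypotheses (GA : G \subset 'Alt_T) (pG : prim G).
Variable x : {perm T}.
Hypotheses (xG : x \in G) (xT : forall u v : T, exists k, (x ^+ k) u = v).
Variables (m p : nat) (g : {perm T}).
Hypotheses (dG : mindeg G m) (gG : g \in G) (g1 : g != 1) (cg : #|supp g| = m).
Hypotheses (p_pr : prime p) (gp : g ^+ p = 1) (m3 : 3 < m).

Lemma x21 : x ^+ 21 = 1.
Proof.
apply/permP=> o; rewrite perm1 permX.
have -> : 21 = #|porbit x o|; last exact: iter_porbit.
rewrite -cT -cardsT; congr #|pred_of_set _|; apply/esym/setP=> v; rewrite inE.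
by have [k <-] := xT o v; apply: mem_porbit.
Qed.

Lemma xP o v : exists k : 'I_21, (x ^+ k) o = v.
Proof.
have [k <-] := xT o v; exists (inord (k %% 21)).
by rewrite inordK ?ltn_mod // (expg_mod _ x21).
Qed.

Lemma card_count o (P : pred T) :
  #|[set z | P z]| = count (fun k => P ((x ^+ k) o)) (iota 0 21).
Proof.
pose f (k : 'I_21) := (x ^+ k) o.
have fI : injective f.
  apply/injectiveP/card_uniqP; rewrite size_map -cardT card_ord.
  transitivity #|T|; last exact: cT.
  by apply: eq_card => v; rewrite inE; have [k <-] := xP o v; apply: codom_f.
have -> : [set z | P z] = f @: [set k | P (f k)].
  apply/setP=> v; rewrite inE; apply/idP/imsetP=> [Pv|[k + ->]]; last by rewrite inE.
  by have [k E] := xP o v; exists k; rewrite ?inE /f E.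
rewrite card_imset // -val_enum_ord count_map cardsE cardE -size_filter /enum_mem.
by rewrite -enumT filter_predT //.
Qed.

Definition bits s o := [seq (x ^+ k) o \in supp s | k <- iota 0 21].

Lemma size_bits s o : size (bits s o) = 21. Proof. by rewrite size_map size_iota. Qed.

Lemma count_bits s o : count id (bits s o) = #|supp s|.
Proof.
by rewrite count_map -(card_count o (mem (supp s))); apply: eq_card => z; rewrite inE.
Qed.

Lemma head_bits s o : head false (bits s o) = (o \in supp s).
Proof. by rewrite /= perm1. Qed.

Lemma rot_bits s o i : i < 21 -> seq.rot i (bits s o) = bits s ((x ^+ i) o).
Proof.
move=> i21; rewrite /bits -map_rot.
rewrite -[in LHS](subnKC (ltnW i21)) iotaD /seq.rot drop_size_cat ?size_iota //.
rewrite take_size_cat ?size_iota // add0n.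
have -> : [seq (x ^+ k) ((x ^+ i) o) \in supp s | k <- iota 0 21] =
          [seq (x ^+ k) o \in supp s | k <- iota i 21].
  have -> : iota i 21 = map (addn i) (iota 0 21) by rewrite -iotaDl addn0.
  by rewrite -map_comp; apply: eq_map => k /=; rewrite -permM -expgD.
have -> : iota i 21 = iota i (21 - i) ++ iota 21 i.
  by rewrite -[in iota 21 _](subnKC (ltnW i21)) -iotaD subnK // ltnW.
rewrite !map_cat; congr (_ ++ _).
have -> : iota 21 i = map (addn 21) (iota 0 i) by rewrite -iotaDl addn0.
by rewrite -map_comp; apply: eq_map => k /=; rewrite expgD x21 mul1g.
Qed.

(** Rotating the sequence of h amounts to conjugating h by a power of x, so all intersections of a
    support with translates of another one are realized by conjugates. *)
Lemma meet_bits s h o i : i < 21 ->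
  meet_count (bits s o) (seq.rot i (bits h o)) = #|supp s :&: supp (h ^ (x ^- i))|.
Proof.
move=> i21; rewrite rot_bits // meet_count_map.
transitivity #|[set z | (z \in supp s) && ((x ^+ i) z \in supp h)]|.
  rewrite (card_count o); apply: eq_count => k /=.
  by rewrite -!permM -!expgD addnC.
by apply: eq_card => z; rewrite in_set in_setI suppJ mem_impermV invgK.
Qed.

Lemma has_shift_meet bad s h o : has_shift bad (bits s o) (bits h o) ->
  exists2 k, k \in G & #|supp s :&: supp (h ^ k)| \in bad.
Proof.
case/hasP=> i; rewrite mem_iota => /andP[_ i21].
by rewrite meet_bits // => ib; exists (x ^- i); rewrite ?groupV ?groupX.
Qed.

Lemma every3P b j k : j < 3 -> every3 j b -> nth false b k -> k = j %[mod 3].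
Proof.
elim: b j k => [|u b IHb] j k /=; first by rewrite nth_nil.
case: j => [|j] j3.
  by case: k => [//|k] e3 bk; rewrite -addn1 -modnDml (IHb 2 k).
case/andP=> /negPf-> e3; case: k => [//|k] /= bk.
by rewrite -addn1 -modnDml (IHb j k) ?(ltnW j3) // modnDml addn1.
Qed.

Lemma bits_every3 s o u : every3 0 (bits s o) -> u \in supp s -> u \in porbit (x ^+ 3) o.
Proof.
move=> e3 us; have [k ku] := xP o u.
have bk : nth false (bits s o) k by rewrite (nth_map 0%N) ?size_iota // nth_iota // add0n ku.
have /eqP := every3P (isT : 0 < 3) e3 bk; rewrite mod0n => /dvdnP[j E].
by rewrite -ku E mulnC expgM mem_porbit.
Qed.

(** If the support of each conjugate lay in one coset of 3 Z/21, [conj_cover] would make x^3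
    transitive, but its cycles have at most 7 points. *)
Lemma type3_absurd : (forall h o, h \in G -> o \in supp (g ^ h) -> every3 0 (bits (g ^ h) o)) ->
  False.
Proof.
move=> e3; have [o _] : exists o, o \in supp g by apply/set0Pn; rewrite supp_eq0.
have : porbit (x ^+ 3) o = setT.
  apply: (conj_cover pG g1) => h u hG uS; apply/subsetP=> v vS.
  exact: (bits_every3 (e3 h u hG uS) vS).
move=> E; have := @card_porbit_le _ 7 (x ^+ 3) o isT; rewrite -expgM x21 E cardsT cT.
by move=> /(_ erefl).
Qed.

Lemma bits_period s o : seq.rot 7 (bits s o) = bits s o -> (x ^+ 7) @: supp s = supp s.
Proof.
rewrite rot_bits // => E; apply/eqP; rewrite imperm_eq.
apply/subsetP=> _ /imsetP[u us ->]; have [k ku] := xP o u.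
have := congr1 (fun b => nth false b k) E.
rewrite !(nth_map 0%N) ?size_iota // nth_iota // add0n ku us -permM -expgD addnC expgD permM ku.
by [].
Qed.

Lemma period_bits s o : (x ^+ 7) @: supp s = supp s -> seq.rot 7 (bits s o) = bits s o.
Proof.
move=> per; rewrite rot_bits //; apply: eq_map => k.
by rewrite -permM -expgD addnC expgD permM -{1}per mem_imperm.
Qed.

Let G4 : mindeg G 4.
Proof. by move=> s sG s1; apply: leq_trans (dG sG s1). Qed.

Lemma no_shift1 s h o : s \in G -> h \in G -> ~~ has_shift [:: 1%N] (bits s o) (bits h o).
Proof.
move=> sG hG; apply/negP=> /has_shift_meet[k kG]; rewrite inE => /eqP E.
by have := mindeg_inter1 G4 sG (groupJ hG kG); rewrite E.
Qed.

Lemma bits_in s o : #|supp s| = m -> bits s o \in bitseqs 21 m.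
Proof. by move=> sm; rewrite mem_bitseqs ?size_bits ?count_bits. Qed.

Lemma no_m4 : m = 4 -> False.
Proof.
move=> mE; apply: type3_absurd => h o hG oS.
have := allP check4 (bits (g ^ h) o).
rewrite -[X in bitseqs _ X]mE bits_in ?card_suppJ // => /(_ isT).
by rewrite head_bits oS (negPf (no_shift1 _ _ _)) ?groupJ.
Qed.

(** If the 5-cycles g and g ^ k overlap in 4 points, they generate a group J that is transitive on 6
    points, hence of even order. An involution of J is even and moves 2, 4 or 6 points, so it moves
    4, fewer than m. *)
Lemma no_m5 : m = 5 -> False.
Proof.
move=> mE; have [o oS] : exists o, o \in supp g by apply/set0Pn; rewrite supp_eq0.
have p5 : p = 5.
  by have := prime_dvd_supp p_pr gp; rewrite cg mE dvdn_prime2 // => /eqP.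
have := allP check5 (bits g o).
rewrite -[X in bitseqs _ X]mE bits_in // => /(_ isT).
rewrite head_bits oS => /has_shift_meet[k kG]; rewrite !inE.
have gkG := groupJ gG kG.
case/orP=> /eqP E; first by have := mindeg_inter1 G4 gG gkG; rewrite E.
pose X := supp g :|: supp (g ^ k).
have cX : #|X| = 6 by rewrite /X cardsU E card_suppJ cg mE.
pose J := <<[set g; g ^ k]>>.
have JG : J \subset G.
  by rewrite gen_subG; apply/subsetP=> z; rewrite !inE => /orP[]/eqP->.
have JX : J \subset perm.Sym X.
  by rewrite gen_subG; apply/subsetP=> z /set2P[]->; rewrite mem_symOn ?subsetUl ?subsetUr.
have gJ : g \in J by rewrite mem_gen // !inE eqxx.
have gkJ : g ^ k \in J by rewrite mem_gen // !inE eqxx orbT.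
have cyc (y : {perm T}) u : y \in J -> y ^+ p = 1 -> #|supp y| = p -> u \in supp y ->
    supp y \subset orbit 'P J u.
  move=> yJ yp cy uy; have : porbit y u = supp y.
    apply/eqP; rewrite (porbit_interval p_pr yp uy) eqEcard interval_sub //= cy.
    by rewrite (card_interval p_pr yp uy).
  move=> <-; apply/subsetP=> _ /porbitP[i ->].
  by apply/orbitP; exists (y ^+ i); rewrite ?groupX.
have [w] : exists w, w \in supp g :&: supp (g ^ k) by apply/set0Pn; rewrite -card_gt0 E.
case/setIP=> wg wk.
have oX : orbit 'P J w = X.
  apply/eqP; rewrite eqEsubset; apply/andP; split.
    apply/subsetP=> _ /orbitP[h hJ <-]; rewrite /= /aperm.
    have := subsetP JX h hJ; rewrite mem_symOn => /supp_stabset/acts_mem->.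
    by rewrite in_setU wg.
  by rewrite subUset !cyc // ?card_suppJ ?cg ?mE ?p5 // -conjXg -p5 gp conj1g.
have : 2 %| #|J|.
  by rewrite -(card_orbit_stab 'P [group of J] w) oX cX dvdn_mulr.
case/(Cauchy (isT : prime 2)) => t tJ ot.
have t2 : t ^+ 2 = 1 by rewrite -ot expg_order.
have t1 : t != 1 by rewrite -order_gt1 ot.
have tG := subsetP JG t tJ.
have := subsetP GA t tG; rewrite Alt_even invol_odd //.
have := dG tG t1; rewrite mE.
have := subsetP JX t tJ; rewrite mem_symOn => /subset_leq_card; rewrite cX.
have := prime_dvd_supp (isT : prime 2) t2.
by case: #|supp t| => [|[|[|[|[|[|[|]]]]]]].
Qed.

(** All conjugates are of the same exceptional type. The first is excluded by [type3_absurd]; in the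
    second, x^7 preserves all supports, so [conj_period] gives x^7 = 1. *)
Lemma no_m6 : m = 6 -> False.
Proof.
move=> mE.
have tp h o : h \in G -> o \in supp (g ^ h) -> every3 0 (bits (g ^ h) o) \/
    seq.rot 7 (bits (g ^ h) o) = bits (g ^ h) o.
  move=> hG oS; have := allP check6 (bits (g ^ h) o).
  rewrite -[X in bitseqs _ X]mE bits_in ?card_suppJ // => /(_ isT).
  rewrite head_bits oS (negPf (no_shift1 _ _ _)) ?groupJ //=.
  by case/orP=> [|/eqP]; [left|right].
have memf h o : o \in supp (g ^ h) -> bits (g ^ h) o \in [seq b <- bitseqs 21 6 | head false b].
  by move=> oS; rewrite mem_filter head_bits oS -[X in bitseqs _ X]mE bits_in ?card_suppJ.
have mixed h1 o1 h2 o2 : h1 \in G -> o1 \in supp (g ^ h1) -> every3 0 (bits (g ^ h1) o1) ->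
    h2 \in G -> o2 \in supp (g ^ h2) -> seq.rot 7 (bits (g ^ h2) o2) = bits (g ^ h2) o2 -> False.
  move=> h1G o1S e3 h2G o2S r7; have [k kE] := xT o2 o1.
  have o1S2 : o1 \in supp (g ^ (h2 * x ^+ k)) by rewrite conjgM suppJ -kE mem_imperm.
  have := allP check6_mixed (bits (g ^ h1) o1).
  rewrite mem_filter e3 memf // => /(_ isT)/allP/(_ (bits (g ^ (h2 * x ^+ k)) o1)).
  rewrite mem_filter memf // andbT.
  rewrite (negPf (no_shift1 _ _ _)) ?groupJ ?groupM ?groupX // => nr.
  have {}nr : seq.rot 7 (bits (g ^ (h2 * x ^+ k)) o1) == bits (g ^ (h2 * x ^+ k)) o1 -> False by move/nr.
  apply: nr; apply/eqP/period_bits; rewrite conjgM suppJ -imset_comp.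
  rewrite -[in RHS](bits_period r7) -imset_comp; apply: eq_imset => z /=.
  by rewrite -!permM -!expgD addnC.
have [o oS] : exists o, o \in supp g by apply/set0Pn; rewrite supp_eq0.
have oS1 : o \in supp (g ^ 1) by rewrite conjg1.
case: (tp 1 o (group1 G) oS1) => [e3|r7].
  apply: type3_absurd => h o' hG o'S; case: (tp h o' hG o'S) => // r7.
  by case: (mixed 1 o h o').
have x7 : x ^+ 7 = 1.
  apply: (conj_period pG g1) => [h hG|]; last first.
    by apply/eqP=> gT; have := cg; rewrite gT cardsT cT mE.
  have [o' o'S] : exists o', o' \in supp (g ^ h) by apply/set0Pn; rewrite -card_gt0 card_suppJ cg mE.
  case: (tp h o' hG o'S) => [e3|/bits_period//].
  by case: (mixed h o' 1 o).
have := @card_porbit_le _ 7 x o isT x7.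
have -> : porbit x o = setT; last by rewrite cardsT cT.
by apply/setP=> v; rewrite inE; have [k <-] := xT o v; apply: mem_porbit.
Qed.

(** If the supports of two conjugates share one or two points, their commutator moves at most 6
    points, so they commute. Then the common points are stable under a 7-cycle, which is
    impossible. *)
Lemma no_m7 : m = 7 -> False.
Proof.
move=> mE; apply: type3_absurd => h o hG oS.
have p7 : p = 7.
  by have := prime_dvd_supp p_pr gp; rewrite cg mE dvdn_prime2 // => /eqP.
have := allP check7 (bits (g ^ h) o).
rewrite -[X in bitseqs _ X]mE bits_in ?card_suppJ // => /(_ isT).
rewrite head_bits oS /= => /orP[/has_shift_meet[k kG]|//]; rewrite !inE => lt.
have ghG := groupJ gG hG; have ghkG := groupJ ghG kG.
have ghp : (g ^ h) ^+ p = 1 by rewrite -conjXg gp conj1g.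
set s := g ^ h in oS lt ghG ghkG ghp *; set s' := s ^ k in lt ghkG *.
have cgh : commute s s'.
  apply/commgP; apply: contraT => n1; have := dG (groupR ghG ghkG) n1.
  rewrite mE leqNgt => /negP[]; apply: leq_ltn_trans (subset_leq_card (supp_commg _ _)) _.
  apply: leq_ltn_trans (leq_card_setU _ _) _.
  apply: leq_ltn_trans (leq_add (leq_card_setU _ _) (leqnn _)) _.
  rewrite !card_imset; [|exact: perm_inj|exact: perm_inj].
  by case/orP: lt => /eqP->.
have [w] : exists w, w \in supp s :&: supp s' by apply/set0Pn; rewrite -card_gt0; case/orP: lt => /eqP->.
case/setIP=> ws ws'.
have [|i] := cycle_escape p_pr ghp ws (_ : #|supp s :&: supp s'| < p).
  by rewrite p7; case/orP: lt => /eqP->.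
case/negP; elim: i => [|i IHi]; first by rewrite perm1 inE ws.
move: IHi; rewrite expgSr permM !in_setI supp_stable => /andP[-> /=].
by rewrite (supp_commute _ cgh).
Qed.

End Degree21.

Theorem prim21 (T : finType) (G : {group {perm T}}) (x : {perm T}) :
  #|T| = 21 -> G \subset 'Alt_T -> prim G -> ~~ ('Alt_T \subset G) ->
  x \in G -> (forall u v : T, exists k, (x ^+ k) u = v) ->
  #|G| <= 36 * (1000 * 1000 * 1000).
Proof.
move=> cT GA pG nAG xG xT; rewrite leqNgt; apply/negP=> bigG.
have G1 : G :!=: 1.
  by apply: contraTneq bigG => ->; rewrite cards1.
have [m [dG [g [p [gG g1 cg p_pr gp]]]]] := mindeg_ex G1.
have m3 : 3 < m.
  rewrite -cg; have := supp_neq1 g; have := supp_gt0 g; rewrite g1.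
  have := @supp2_odd _ g; have := @jordan3 _ G g pG gG.
  have := subsetP GA g gG; rewrite Alt_even.
  case: #|supp g| => [|[|[|[|k]]]] // ge; first by move=> _ /(_ erefl); rewrite (negPf ge).
  by move=> /(_ erefl) AG; rewrite AG in nAG.
have [m7|] := ltnP 7 m; first exact: (no_mindeg8 cT GA pG bigG dG gG g1 cg p_pr gp m7).
rewrite leq_eqVlt => /predU1P[|].
  exact: (no_m7 cT pG xG xT dG gG g1 cg p_pr gp).
rewrite ltnS leq_eqVlt => /predU1P[|].
  exact: (no_m6 cT pG xG xT dG gG g1 cg m3).
rewrite ltnS leq_eqVlt => /predU1P[|].
  exact: (no_m5 cT GA xG xT dG gG g1 cg p_pr gp m3).
rewrite ltnS leq_eqVlt => /predU1P[|].
  exact: (no_m4 cT pG xG xT dG gG g1 cg m3).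
by rewrite ltnNge m3.
Qed.

(** * Permutations with at most three cycles *)

Section ThreeCycles.

Variables (n i j : nat).
Hypothesis ijn : i + j < n.

Definition nxt (x : nat) : nat :=
  if x.+1 == i then 0 else if x.+1 == (i + j)%N then i
  else if x.+1 == n then (i + j)%N else x.+1.

Lemma nxt_lt x : x < n -> nxt x < n.
Proof. by rewrite /nxt; move: ijn; do ?case: ifP => ?; lia. Qed.

Lemma nxt_inj x y : x < n -> y < n -> nxt x = nxt y -> x = y.
Proof. by rewrite /nxt; move: ijn; do ?case: ifP => ?; lia. Qed.

Definition nxt_ord (x : 'I_n) : 'I_n := Ordinal (nxt_lt (ltn_ord x)).

Lemma nxt_ord_inj : injective nxt_ord.
Proof. by move=> x y [E]; apply/val_inj/(nxt_inj (ltn_ord x) (ltn_ord y)). Qed.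

(* The cycles are the intervals [0, i), [i, i + j), [i + j, n);
   for i = j = 0 this is an n-cycle. *)
Definition cyc : {perm 'I_n} := perm nxt_ord_inj.

Lemma cycE x : val (cyc x) = nxt x.
Proof. by rewrite permE. Qed.

Definition start (x : nat) : nat :=
  if x < i then 0 else if x < i + j then i else (i + j)%N.

Lemma start_start x : start (start x) = start x.
Proof. by rewrite {2 3}/start; do ?case: ifP => ?; rewrite /start; do ?case: ifP => ?; lia. Qed.

Lemma start_lt x : start x < n.
Proof. by rewrite /start; move: ijn; do ?case: ifP => ?; lia. Qed.

Definition start_ord (x : 'I_n) : 'I_n := Ordinal (start_lt x).

Lemma start_ind (P : 'I_n -> Prop) :
  (forall x, P (start_ord x)) -> (forall x, P x -> P (cyc x)) -> forall x, P x.
Proof.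
move=> P0 PS x; have [m] := ubnP (x : nat); elim: m x => // m IHm x xm.
have [E|ne] := eqVneq (x : nat) (start x).
  by have -> : x = start_ord x by apply: val_inj.
have x0 : 0 < x.
  by move: ne; rewrite /start; case: (nat_of_ord x) => //; do ?case: ifP => ?; lia.
have yn : x.-1 < n by apply: leq_ltn_trans (ltn_ord x); apply: leq_pred.
have -> : x = cyc (Ordinal yn).
  apply: val_inj; rewrite cycE /nxt /= prednK //.
  by move: ne (ltn_ord x); rewrite /start; do ?case: ifP => ?; do ?case: ifP => ?; lia.
by apply/PS/IHm => /=; move: xm; rewrite -{1}(prednK x0) ltnS.
Qed.

Lemma cyc_start x : start (cyc x) = start x.
Proof.
rewrite cycE /nxt; move: (ltn_ord x) ijn.
by do ?case: ifP => ?; rewrite /start; do ?case: ifP => ?; lia.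
Qed.

Section Invariant.

Variable B : {set 'I_n}.
Hypothesis gB : cyc @: B = B.

Lemma inv_start x : (x \in B) = (start_ord x \in B).
Proof.
move: x; apply: start_ind => x.
  congr (_ \in B); apply: val_inj; rewrite /= /start.
  by do ?case: ifP => ?; lia.
by move=> E; rewrite -{1}gB mem_imperm E; congr (_ \in B); apply: val_inj; rewrite /= cyc_start.
Qed.

Definition bit (k : nat) : bool := [exists x in B, val x == k].

Lemma inv_bit (x : 'I_n) : (x \in B) = bit (start x).
Proof.
rewrite inv_start; apply/idP/exists_inP=> [xB | [y yB /eqP E]].
  by exists (start_ord x).
by have -> : start_ord x = y by apply: val_inj.
Qed.

Lemma card_inv : #|B| = (bit 0 * i + bit i * j + bit (i + j) * (n - (i + j)))%N.
Proof.
rewrite -sum1_card (eq_bigl (fun x : 'I_n => bit (start x))); last exact: inv_bit.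
rewrite (big_mkcond (fun x : 'I_n => bit (start x))) /=.
rewrite -(big_mkord xpredT (fun k => if bit (start k) then 1%N else 0%N)).
rewrite (@big_cat_nat _ _ _ i) //=; last by move: ijn; lia.
rewrite (@big_cat_nat _ _ _ (i + j) i) ?leq_addr //=; last by move: ijn; lia.
rewrite addnA; congr (_ + _ + _)%N.
- rewrite (eq_big_nat _ _ (F2 := fun=> nat_of_bool (bit 0))).
    by rewrite sum_nat_const_nat subn0 mulnC.
  by move=> k /andP[_ ki]; rewrite /start ki; case: bit.
- rewrite (eq_big_nat _ _ (F2 := fun=> nat_of_bool (bit i))).
    by rewrite sum_nat_const_nat addKn mulnC.
  by move=> k /andP[ik ki]; rewrite /start ltnNge ik /= ki; case: bit.
rewrite (eq_big_nat _ _ (F2 := fun=> nat_of_bool (bit (i + j)))).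
  by rewrite sum_nat_const_nat mulnC.
move=> k /andP[ik ki]; rewrite /start !ltnNge ik /= (leq_trans (leq_addr j i) ik) /=.
by case: bit.
Qed.

End Invariant.

Lemma inv_eq (B B' : {set 'I_n}) : cyc @: B = B -> cyc @: B' = B' ->
  bit B 0 = bit B' 0 -> bit B i = bit B' i -> bit B (i + j) = bit B' (i + j) -> B = B'.
Proof.
move=> gB gB' e1 e2 e3; apply/setP=> x; rewrite !inv_bit // /start.
by do ?case: ifP => _.
Qed.

Definition seg a b : {set 'I_n} := [set x : 'I_n | a <= x < b].

Lemma seg_inv a b : [\/ (a, b) = (0, i), (a, b) = (i, i + j)%N | (a, b) = ((i + j)%N, n)] ->
  cyc @: seg a b = seg a b.
Proof.
move=> ab; apply/eqP; rewrite imperm_eq.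
apply/subsetP=> _ /imsetP[x + ->]; rewrite !inE cycE /nxt; move: (ltn_ord x) ijn.
by case: ab => -[-> ->]; do ?case: ifP => ?; lia.
Qed.

Lemma porbit_start x : porbit cyc x = porbit cyc (start_ord x).
Proof.
move: x; apply: start_ind => x.
  by congr porbit; apply: val_inj; rewrite /= /start; do ?case: ifP => ?; lia.
move=> E; rewrite -(porbit_perm cyc 1 x) expg1 in E.
rewrite E; congr porbit; apply: val_inj; exact/esym/cyc_start.
Qed.

Lemma porbit_cyc x y : (y \in porbit cyc x) = (start y == start x).
Proof.
apply/idP/eqP => [/porbitP[m ->] | E].
  by elim: m => [|m IHm]; rewrite ?perm1 // expgSr permM cyc_start.
rewrite -eq_porbit_mem porbit_start [in X in _ == X]porbit_start; apply/eqP; congr porbit.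
exact: val_inj.
Qed.

Lemma card_porbits_cyc : #|porbits cyc| = #|[set start_ord x | x in 'I_n]|.
Proof.
have -> : porbits cyc = [set porbit cyc x | x in [set start_ord x | x in 'I_n]].
  apply/setP=> X; apply/imsetP/imsetP => [[x _ ->] | [_ /imsetP[x _ ->] ->]].
    by exists (start_ord x); rewrite ?imset_f // porbit_start.
  by exists (start_ord x).
apply: card_in_imset => _ _ /imsetP[x _ ->] /imsetP[y _ ->] /eqP.
rewrite eq_porbit_mem porbit_cyc => /eqP E; apply: val_inj => /=.
by move: E; rewrite /= !start_start.
Qed.

Lemma cent_cyc_inj h h' : h \in 'C[cyc] -> h' \in 'C[cyc] ->
  (forall x, h (start_ord x) = h' (start_ord x)) -> h = h'.
Proof.
move=> /cent1P hC /cent1P h'C E; apply/permP; apply: start_ind => // x Ex.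
by rewrite -!permM -hC -h'C !permM Ex.
Qed.

Lemma cent_cyc_inv h (B : {set 'I_n}) : h \in 'C[cyc] -> cyc @: B = B -> cyc @: (h @: B) = h @: B.
Proof.
move=> /cent1P hC gB.
have E (u v : {perm 'I_n}) : u @: (v @: B) = (v * u) @: B.
  by rewrite -imset_comp; apply: eq_imset => x; rewrite /= permM.
by rewrite E hC -E gB.
Qed.

End ThreeCycles.

Lemma set3P (T : finType) (x a b c : T) :
  reflect [\/ x = a, x = b | x = c] (x \in [set a; b; c]).
Proof. by rewrite !inE -orbA; apply: (iffP or3P) => -[] /eqP; constructor. Qed.

(** * Permutations preserving three blocks *)

Section ThreeBlocks.

Variables (T : finType) (P : {set {set T}}) (g : {perm T}).
Hypotheses (pP : partition P [set: T]) (cP : #|P| = 3) (gP : g \in 'N(P | 'P^*)).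

Lemma stabpart_im B : B \in P -> g @: B \in P.
Proof. by move: gP; rewrite mem_stabpart => /forall_inP; apply. Qed.

Lemma imperm_inj : injective (fun B : {set T} => g @: B).
Proof. exact/imset_inj/perm_inj. Qed.

Lemma three_eq B1 B2 B3 : B1 \in P -> B2 \in P -> B3 \in P ->
  B1 != B2 -> B1 != B3 -> B2 != B3 -> P = [set B1; B2; B3].
Proof.
move=> P1 P2 P3 d12 d13 d23; apply/eqP; rewrite eq_sym eqEcard cP; apply/andP; split.
  by apply/subsetP=> B /set3P[] ->.
by rewrite -setUA cardsU1 cards2 !inE negb_or d12 d13 d23.
Qed.

Lemma ex_third B1 B2 : exists2 B, B \in P & B \notin [set B1; B2].
Proof.
by apply/subsetPn; apply: contraL (leqnn 3) => /subset_leq_card; rewrite cP cards2 -ltnNge; case: (B1 != B2).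
Qed.

Lemma three_blocks_cases : (exists2 B, B \in P & g @: B = B) \/
  (forall B, B \in P -> [/\ g @: (g @: (g @: B)) = B,
     [disjoint B & g @: B], [disjoint B & g @: (g @: B)] & P = [set B; g @: B; g @: (g @: B)]]).
Proof.
case: (boolP [exists B in P, g @: B == B]) => [/exists_inP[B BP /eqP E] | nf].
  by left; exists B.
have {}nf B : B \in P -> g @: B != B.
  by move=> BP; apply: contra nf => E; apply/exists_inP; exists B.
right=> B1 P1; have P2 := stabpart_im P1; have P3 := stabpart_im P2.
have d12 := nf _ P1; have d23 := nf _ P2.
have d13 : g @: (g @: B1) != B1.
  apply/negP=> /eqP E; have [B BP] := ex_third B1 (g @: B1).
  rewrite !inE negb_or => /andP[d1 d2].
  have PE : P = [set B1; g @: B1; B] by apply: three_eq; rewrite // eq_sym.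
  have /negP[] := nf _ BP; have := stabpart_im BP; rewrite {1}PE => /set3P[] Eg.
  - by case/eqP: d2; apply: imperm_inj; rewrite E.
  - by case/eqP: d1; apply: imperm_inj.
  by rewrite Eg.
have PE : P = [set B1; g @: B1; g @: (g @: B1)].
  by apply: three_eq; rewrite // eq_sym.
have tP : trivIset P by case/and3P: pP.
split=> //; try by apply: (trivIsetP tP); rewrite // eq_sym.
have := stabpart_im P3; rewrite {1}PE => /set3P[] // Eg.
  by case/eqP: d13; apply: imperm_inj.
by case/eqP: d23; apply: imperm_inj.
Qed.

Lemma im_setI (X B : {set T}) : g @: X = X -> #|X :&: g @: B| = #|X :&: B|.
Proof.
move=> gX; rewrite -{1}gX -imsetI; last by move=> ? ? _ _; apply: perm_inj.
by rewrite card_imperm.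
Qed.

Lemma card_part_sum (X : {set T}) : #|X| = (\sum_(B in P) #|X :&: B|)%N.
Proof.
rewrite -sum1_card (partition_big (pblock P) (mem P)) /=; last first.
  by move=> x _; rewrite pblock_mem // (cover_partition pP) inE.
apply: eq_bigr => B BP; rewrite sum1dep_card; apply: eq_card => x; rewrite !inE.
have [tP xP] : trivIset P /\ x \in cover P.
  by rewrite (cover_partition pP) inE; case/and3P: pP.
by congr (_ && _); apply/eqP/idP => [<- | xB]; [rewrite mem_pblock | apply: def_pblock].
Qed.

(** If g permutes the three blocks cyclically, an invariant set has equally many points in each. *)
Lemma three_blocks_inv (X : {set T}) :
  (exists2 B, B \in P & g @: B = B) \/ (g @: X = X -> 3 %| #|X|).
Proof.
have [fB|nB] := three_blocks_cases; [by left | right=> gX].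
have /card_gt0P[B BP] : 0 < #|P| by rewrite cP.
have [_ d1 d2 PE] := nB B BP; rewrite card_part_sum.
suff E A : A \in P -> #|X :&: A| = #|X :&: B|.
  by rewrite (eq_bigr (fun=> #|X :&: B|)) // sum_nat_const cP dvdn_mulr.
by rewrite PE => /set3P[] ->; rewrite ?im_setI.
Qed.

(** The two other blocks are exchanged, so X has equally many points in both. *)
Lemma three_blocks_even (B X : {set T}) : B \in P -> g @: B = B ->
  (forall A, A \in P -> g @: A = A -> A = B) ->
  g @: X = X -> [disjoint X & B] -> ~~ odd #|X|.
Proof.
move=> BP gB uB gX dX.
have [A AP] := ex_third B B; rewrite setUid inE => dA.
have P2 := stabpart_im AP.
have dg : A != g @: A by apply: contra dA => /eqP E; rewrite (uB A).
have dgB : g @: A != B by apply: contra dA => /eqP E; rewrite -(inj_eq imperm_inj) E gB.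
have PE : P = [set B; A; g @: A] by apply: three_eq; rewrite // eq_sym.
have XB : X :&: B = set0 by apply/eqP; rewrite setI_eq0.
rewrite card_part_sum PE (big_setD1 B) ?inE ?eqxx //= XB cards0 add0n.
rewrite (big_setD1 A) /=; last by rewrite !inE dA eqxx orbT.
rewrite (big_setD1 (g @: A)) /=; last by rewrite !inE eq_sym dg dgB eqxx !orbT.
rewrite big1 => [|C]; last by rewrite !in_setD1 => /and4P[n1 n2 n3 /set3P[]E]; rewrite E eqxx in n1 n2 n3.
by rewrite addn0 im_setI // addnn odd_double.
Qed.

End ThreeBlocks.

Lemma card_seg n a b : b <= n -> #|seg n a b| = (b - a)%N.
Proof.
move=> bn; rewrite -[RHS]muln1 -sum_nat_const_nat (big_nat_widen _ _ _ _ _ bn).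
by rewrite big_geq_mkord -sum1dep_card; apply: eq_bigl => x; rewrite andbC.
Qed.

(** * Three cycles of distinct lengths *)

Section ThreeTypes.

Variables (n i j : nat).
Hypotheses (ijn : i + j < n) (i0 : 0 < i) (ij : i < j).
Let k := (n - (i + j))%N.
Hypotheses (jk : j < k) (ijk : (i + j)%N != k).

Let g := cyc ijn.

(** With i < j < k and i + j != k the eight subset sums of the cycle lengths are distinct. *)
Lemma inv_card_eq (B B' : {set 'I_n}) : g @: B = B -> g @: B' = B' -> #|B| = #|B'| -> B = B'.
Proof.
move=> gB gB' E; apply: (inv_eq gB gB'); move: E; rewrite (card_inv gB) (card_inv gB') -/k;
do 6!case: (bit _ _) => //; rewrite ?mul1n ?mul0n ?add0n ?addn0; move: ijk jk ij i0; clear; lia.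
Qed.

Lemma inv_card_lt (B : {set 'I_n}) : g @: B = B -> 0 < #|B| -> #|B| < j -> #|B| = i.
Proof.
move=> gB; rewrite (card_inv gB) -/k.
do 3!case: (bit _ _) => //; rewrite ?mul1n ?mul0n ?add0n ?addn0; move: ijk jk ij i0; clear; lia.
Qed.

Lemma inv_card_j (B : {set 'I_n}) : g @: B = B -> i < #|B| -> #|B| < k ->
  #|B| = j \/ #|B| = (i + j)%N.
Proof.
move=> gB; rewrite (card_inv gB) -/k.
do 3!case: (bit _ _) => //; rewrite ?mul1n ?mul0n ?add0n ?addn0; move: ijk jk ij i0; clear; lia.
Qed.

Lemma seg1_inv : g @: seg n 0 i = seg n 0 i. Proof. by apply: seg_inv; constructor. Qed.
Lemma seg2_inv : g @: seg n i (i + j) = seg n i (i + j). Proof. by apply: seg_inv; constructor. Qed.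
Lemma seg3_inv : g @: seg n (i + j) n = seg n (i + j) n. Proof. by apply: seg_inv; constructor. Qed.

(** A permutation commuting with g maps each cycle to itself, as the lengths differ, and is
    determined by the images of the three first points. *)
Lemma card_cent_cyc3 : #|'C[g]| <= i * j * k.
Proof.
have n0 : 0 < n by apply: leq_ltn_trans ijn.
have in_ : i < n by apply: leq_ltn_trans ijn; apply: leq_addr.
pose a := Ordinal n0; pose b := Ordinal in_; pose c := Ordinal ijn.
have as1 : a \in seg n 0 i by rewrite inE.
have bs2 : b \in seg n i (i + j) by rewrite inE /=; move: ij; lia.
have cs3 : c \in seg n (i + j) n by rewrite inE /= leqnn.
have cS (h : {perm 'I_n}) (x : 'I_n) (S : {set 'I_n}) : h \in 'C[g] -> g @: S = S -> x \in S -> h x \in S.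
  move=> hC gS xS; suff -> : S = h @: S by rewrite mem_imperm.
  apply: inv_card_eq => //; first exact: cent_cyc_inv.
  by rewrite card_imperm.
pose F (h : {perm 'I_n}) := (h a, h b, h c).
have injF : {in 'C[g] &, injective F}.
  move=> h h' hC hC' [E1 E2 E3]; apply: (cent_cyc_inj hC hC') => x.
  have : [\/ start_ord ijn x = a, start_ord ijn x = b | start_ord ijn x = c].
    rewrite /start_ord; case: (ltnP x i) => [xi|ix].
      by constructor 1; apply: val_inj; rewrite /= /start xi.
    case: (ltnP x (i + j)) => [xi|ijx].
      by constructor 2; apply: val_inj; rewrite /= /start xi ltnNge ix.
    by constructor 3; apply: val_inj; rewrite /= /start !ltnNge ix ijx.
  by case=> ->.
rewrite -(card_in_imset injF).
have <- : #|setX (setX (seg n 0 i) (seg n i (i + j))) (seg n (i + j) n)| = (i * j * k)%N.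
  by rewrite !cardsX !card_seg ?subn0 ?addKn // ltnW.
apply/subset_leq_card/subsetP=> _ /imsetP[h hC ->].
by rewrite !in_setX /= !(cS _ _ _ hC) // ?seg1_inv ?seg2_inv ?seg3_inv.
Qed.

Lemma odd_cyc3 : odd_perm g = ~~ odd n.
Proof.
rewrite /odd_perm card_ord card_porbits_cyc.
have n0 : 0 < n by apply: leq_ltn_trans ijn.
have in_ : i < n by apply: leq_ltn_trans ijn; apply: leq_addr.
have -> : [set start_ord ijn x | x in 'I_n] = [set Ordinal n0; Ordinal in_; Ordinal ijn].
  apply/setP=> y; apply/imsetP/set3P => [[x _ ->] | [] ->].
  - case: (ltnP x i) => [xi|ix].
      by constructor 1; apply: val_inj; rewrite /= /start xi.
    case: (ltnP x (i + j)) => [xi|ijx].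
      by constructor 2; apply: val_inj; rewrite /= /start xi ltnNge ix.
    by constructor 3; apply: val_inj; rewrite /= /start !ltnNge ix ijx.
  - by exists (Ordinal n0) => //; apply: val_inj; rewrite /= /start i0.
  - by exists (Ordinal in_) => //; apply: val_inj; rewrite /= /start ltnn; case: ifP => // /negP[]; move: ij; lia.
  - by exists (Ordinal ijn) => //; apply: val_inj; rewrite /= /start !ltnNge leq_addr leqnn.
rewrite -setUA cardsU1 cards2 !inE -!val_eqE /=.
have -> : (0 == i) = false by move: i0; clear; lia.
have -> : (0 == i + j)%N = false by move: i0; clear; lia.
have -> : (i == i + j)%N = false by move: ij; clear; lia.
by case: (odd n).
Qed.

End ThreeTypes.

(** For i <= q - 3 no invariant set has size q, so no block is fixed, and a cyclic permutation of
    the blocks is excluded because q + 1 = 2 mod 3. For i = q - 2 a fixed block can only be the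
    q-cycle; the cycle of length q - 2 would then be spread evenly over two exchanged blocks, but q
    - 2 is odd. A cyclic permutation is excluded since 3 does not divide q. *)
Lemma ex_three_cycles q i : 7 <= q -> odd q -> ~~ (3 %| q) -> q = 1 %[mod 3] ->
  0 < i -> i <= q - 2 ->
  exists g : {perm 'I_(3 * q)}, [/\ g \in 'Alt_('I_(3 * q)), #|'C[g]| <= q ^ 3,
    (forall B B' : {set 'I_(3 * q)}, g @: B = B -> g @: B' = B' -> #|B| = #|B'| -> B = B'),
    (forall B : {set 'I_(3 * q)}, g @: B = B -> 0 < #|B| -> #|B| <= q - 2 -> #|B| = i) &
    (forall P, unif 3 q P -> g \notin 'N(P | 'P^*))].
Proof.
move=> q7 oq q3 q1 i0 iq.
have on : odd (3 * q) by rewrite oddM oq.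
have [lei|gti] := leqP i (q - 3).
- have ijn : i + q.+1 < 3 * q by move: q7 lei; lia.
  have ij : i < q.+1 by move: lei; lia.
  have jk : q.+1 < 3 * q - (i + q.+1) by move: q7 lei; lia.
  have ijk : (i + q.+1)%N != (3 * q - (i + q.+1))%N.
    (* Equality would give q = 2 (i + 1), but q is odd. *)
    by apply: contraL oq => /eqP E; have -> : q = (2 * i.+1)%N by [move: E ijn; lia]; rewrite oddM.
  exists (cyc ijn); split.
  + by rewrite Alt_even (odd_cyc3 ijn) // on.
  + apply: leq_trans (card_cent_cyc3 ijn i0 ij jk ijk) _.
    have [e ->] : exists e, q = (i + 3 + e)%N by exists (q - 3 - i)%N; move: lei q7; clear; lia.
    have -> : (3 * (i + 3 + e) - (i + (i + 3 + e).+1) = i + 2 * e + 5)%N by clear; lia.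
    by rewrite expnS expnS expn1; clear; nia.
  + exact: inv_card_eq.
  + by move=> B gB B0 Bq; apply: (inv_card_lt i0 ij jk ijk gB) => //; move: Bq q7; clear; lia.
  move=> P uP; have [pP cP bP] := unifP _ _ _ uP; apply/negP=> gP.
  have [[B BP gB]|] := three_blocks_inv pP cP gP (seg (3 * q) i (i + q.+1)).
    have := inv_card_j i0 ij jk ijk gB; rewrite (bP _ BP) => /(_ _ _)[]; lia.
  move=> /(_ (seg2_inv ijn)); rewrite card_seg ?(ltnW ijn) // addKn.
  by move: q1; clear; lia.
have {gti iq} E : i = (q - 2)%N by move: gti iq; lia.
have ijn : i + q < 3 * q by move: q7 E; lia.
have ij : i < q by move: E q7; lia.
have jk : q < 3 * q - (i + q) by move: E q7; lia.
have ijk : (i + q)%N != (3 * q - (i + q))%N by move: E q7; lia.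
exists (cyc ijn); split.
- by rewrite Alt_even (odd_cyc3 ijn) // on.
- apply: leq_trans (card_cent_cyc3 ijn i0 ij jk ijk) _.
  have [e Eq] : exists e, q = (e + 2)%N by exists (q - 2)%N; move: q7; clear; lia.
  have -> : (3 * q - (i + q) = e + 4)%N by move: E Eq; clear; lia.
  have -> : i = e by move: E Eq; clear; lia.
  by rewrite Eq expnS expnS expn1; clear; nia.
- exact: inv_card_eq.
- by move=> B gB B0 Bq; apply: (inv_card_lt i0 ij jk ijk gB) => //; move: Bq q7; clear; lia.
move=> P uP; have [pP cP bP] := unifP _ _ _ uP; apply/negP=> gP.
have [[B BP gB]|] := three_blocks_inv pP cP gP (seg (3 * q) i (i + q)).
  have uB A : A \in P -> cyc ijn @: A = A -> A = B.
    by move=> AP gA; apply: (inv_card_eq i0 ij jk ijk gA gB); rewrite !bP.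
  have EB : B = seg (3 * q) i (i + q).
    by apply: (inv_card_eq i0 ij jk ijk gB (seg2_inv ijn)); rewrite bP // card_seg ?(ltnW ijn) // addKn.
  have := three_blocks_even pP cP gP BP gB uB (seg1_inv ijn).
  rewrite card_seg ?subn0; last exact: (leq_trans (leq_addr q i) (ltnW ijn)).
  have -> : odd i by rewrite E oddB ?oq //; move: q7; clear; lia.
  have dX : [disjoint seg (3 * q) 0 i & B] ; last by move=> /(_ dX).
  by rewrite EB; apply/pred0P=> x; rewrite /= !inE; clear; lia.
move=> /(_ (seg2_inv ijn)); rewrite card_seg ?(ltnW ijn) // addKn.
by apply/negP.
Qed.

Lemma ex_full_cycle q : 1 < q -> odd q ->
  exists g : {perm 'I_(3 * q)}, [/\ g \in 'Alt_('I_(3 * q)), #|'C[g]| <= 3 * q,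
    (forall u v, exists k, (g ^+ k) u = v),
    (forall B : {set 'I_(3 * q)}, g @: B = B -> B = set0 \/ B = setT) &
    (forall P P', unif 3 q P -> unif 3 q P' ->
       g \in 'N(P | 'P^*) -> g \in 'N(P' | 'P^*) -> P = P')].
Proof.
move=> q1 oq; set n := (3 * q)%N; have ijn : 0 + 0 < n by rewrite /n; lia.
have on : odd n by rewrite oddM oq.
pose g := cyc ijn; have st x : start 0 0 x = 0 by rewrite /start ltn0.
pose o : 'I_n := Ordinal ijn.
have sto x : start_ord ijn x = o by apply: val_inj; rewrite /= st.
have tr u v : exists k, (g ^+ k) u = v.
  have : v \in porbit g u by rewrite porbit_cyc !st.
  by case/porbitP=> k ->; exists k.
have gB (B : {set 'I_n}) : g @: B = B -> B = set0 \/ B = setT.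
  move=> gB; have E x : (x \in B) = (o \in B) by rewrite (inv_start gB) sto.
  by case oB: (o \in B); [right | left]; apply/setP=> x; rewrite E oB !inE.
exists g; split=> //.
- rewrite Alt_even /odd_perm card_ord card_porbits_cyc.
  have -> : [set start_ord ijn x | x in 'I_n] = [set o].
    by apply/setP=> y; rewrite inE; apply/imsetP/eqP => [[x _ ->] | ->]; last exists o.
  by rewrite cards1 on.
- have injF : {in 'C[g] &, injective (fun h : {perm 'I_n} => h o)}.
    by move=> h h' hC hC' E; apply: (cent_cyc_inj hC hC') => x; rewrite sto.
  by rewrite -(card_in_imset injF) -[X in _ <= X]card_ord max_card.
have go m : m < n -> val ((g ^+ m) o) = m.
  elim: m => [|m IHm] lm; first by rewrite expg0 perm1.
  rewrite expgSr permM cycE IHm ?(ltnW lm) // /nxt /=.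
  by case: eqP lm => // ->; rewrite ltnn.
(* The n-cycle preserves only the partition into residue classes modulo 3; [B] is the class of 0. *)
have key P : unif 3 q P -> g \in 'N(P | 'P^*) ->
  let B := [set x : 'I_n | 3 %| x] in P = [set B; g @: B; g @: (g @: B)].
  move=> uP gP B0; have [pP cP bP] := unifP _ _ _ uP.
  have [[B BP /gB[]E]|nf] := three_blocks_cases pP cP gP.
  - by move: (bP _ BP); rewrite E cards0; lia.
  - by move: (bP _ BP); rewrite E cardsT card_ord /n; lia.
  have [B BP oB] := part_ex o pP; have [g3 d1 d2 PE] := nf B BP.
  have gm m : (g ^+ m) o \in iter (m %% 3) (fun A : {set 'I_n} => g @: A) B.
    elim: m => [|m IHm]; first by rewrite expg0 perm1.
    rewrite expgSr permM -(mem_imperm g) in IHm *.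
    have m3 : m %% 3 < 3 by rewrite ltn_mod.
    rewrite -addn1 -modnDml; case: (m %% 3) m3 IHm => [|[|[|]]] //= _.
    by rewrite g3.
  suff -> : B0 = B by [].
  apply/setP=> x; rewrite inE.
  have := gm x; have -> : (g ^+ x) o = x by apply: val_inj; rewrite go.
  rewrite /dvdn; have m3 : x %% 3 < 3 by rewrite ltn_mod.
  case: (x %% 3) m3 => [|[|[|]]] //= _ xB; rewrite ?xB //; apply/esym/negbTE.
    by rewrite (disjointFl d1).
  by rewrite (disjointFl d2).
by move=> P P' uP uP' gP gP'; rewrite (key P uP gP) (key P' uP' gP').
Qed.

(** * The weight of a proper subgroup *)

Section Density.

Variable T : finType.
Implicit Types (g : {perm T}) (H : {set {perm T}}).

(** Classes are taken in the symmetric group, which is transitive on the sets of a given size and on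
    the block partitions; the class of an even permutation still lies in the alternating group. *)
Definition mu g H : rat :=
  (#|(g ^: [set: {perm T}]) :&: H|%:R / #|g ^: [set: {perm T}]|%:R)%R.

Lemma class_gt0 g : 0 < #|g ^: [set: {perm T}]|.
Proof. by apply/card_gt0P; exists g; apply: class_refl. Qed.

Lemma mu_ge0 g H : (0 <= mu g H)%R.
Proof. by rewrite divr_ge0 ?ler0n. Qed.

Lemma mu_le g H a b : 0 < b ->
  #|(g ^: [set: {perm T}]) :&: H| * b <= #|g ^: [set: {perm T}]| * a ->
  (mu g H <= a%:R / b%:R :> rat)%R.
Proof.
move=> b0 le; rewrite /mu ler_pdivrMr ?ltr0n ?class_gt0 //.
by rewrite mulrAC ler_pdivlMr ?ltr0n // -!natrM ler_nat [X in _ <= X]mulnC.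
Qed.

Lemma class_card_cent g : (#|g ^: [set: {perm T}]| * #|'C[g]| = #|T|`!)%N.
Proof.
rewrite -index_cent1 setTI mulnC Lagrange ?subsetT // -(alt.card_Sym T).
by apply: eq_card => x; rewrite !inE.
Qed.

Lemma mu_le_card g H h c : #|H| <= h -> #|'C[g]| <= c ->
  (mu g H <= (h * c)%:R / #|T|`!%:R :> rat)%R.
Proof.
move=> Hh gc; apply: mu_le; first exact: fact_gt0.
rewrite -(class_card_cent g) mulnCA leq_mul2l; apply/orP; right.
by apply: leq_mul => //; apply: leq_trans Hh; apply/subset_leq_card/subsetIr.
Qed.

Lemma mu_disjoint g H : (forall h, h \in g ^: [set: {perm T}] -> h \notin H) -> mu g H = 0%R.
Proof.
move=> dH; rewrite /mu; suff -> : g ^: [set: {perm T}] :&: H = set0 by rewrite cards0 mul0r.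
by apply/setP=> h; rewrite !inE; apply/negP=> /andP[/dH/negP].
Qed.

Section Action.

Variables (S : finType) (to : {action {perm T} &-> S}) (O : {set S}) (X : S).
Hypotheses (XO : X \in O) (OJ : forall Y s, Y \in O -> to Y s \in O)
  (Otr : forall Y, Y \in O -> exists s, Y = to X s).

(** Pairs (h, Y) with h in the class fixing Y in O, counted in two ways. So the density of the
    stabilizer of X is the proportion of members of O fixed by g. *)
Lemma class_fix g : (#|(g ^: [set: {perm T}]) :&: 'C[X | to]| * #|O| =
  #|g ^: [set: {perm T}]| * #|[set Y in O | to Y g == Y]|)%N.
Proof.
set K := g ^: _.
have KJ h s : (h ^ s \in K) = (h \in K) by rewrite memJ_norm // (subsetP (class_norm _ _)) ?inE.
transitivity (\sum_(Y in O) \sum_(h in K) (to Y h == Y))%N; last first.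
  rewrite exchange_big /= -sum_nat_const; apply: eq_bigr => h /imsetP[s _ ->].
  rewrite -big_mkcondr sum1dep_card -[RHS](card_imset _ (act_inj to s)).
  apply: eq_card => Y; rewrite inE; apply/andP/imsetP => [[YO /eqP YE] | [Z]].
    exists (to Y s^-1); last by rewrite actKV.
    by rewrite inE OJ //=; apply/eqP; rewrite -[in RHS]YE conjgE !actM actK.
  rewrite inE => /andP[ZO /eqP ZE] ->; rewrite OJ //; split=> //.
  by rewrite conjgE !actM actK ZE.
rewrite mulnC -sum_nat_const; apply: eq_bigr => Y /Otr[s ->].
rewrite -big_mkcondr sum1dep_card -(card_imset _ (conjg_inj s)).
apply: eq_card => h; rewrite inE; apply/imsetP/andP => [[u /setIP[uK /astab1P uX] ->] | [hK /eqP hX]].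
  by rewrite KJ uK conjgE !actM actK uX.
exists (h ^ s^-1); last by rewrite conjgKV.
by apply/setIP; rewrite KJ; split=> //; apply/astab1P; rewrite conjgE invgK !actM hX actK.
Qed.

Lemma mu_fix g H f : H \subset 'C[X | to] -> #|[set Y in O | to Y g == Y]| <= f ->
  (mu g H <= f%:R / #|O|%:R :> rat)%R.
Proof.
move=> HX gf; apply: mu_le; first by apply/card_gt0P; exists X.
apply: leq_trans (_ : #|(g ^: [set: {perm T}]) :&: 'C[X | to]| * #|O| <= _).
  by rewrite leq_mul2r subset_leq_card ?orbT // setIS.
by rewrite class_fix leq_mul2l gf orbT.
Qed.

End Action.

(** If s maximizes the overlap of s A with B, no transposition can improve it, so s A = B. *)
Lemma imset_perm_ex (A B : {set T}) : #|A| = #|B| -> exists s : {perm T}, B = s @: A.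
Proof.
move=> AB; pose s := [arg max_(s > 1 : {perm T}) #|s @: A :&: B|].
have smax (t : {perm T}) : #|t @: A :&: B| <= #|s @: A :&: B| by rewrite /s; case: arg_maxnP => // u _; apply.
exists s; apply/eqP; have sAB : #|s @: A| = #|B| by rewrite card_imperm.
rewrite eqEcard sAB leqnn andbT.
apply: contraT => /subsetPn[y yB yA].
have /subsetPn[x xA xB] : ~~ (s @: A \subset B).
  apply: contra yA => sub; have /eqP -> // : s @: A == B by rewrite eqEcard sub sAB /=.
have := smax (s * tperm x y); rewrite leqNgt => /negP[].
apply: leq_trans (_ : #|y |: (s @: A :&: B)| <= _).
  by rewrite cardsU1 inE negb_and yA.
apply/subset_leq_card/subsetP=> z; rewrite !in_setU1 !in_setI => /predU1P[->|/andP[zA zB]].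
  rewrite yB andbT mem_impermV invMg tpermV permM tpermR -mem_impermV //.
rewrite zB andbT mem_impermV invMg tpermV permM tpermD -?mem_impermV //.
  by apply: contraNneq xB => ->.
by apply: contraNneq yA => ->.
Qed.

Lemma mu_stabset g H (B : {set T}) f : H \subset 'N(B | 'P) ->
  #|[set Y : {set T} | (#|Y| == #|B|) && (g @: Y == Y)]| <= f ->
  (mu g H <= f%:R / 'C(#|T|, #|B|)%:R :> rat)%R.
Proof.
move=> HB gf; rewrite -(card_draws T #|B|).
apply: (@mu_fix _ ('P^*)%act _ B); rewrite ?inE //.
- by move=> Y s; rewrite !inE setactP card_imset //; apply: perm_inj.
- move=> Y; rewrite inE => /eqP E.
  by have [s sB] := imset_perm_ex (esym E); exists s; rewrite setactP.
- by rewrite astab1_set.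
by apply: leq_trans gf; apply/subset_leq_card/subsetP=> Y; rewrite !inE setactP.
Qed.

Lemma mu_stabpart g H k b P f : unif k b P -> H \subset 'N(P | 'P^*) ->
  #|[set Q : {set {set T}} | unif k b Q && (g \in 'N(Q | 'P^*))]| <= f ->
  (mu g H <= f%:R / #|[set Q : {set {set T}} | unif k b Q]|%:R :> rat)%R.
Proof.
move=> uP HB gf.
apply: (@mu_fix _ (('P^*)^*)%act _ P); rewrite ?inE //.
- by move=> Q s; rewrite !inE; apply: unif_im.
- move=> Y; rewrite inE => /(unif_orbit uP)[s ->]; exists s.
  by apply: eq_imset => B; rewrite setactP.
- by rewrite astab1_set.
apply: leq_trans gf; apply/subset_leq_card/subsetP=> Y /setIdP[]; rewrite inE => uY /eqP YE.
by rewrite inE uY -astab1_set; apply/astab1P.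
Qed.

Lemma mu_cover (G : {group {perm T}}) (C : {set {group {perm T}}}) g : g ^: [set: {perm T}] \subset G ->
  is_covering G C -> (1 <= \sum_(H in C) mu g H :> rat)%R.
Proof.
move=> gG /andP[_ /eqP CG].
rewrite -mulr_suml -natr_sum ler_pdivlMr ?ltr0n ?class_gt0 // mul1r ler_nat.
rewrite (eq_bigr (fun H : {group {perm T}} => \sum_(h in g ^: [set: {perm T}]) (h \in H)))%N; last first.
  move=> H _; rewrite -big_mkcondr sum1dep_card; apply: eq_card => h.
  by rewrite !inE.
rewrite exchange_big /= -sum1_card; apply: leq_sum => h /(subsetP gG).
rewrite -CG => /bigcupP[H HC hH].
by rewrite (bigD1 H) //= hH.
Qed.

End Density.

Lemma ex_unif k b : 0 < b -> exists P : {set {set 'I_(k * b)}}, unif k b P.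
Proof.
move=> b0; set n := (k * b)%N.
pose A (i : 'I_k) := seg n (i * b) (i.+1 * b).
have cA i : #|A i| = b.
  by rewrite card_seg ?leq_mul2r ?ltn_ord ?orbT // mulSn addnK.
have AE i x : (x \in A i) = (x %/ b == i).
  by rewrite inE -leq_divRL // -ltn_divLR // ltnS eqn_leq andbC.
have injA : injective A.
  move=> i j E; have /card_gt0P[x xi] : 0 < #|A i| by rewrite cA.
  by have xj := xi; rewrite E AE in xj; rewrite AE in xi; apply: val_inj; rewrite /= -(eqP xi) (eqP xj).
exists [set A i | i : 'I_k]; apply/unifP; split.
- apply/and3P; split.
  + rewrite eqEsubset subsetT; apply/subsetP=> x _.
    have xk : x %/ b < k by rewrite ltn_divLR // ltn_ord.
    by apply/bigcupP; exists (A (Ordinal xk)); [apply: imset_f | rewrite AE].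
  + apply/trivIsetP=> _ _ /imsetP[i _ ->] /imsetP[j _ ->] ij.
    apply/pred0P=> x; rewrite /= !AE; apply: contraNF ij => /andP[/eqP-> /eqP/val_inj->].
    by [].
  + by apply/imsetP=> -[i _ /esym/eqP]; rewrite -cards_eq0 cA => /eqP b00; rewrite b00 in b0.
- by rewrite card_imset // card_ord.
by move=> _ /imsetP[i _ ->].
Qed.

Lemma frac_le (a b c d : nat) : 0 < b -> 0 < d -> a * d <= c * b ->
  (a%:R / b%:R <= c%:R / d%:R :> rat)%R.
Proof.
move=> b0 d0 le; rewrite ler_pdivrMr ?ltr0n // mulrAC ler_pdivlMr ?ltr0n //.
by rewrite -!natrM ler_nat.
Qed.

(** For q = 7 and order 36 * 10^9 the two terms of [weight_order] are about 0.0131 and 0.9842,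
    whence the shares 3 / 200 and 197 / 200. Their sum stays below 1 up to an order of about 36.1 *
    10^9. *)
Lemma frac_sum_le1 (x f y s : nat) : 0 < f -> 0 < s -> x * 200 <= 3 * f ->
  y * 200 <= 197 * s -> (x%:R / f%:R + y%:R / s%:R <= 1 :> rat)%R.
Proof.
move=> f0 s0 xf ys.
rewrite [leRHS](_ : 1 = 3%:R / 200%:R + 197%:R / 200%:R)%R; last by field.
by apply: lerD; apply: frac_le.
Qed.

Lemma degree21_ineq1 (h c : nat) : h = (36 * (1000 * 1000 * 1000))%N -> c = 'C(3 * 7, 6) ->
  h * (c * 7 ^ 3) * 200 <= 3 * (3 * 7)`!.
Proof.
have le : 6 <= 3 * 7 by [].
move=> -> ->; rewrite -(bin_fact le); move: ('C(3 * 7, 6)) => c'.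
have -> : (3 * 7 - 6 = 15)%N by [].
have -> : 6`! = 720 by rewrite !factS fact0; clear; lia.
have : 2 * 1000 * 1000 * (600 * 1000) <= 15`! by rewrite !factS fact0; clear; lia.
have -> : (7 ^ 3 = 343)%N by [].
move: (15`!) => f; clear; nia.
Qed.

Lemma degree21_ineq2 (h f : nat) : h = (36 * (1000 * 1000 * 1000))%N -> f = 7`! ->
  h * 7 * 200 <= 197 * (2 * f ^ 3).
Proof.
have -> : 7`! = (7 * 720)%N by rewrite !factS fact0; clear; lia.
by move=> -> ->; rewrite !expnS expn0; clear; lia.
Qed.

(** * The dual constraint *)

Section Weight.

Variable q : nat.
Let n := (3 * q)%N.
Hypotheses (q7 : 7 <= q) (oq : odd q) (q1 : q = 1 %[mod 3]).

Definition nparts := #|[set Q : {set {set 'I_(3 * q)}} | unif 3 q Q]|.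

Lemma nparts_eq : (nparts * (6 * q`! ^ 3))%N = n`!.
Proof.
have [P uP] : exists P : {set {set 'I_n}}, unif 3 q P by apply: ex_unif; apply: leq_trans q7.
by have := card_unif _ uP; rewrite card_ord; apply; rewrite muln_gt0; apply: leq_trans q7.
Qed.

Lemma nparts_gt0 : 0 < nparts.
Proof. by move: (fact_gt0 n); rewrite -nparts_eq muln_gt0 => /andP[]. Qed.

Variables (g : 'I_q.-1 -> {perm 'I_n}) (g0 : {perm 'I_n}).

Hypothesis gC : forall i : 'I_q.-1, 0 < i -> #|'C[g i]| <= q ^ 3.
Hypothesis gU : forall i : 'I_q.-1, 0 < i -> forall B B' : {set 'I_n},
  g i @: B = B -> g i @: B' = B' -> #|B| = #|B'| -> B = B'.
Hypothesis gS : forall i : 'I_q.-1, 0 < i -> forall B : {set 'I_n},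
  g i @: B = B -> 0 < #|B| -> #|B| <= q - 2 -> #|B| = i.
Hypothesis gP : forall i : 'I_q.-1, 0 < i -> forall P, unif 3 q P -> g i \notin 'N(P | 'P^*).
Hypothesis g0C : #|'C[g0]| <= n.
Hypothesis g0T : forall u v, exists k, (g0 ^+ k) u = v.
Hypothesis g0B : forall B : {set 'I_n}, g0 @: B = B -> B = set0 \/ B = setT.
Hypothesis g0P : forall P P', unif 3 q P -> unif 3 q P' ->
  g0 \in 'N(P | 'P^*) -> g0 \in 'N(P' | 'P^*) -> P = P'.

(** The left side of the dual constraint at H. The ordinals below q - 1 end at q - 2; the n-cycle is
    kept apart as [g0]. *)
Definition weight (H : {set {perm 'I_n}}) : rat :=
  (\sum_(i < q.-1 | (0 < i)%N) 'C(n, i)%:R * mu (g i) H + nparts%:R * mu g0 H)%R.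

Lemma sum_bin_ord : \sum_(i < q.-1 | 0 < i) 'C(n, i) <= 'C(n, q.-1).
Proof.
apply: leq_trans (@sum_bin_le n q.-1 _); last by rewrite /n; lia.
by rewrite big_geq_mkord.
Qed.

(** The n-cycle fixes no such B. If |B| <= q - 2, only the term of index |B| survives, and it is at
    most 1. If |B| >= q - 1, every density is at most 1 / C(n, |B|), and the coefficients add up to
    at most C(n, q - 1). *)
Lemma weight_intrans (H : {set {perm 'I_n}}) (B : {set 'I_n}) : H \subset 'N(B | 'P) ->
  0 < #|B| -> 2 * #|B| < n -> (weight H <= 1)%R.
Proof.
move=> HB B0 B2; set b := #|B| in B0 B2.
have Cb : 0 < 'C(n, b) by rewrite bin_gt0; move: B2; lia.
have mu0 : mu g0 H = 0%R.
  apply/eqP; rewrite eq_le mu_ge0 andbT; apply: le_trans (mu_stabset (f := 0) HB _) _.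
    rewrite leqn0 cards_eq0; apply/eqP/setP=> Y; rewrite !inE; apply/negP=> /andP[/eqP + /eqP/g0B[] E].
      by rewrite E cards0; move: B0; rewrite /b; lia.
    by rewrite E cardsT card_ord; move: B2; rewrite /b; lia.
  by rewrite mul0r.
have mu1 (i : 'I_q.-1) : 0 < i -> (mu (g i) H <= 1 / 'C(n, b)%:R)%R.
  move=> i0; have := mu_stabset (g := g i) (f := 1) HB; rewrite card_ord; apply.
  apply/card_le1_eqP=> Y Z; rewrite !inE => /andP[/eqP cY /eqP gY] /andP[/eqP cZ /eqP gZ].
  by apply: (gU i0 gZ gY); rewrite cY cZ.
rewrite /weight mu0 mulr0 addr0.
have [bq|bq] := leqP b (q - 2); last first.
  apply: le_trans (_ : \sum_(i < q.-1 | (0 < i)%N) 'C(n, i)%:R * (1 / 'C(n, b)%:R) <= _)%R.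
    by apply: ler_sum => i i0; apply: ler_wpM2l; [rewrite ler0n | apply: mu1].
  rewrite -mulr_suml mul1r ler_pdivrMr ?ltr0n // mul1r -natr_sum ler_nat.
  apply: leq_trans sum_bin_ord _; apply: bin_mono; first by move: bq q7; lia.
  by move: B2; lia.
have bo : b < q.-1 by move: bq q7; lia.
rewrite (bigD1 (Ordinal bo)) //= big1 => [|i /andP[i0 ib]].
  rewrite addr0 -ler_pdivlMl ?ltr0n // mulr1 -div1r.
  exact: (mu1 (Ordinal bo)).
suff -> : mu (g i) H = 0%R by rewrite mulr0.
apply/eqP; rewrite eq_le mu_ge0 andbT; apply: le_trans (mu_stabset (f := 0) HB _) _.
  rewrite leqn0 cards_eq0; apply/eqP/setP=> Y; rewrite !inE; apply/negP=> /andP[/eqP cY /eqP gY].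
  case/eqP: ib; apply: val_inj => /=.
  by rewrite -(gS i0 gY) // cY.
by rewrite mul0r.
Qed.

Lemma weight_part3 (H : {set {perm 'I_n}}) P : unif 3 q P -> H \subset 'N(P | 'P^*) ->
  (weight H <= 1)%R.
Proof.
move=> uP HP; rewrite /weight big1 => [|i i0]; last first.
  suff -> : mu (g i) H = 0%R by rewrite mulr0.
  apply/eqP; rewrite eq_le mu_ge0 andbT; apply: le_trans (mu_stabpart (f := 0) uP HP _) _.
    rewrite leqn0 cards_eq0; apply/eqP/setP=> Q; rewrite inE [RHS]inE; apply/negP=> /andP[uQ].
    by apply/negP/gP.
  by rewrite mul0r.
rewrite add0r -ler_pdivlMl ?ltr0n ?nparts_gt0 // mulr1 -div1r.
apply: (mu_stabpart (f := 1) uP HP).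
apply/card_le1_eqP=> Y Z /setIdP[uY gY] /setIdP[uZ gZ]; by apply: g0P.
Qed.

Lemma weight_sum_order (H : {set {perm 'I_n}}) h : #|H| <= h ->
  (\sum_(i < q.-1 | (0 < i)%N) 'C(n, i)%:R * mu (g i) H <=
     (h * ('C(n, q.-1) * q ^ 3))%:R / n`!%:R)%R.
Proof.
move=> Hh.
apply: le_trans (_ : \sum_(i < q.-1 | (0 < i)%N) 'C(n, i)%:R * ((h * q ^ 3)%:R / n`!%:R) <= _)%R.
  apply: ler_sum => i i0; apply: ler_wpM2l; first by rewrite ler0n.
  by have := mu_le_card Hh (gC i0); rewrite card_ord.
rewrite -mulr_suml mulrA ler_wpM2r ?invr_ge0 ?ler0n //.
rewrite -natr_sum -natrM ler_nat mulnCA leq_mul2l; apply/orP; right.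
by rewrite leq_mul2r sum_bin_ord orbT.
Qed.

(** Densities are bounded by |H| times the order of a centralizer over n!. For the n-cycle, M (3 q)
    / n! = q / (2 q!^3). *)
Lemma weight_order (H : {set {perm 'I_n}}) h : #|H| <= h ->
  (weight H <= (h * ('C(n, q.-1) * q ^ 3))%:R / n`!%:R
                + (h * q)%:R / (2 * q`! ^ 3)%:R)%R.
Proof.
move=> Hh; rewrite /weight; apply: lerD; first exact: weight_sum_order.
apply: le_trans (_ : nparts%:R * ((h * n)%:R / n`!%:R) <= _)%R.
  apply: ler_wpM2l; first by rewrite ler0n.
  by have := mu_le_card Hh g0C; rewrite card_ord.
rewrite -nparts_eq /n mulrA -natrM ler_pdivrMr ?ltr0n ?muln_gt0 ?nparts_gt0 ?expn_gt0 ?fact_gt0 //.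
rewrite mulrAC ler_pdivlMr ?ltr0n ?muln_gt0 ?expn_gt0 ?fact_gt0 //.
by rewrite -!natrM ler_nat; apply: eq_leq; move: (q`! ^ 3)%N; clear; lia.
Qed.

Lemma weight_order_le1 (H : {set {perm 'I_n}}) h : #|H| <= h ->
  h * ('C(n, q.-1) * (2 * q ^ 3)) <= n`! -> h * q <= q`! ^ 3 -> (weight H <= 1)%R.
Proof.
move=> Hh le1 le2; apply: le_trans (weight_order Hh) _.
rewrite [leRHS](_ : 1 = 1%:R / 2%:R + 1%:R / 2%:R)%R; last by field.
apply: lerD; apply: frac_le; rewrite ?muln_gt0 ?expn_gt0 ?fact_gt0 // mul1n.
  by apply: leq_trans le1; apply: eq_leq; clear; lia.
by rewrite mulnC leq_mul2l le2 orbT.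
Qed.

Lemma q_ndvd3 : ~~ (3 %| q).
Proof. by rewrite /dvdn q1. Qed.

Lemma odd_n : odd n. Proof. by rewrite oddM oq. Qed.

Lemma weight_part (H : {set {perm 'I_n}}) k b P : unif k b P -> 1 < k -> 1 < b ->
  H \subset 'N(P | 'P^*) -> (weight H <= 1)%R.
Proof.
move=> uP k1 b1 HP; have kb := unif_card uP; rewrite card_ord in kb.
have [k3|k3] := eqVneq k 3.
  have bq : b = q by move: kb; rewrite k3 /n; clear; lia.
  by move: uP; rewrite k3 bq => uP; apply: weight_part3 uP HP.
have := odd_n; rewrite -kb oddM => /andP[ok ob].
have k5 : 4 < k by case: k k1 k3 ok {uP kb} => [|[|[|[|[]]]]].
have b3 : 2 < b by case: b b1 ob {uP kb} => [|[|[]]].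
have cH : #|H| <= b`! ^ k * k`!.
  apply: leq_trans (subset_leq_card HP) _.
  have [|_ ->] := stabpart_isog _ uP; last by rewrite mulnC.
  by rewrite card_ord /n; move: q7; clear; lia.
have ineq := partition_ineq kb k5 b3 oq q_ndvd3 q7.
apply: (weight_order_le1 cH) => //.
apply: leq_trans (multinomial_ge q7).
have -> : (b`! ^ k * k`! * ('C(n, q.-1) * (2 * q ^ 3)) = (b`! ^ k * k`! * q) * ('C(n, q.-1) * (2 * q ^ 2)))%N.
  by rewrite [(q ^ 3)%N]expnSr; move: (b`! ^ k * k`!)%N ('C(n, q.-1)) (q ^ 2)%N; clear; lia.
by rewrite leq_mul2r ineq orbT.
Qed.

(** For odd q the number [(q + q./2).+1] is (n + 1) / 2. The minimal degree is at least 4: a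
    permutation moving two points is odd, and a 3-cycle is excluded by [jordan3]. *)
Lemma prim_bochert (H : {group {perm 'I_n}}) : H \subset 'Alt_('I_n) -> prim H ->
  ~~ ('Alt_('I_n) \subset H) -> #|H| * (q + q./2).+1`! <= n`!.
Proof.
move=> HA pH nAH; have := @bochert_bound _ H (q + q./2).+1; rewrite card_ord; apply.
  move=> s sH s1; have := supp_neq1 s; have := supp_gt0 s; rewrite s1.
  have := @supp2_odd _ s; have := @jordan3 _ H s pH sH.
  have := subsetP HA s sH; rewrite Alt_even.
  case: (#|supp s|) => [|[|[|[|//]]]] // es; first by move=> _ /(_ erefl); rewrite (negbTE es).
  by move=> /(_ erefl) AH; rewrite AH in nAH.
by rewrite /n; have := odd_double_half q; rewrite oq; clear; lia.
Qed.

Lemma weight_prim (H : {group {perm 'I_n}}) : (q = 7 \/ 13 <= q) ->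
  H \subset 'Alt_('I_n) -> prim H -> ~~ ('Alt_('I_n) \subset H) -> (weight H <= 1)%R.
Proof.
move=> q13 HA pH nAH; have bH := prim_bochert HA pH nAH.
set r := q./2 in bH; have qr : q = (2 * r).+1.
  by have := odd_double_half q; rewrite oq -/r; clear; lia.
have E1 : (q + r).+1 = (3 * r + 2)%N by move: qr; clear; lia.
have E2 : n = (6 * r + 3)%N by move: qr; rewrite /n; clear; lia.
have E3 : q.-1 = (2 * r)%N by rewrite qr.
have r3 : 3 <= r by move: q7 qr; clear; lia.
have := fact_ineq_bin r3; rewrite -qr -E3 -E2 -E1 => /(_ _ _) ib.
have {}ib : 'C(n, q.-1) * q ^ 3 * 2 <= (q + r).+1`! by apply: ib; case: q13 qr; clear; lia.
have le1 : #|H| * ('C(n, q.-1) * (2 * q ^ 3)) <= n`!.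
  apply: leq_trans bH; rewrite leq_mul2l; apply/orP; right.
  by apply: leq_trans ib; apply: eq_leq; clear; lia.
case: q13 => [q_7|q13].
  have c21 : #|'I_n| = 21 by rewrite card_ord /n q_7.
  (* Without a 21-cycle in H the last term of the weight vanishes, and Bochert's bound suffices for
     the others. *)
  have [gH|gH] := boolP [exists h in g0 ^: [set: {perm 'I_n}], h \in H]; last first.
    rewrite /weight (_ : mu g0 H = 0%R) ?mulr0 ?addr0; last first.
      by apply: mu_disjoint => h hg; apply: contra gH => hH; apply/exists_inP; exists h.
    apply: le_trans (weight_sum_order (leqnn #|H|)) _.
    rewrite [leRHS](_ : 1 = 1%:R / 1%:R)%R; last by field.
    apply: frac_le; rewrite ?fact_gt0 // mul1n muln1.
    by apply: leq_trans le1; rewrite leq_mul2l leq_mul2l leq_pmull ?orbT.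
  case/exists_inP: gH => h /imsetP[s _ ->] gH.
  have tr u v : exists k, ((g0 ^ s) ^+ k) u = v.
    have [k gk] := g0T (s^-1 u) (s^-1 v); exists k.
    by rewrite -conjXg -[u](permKV s) permJ gk permKV.
  have cH := prim21 c21 HA pH nAH gH tr.
  apply: le_trans (weight_order cH) _; rewrite /n.
  apply: frac_sum_le1; rewrite ?muln_gt0 ?expn_gt0 ?fact_gt0 //.
    by move: cH; rewrite q_7 => _; apply: degree21_ineq1.
  by rewrite q_7; apply: degree21_ineq2.
apply: (weight_order_le1 (leqnn #|H|) le1).
have r6 : 6 <= r by move: q13 qr; clear; lia.
have := fact_ineq_bochert r6; rewrite -qr -E2 -E1 => ib2.
rewrite -(leq_pmul2r (fact_gt0 (q + r).+1)) mulnAC.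
by apply: leq_trans ib2; rewrite leq_mul2r bH orbT.
Qed.

Lemma weight_le1 (H : {group {perm 'I_n}}) : (q = 7 \/ 13 <= q) ->
  H \proper 'Alt_('I_n) -> (weight H <= 1)%R.
Proof.
move=> q13 /andP[HA nAH]; have n0 : 0 < n by rewrite /n; move: q7; clear; lia.
have x0 := Ordinal n0.
have [tH|ntH] := boolP [transitive H, on [set: 'I_n] | 'P].
  have [pH|npH] := boolP (prim H); first exact: weight_prim.
  have [k [b [P [uP HP k1 b1]]]] := trans_nprim x0 tH npH.
  exact: weight_part uP k1 b1 HP.
have [B [HB B0 BT]] := ntrans_stab x0 ntH.
have cB := cardsC B; rewrite card_ord in cB.
have b0 : 0 < #|B| by rewrite card_gt0.
have bc0 : 0 < #|~: B| by rewrite card_gt0; apply: contra BT => /eqP E; rewrite -(setCK B) E setC0.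
have [lt|ge] := ltnP (2 * #|B|) n; first exact: weight_intrans HB b0 lt.
apply: weight_intrans (stabsetC HB) bc0 _.
have : (2 * #|B| != n)%N by apply: contraL odd_n => /eqP <-; rewrite oddM.
by move: cB ge; move: (#|B|) (#|~: B|) => u v; move: (n) => m; clear; lia.
Qed.

End Weight.

Lemma class_sub_Alt (T : finType) (g : {perm T}) : g \in 'Alt_T -> g ^: [set: {perm T}] \subset 'Alt_T.
Proof.
move=> gA; apply/subsetP=> _ /imsetP[s _ ->]; rewrite Alt_even conjgE !odd_permM odd_permV.
by rewrite addbCA addbb addbF -Alt_even.
Qed.

Lemma covering_lower_bound q (C : {set {group {perm 'I_(3 * q)}}}) :
  7 <= q -> odd q -> q = 1 %[mod 3] -> (q = 7 \/ 13 <= q) -> is_covering 'Alt_('I_(3 * q)) C ->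
  \sum_(i < q.-1 | 0 < i) 'C(3 * q, i) + nparts q <= #|C|.
Proof.
move=> q7 oq q1 q13 covC.
have q3 : ~~ (3 %| q) by rewrite /dvdn q1.
pose spec (i : 'I_q.-1) (u : {perm 'I_(3 * q)}) := [/\ u \in 'Alt_('I_(3 * q)), #|'C[u]| <= q ^ 3,
    (forall B B' : {set 'I_(3 * q)}, u @: B = B -> u @: B' = B' -> #|B| = #|B'| -> B = B'),
    (forall B : {set 'I_(3 * q)}, u @: B = B -> 0 < #|B| -> #|B| <= q - 2 -> #|B| = i) &
    (forall P, unif 3 q P -> u \notin 'N(P | 'P^*))].
have [g gP] : exists g : 'I_q.-1 -> {perm 'I_(3 * q)}, forall i : 'I_q.-1, 0 < i ->
    spec i (g i).
  apply: (@fin_all_exists 'I_q.-1 (fun=> {perm 'I_(3 * q)}) (fun i u => 0 < i -> spec i u)) => i.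
  have [i0|i0] := posnP i; first by exists 1.
  have iq : i <= q - 2 by have := ltn_ord i; move: q7; clear; lia.
  have [u uP] := ex_three_cycles q7 oq q3 q1 i0 iq.
  by exists u => _.
have [g0 [g0A g0C g0T g0B g0P]] := ex_full_cycle (ltn_trans (isT : 1 < 6) q7) oq.
have W (H : {group {perm 'I_(3 * q)}}) : H \in C -> (weight g g0 H <= 1)%R.
  case/andP: covC => /forall_inP pC _ /pC.
  apply: weight_le1 => // i i0; by have [] := gP i i0.
rewrite -(ler_nat rat) -sum1_card natr_sum natrD natr_sum.
apply: le_trans (_ : \sum_(H in C) weight g g0 H <= _)%R; last by apply: ler_sum => H /W.
rewrite /weight big_split /= exchange_big /=; apply: lerD.
  apply: ler_sum => i i0; rewrite -mulr_sumr ler_peMr ?ler0n //.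
  apply: mu_cover covC; apply: class_sub_Alt; by have [] := gP i i0.
rewrite -mulr_sumr ler_peMr ?ler0n //.
by apply: mu_cover covC; apply: class_sub_Alt.
Qed.

(** * Even permutations without short cycles *)

Section Colouring.

Variables (T : finType) (g : {perm T}).

(** A base point on each cycle, depending only on the cycle. The default x never occurs, since x
    lies on its own cycle. *)
Let rep (x : T) := odflt x [pick y in porbit g x].

Let repP x : rep x \in porbit g x.
Proof. by rewrite /rep; case: pickP => //= /(_ x); rewrite porbit_id. Qed.

Let rep_eq x y : porbit g x = porbit g y -> rep x = rep y.
Proof. by rewrite /rep => ->; case: pickP => // /(_ y); rewrite porbit_id. Qed.

Let pos x := index x (traject g (rep x) #|porbit g x|).

Let posP x : pos x < #|porbit g x| /\ iter (pos x) g (rep x) = x.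
Proof.
have /eqP E : porbit g (rep x) == porbit g x by rewrite eq_porbit_mem repP.
have xt : x \in traject g (rep x) #|porbit g x|.
  by rewrite -E -porbit_traject E porbit_id.
have lt : pos x < #|porbit g x| by move: xt; rewrite -index_mem size_traject.
by split=> //; rewrite -(nth_traject _ lt) nth_index.
Qed.

Let pos_iter x i : i < #|porbit g x| -> x = iter i g (rep x) -> pos x = i.
Proof.
move=> ik xE; rewrite /pos {1}xE -(nth_traject _ ik) index_uniq ?size_traject //.
have /eqP E : porbit g (rep x) == porbit g x by rewrite eq_porbit_mem repP.
by rewrite -E uniq_traject_porbit.
Qed.

Let pos_next d x : d %| #|porbit g x| -> pos (g x) = (pos x).+1 %[mod d].
Proof.
move=> dk; have [ik xE] := posP x.
have E : porbit g (g x) = porbit g x by have := porbit_perm g 1 x; rewrite expg1.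
have rE := rep_eq E.
have gxE : g x = iter (pos x).+1 g (rep (g x)) by rewrite rE /= xE.
have [lt|ge] := ltnP (pos x).+1 #|porbit g x|.
  by rewrite (@pos_iter _ (pos x).+1) // E.
have kE : (pos x).+1 = #|porbit g x| by apply/eqP; rewrite eqn_leq ge ik.
have /eqP E' : porbit g (rep x) == porbit g x by rewrite eq_porbit_mem repP.
rewrite (@pos_iter _ 0) ?E ?lt0n ?card_porbit_neq0 //.
  by rewrite kE mod0n; apply/esym/eqP.
by rewrite [LHS]gxE kE rE -E' iter_porbit.
Qed.

(** F i consists of the points of A whose distance from the base point of their cycle is i modulo d.
    As d divides the lengths of the cycles, g raises this colour by one even when it passes the base
    point. *)
Lemma colour_classes d (A : {set T}) : 0 < d -> g @: A = A ->
  (forall x, x \in A -> d %| #|porbit g x|) ->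
  exists F : nat -> {set T}, [/\ forall i, g @: F i = F i.+1, forall i, F (i %% d) = F i,
    (forall i j x, x \in F i -> x \in F j -> i = j %[mod d]) &
    forall x, (x \in A) = [exists i : 'I_d, x \in F i]].
Proof.
move=> d0 gA dA; pose F i := [set x in A | pos x == i %[mod d]].
exists F; split.
- move=> i; apply/setP=> y; rewrite -[y](permKV g) mem_imperm !inE -(mem_imperm g) gA permKV.
  have [yA|] := boolP (y \in A) => //=; set x := g^-1 y.
  have yE : y = g x by rewrite permKV.
  have xA : x \in A by rewrite -(mem_imperm g) gA -yE.
  rewrite yE (pos_next (dA x xA)); apply/eqP/eqP => E; first by rewrite -addn1 -modnDml E modnDml addn1.
  by apply/eqP; rewrite -(eqn_modDr 1) !addn1; apply/eqP.
- by move=> i; apply/setP=> x; rewrite !inE modn_mod.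
- by move=> i j x; rewrite !inE => /andP[_ /eqP <-] /andP[_ /eqP].
move=> x; apply/idP/existsP => [xA | [i]]; last by rewrite inE => /andP[].
by exists (Ordinal (ltn_pmod (pos x) d0)); rewrite inE xA /= modn_mod.
Qed.

Lemma porbit_im x : g @: porbit g x = porbit g x.
Proof.
apply/eqP; rewrite imperm_eq.
apply/subsetP=> _ /imsetP[y yx ->]; rewrite porbit_sym.
have -> : porbit g (g y) = porbit g y by have := porbit_perm g 1 y; rewrite expg1.
by rewrite porbit_sym.
Qed.

Lemma porbits_partition : partition (porbits g) [set: T].
Proof.
apply/and3P; split.
- rewrite eqEsubset subsetT; apply/subsetP=> x _.
  by apply/bigcupP; exists (porbit g x); [apply: imset_f | apply: porbit_id].
- apply/trivIsetP=> _ _ /imsetP[x _ ->] /imsetP[y _ ->] xy.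
  apply/pred0P=> z; apply: contraNF xy => /= /andP[].
  by rewrite -!eq_porbit_mem => /eqP<- /eqP<-.
by apply/imsetP=> -[x _ /setP/(_ x)]; rewrite inE porbit_id.
Qed.

End Colouring.

Lemma cards3P (T : finType) (A : {set T}) : #|A| = 3 ->
  exists a b c, [/\ a != b, a != c, b != c & A = [set a; b; c]].
Proof.
move=> A3; have /card_gt0P[a aA] : 0 < #|A| by rewrite A3.
have := cardsD1 a A; rewrite aA A3 => -[/esym/eqP/cards2P[b [c [bc E]]]].
have := setD1K aA; rewrite E => AE; exists a, b, c; rewrite bc -AE setUA; split=> //.
  have : b \in A :\ a by rewrite E !inE eqxx.
  by rewrite in_setD1 eq_sym => /andP[].
have : c \in A :\ a by rewrite E !inE eqxx orbT.
by rewrite in_setD1 eq_sym => /andP[].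
Qed.

Lemma unif3 (T : finType) q (X Y Z : {set T}) : 0 < q -> #|T| = (3 * q)%N ->
  #|X| = q -> #|Y| = q -> #|Z| = q ->
  [disjoint X & Y] -> [disjoint X & Z] -> [disjoint Y & Z] -> unif 3 q [set X; Y; Z].
Proof.
move=> q0 cT cX cY cZ dXY dXZ dYZ.
have ne (U V : {set T}) : #|U| = q -> [disjoint U & V] -> U != V.
  move=> cU; apply: contraTneq => <-; rewrite -setI_eq0 setIid -cards_eq0 cU.
  by rewrite -lt0n.
have sz B : B \in [set X; Y; Z] -> #|B| = q by case/set3P=> ->.
have c3 : #|[set X; Y; Z]| = 3.
  by rewrite -setUA cardsU1 cards2 !inE negb_or !ne.
have tI : trivIset [set X; Y; Z].
  by apply/trivIsetP=> A B /set3P[] -> /set3P[] ->; rewrite ?eqxx // => _ ; rewrite // disjoint_sym.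
apply/unifP; split=> //; apply/and3P; split=> //; last first.
  by apply/negP=> /sz; rewrite cards0 => E; rewrite -E in q0.
rewrite eqEcard subsetT cardsT cT /=.
move: tI; rewrite /trivIset => /eqP <-.
by rewrite (eq_bigr (fun=> q)) => [|B /sz //]; rewrite sum_nat_const c3.
Qed.

Lemma stabpart3 (T : finType) (g : {perm T}) (X Y Z : {set T}) :
  g @: X \in [set X; Y; Z] -> g @: Y \in [set X; Y; Z] -> g @: Z \in [set X; Y; Z] ->
  g \in 'N([set X; Y; Z] | 'P^*).
Proof. by move=> gX gY gZ; rewrite mem_stabpart; apply/forall_inP=> B /set3P[] ->. Qed.

Lemma card_disjointU (T : finType) (A B : {set T}) : [disjoint A & B] ->
  #|A :|: B| = (#|A| + #|B|)%N.
Proof. by move=> dAB; rewrite cardsU (_ : A :&: B = set0) ?cards0 ?subn0 //; apply/eqP; rewrite setI_eq0. Qed.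

Lemma stab_ex_div3 (T : finType) q (g : {perm T}) : 0 < q -> #|T| = (3 * q)%N ->
  (forall x, 3 %| #|porbit g x|) -> exists2 P, unif 3 q P & g \in 'N(P | 'P^*).
Proof.
move=> q0 cT d3.
have gT : g @: [set: T] = [set: T].
  by apply/setP=> x; rewrite mem_impermV !inE.
have [F [gF Fm Fd Fc]] := colour_classes (isT : 0 < 3) gT (fun x _ => d3 x).
have cF i : #|F i| = #|F 0|.
  by elim: i => // i <-; rewrite -gF card_imset //; apply: perm_inj.
have dF i j : i %% 3 != j %% 3 -> [disjoint F i & F j].
  by move=> ij; apply/pred0P=> x; apply: contraNF ij => /andP[xi xj]; rewrite (Fd i j x).
have TE : [set: T] = F 0 :|: (F 1%N :|: F 2%N).
  apply/setP=> x; rewrite Fc !inE; apply/existsP/or3P => [[[[|[|[|]]] //= i3]] | ].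
  - by constructor 1.
  - by constructor 2.
  - by constructor 3.
  case=> xF; [exists ord0 | exists (Ordinal (isT : 1 < 3)) | exists (Ordinal (isT : 2 < 3))] => //.
have c0 : #|F 0| = q.
  have := cardsT T; rewrite TE !card_disjointU ?dF // ?(cF 1%N) ?(cF 2%N) ?cT.
    by clear; lia.
  by rewrite -setI_eq0 setIUr setU_eq0 !setI_eq0 !dF.
exists [set F 0; F 1%N; F 2%N]; first by apply: unif3; rewrite ?cF ?dF.
by apply: stabpart3; rewrite gF ?inE ?eqxx ?orbT // -(Fm 3%N) eqxx.
Qed.

Lemma stab_ex_even (T : finType) q (g : {perm T}) (B : {set T}) : 0 < q -> #|T| = (3 * q)%N ->
  g @: B = B -> #|B| = q -> (forall x, x \notin B -> 2 %| #|porbit g x|) ->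
  exists2 P, unif 3 q P & g \in 'N(P | 'P^*).
Proof.
move=> q0 cT gB cB d2.
have gT : g @: (~: B) = ~: B.
  by apply/setP=> x; rewrite mem_impermV !inE -(mem_imperm g) gB permKV.
have [|F [gF Fm Fd Fc]] := colour_classes (isT : 0 < 2) gT _.
  by move=> x; rewrite inE; apply: d2.
have cF : #|F 1%N| = #|F 0| by rewrite -gF card_imset //; apply: perm_inj.
have dF : [disjoint F 0 & F 1%N].
  by apply/pred0P=> x; apply/negP=> /andP[xi xj]; have := Fd 0%N 1%N x xi xj.
have TE : ~: B = F 0 :|: F 1%N.
  apply/setP=> x; rewrite Fc !inE; apply/existsP/orP => [[[[|[|]] //= i3]] | ].
  - by left.
  - by right.
  case=> xF; [exists ord0 | exists (Ordinal (isT : 1 < 2))] => //.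
have dB i : i < 2 -> [disjoint B & F i].
  move=> i2; rewrite disjoints_subset; apply/subsetP=> x xB; rewrite inE.
  apply/negP=> xF; have : x \in ~: B by rewrite Fc; apply/existsP; exists (Ordinal i2).
  by rewrite inE xB.
have c0 : #|F 0| = q.
  by have := cardsC B; rewrite TE !card_disjointU ?dF // cF cT cB; clear; lia.
exists [set B; F 0; F 1%N]; first by apply: unif3; rewrite ?cF ?dF ?dB.
by apply: stabpart3; rewrite ?gF ?gB ?inE ?eqxx ?orbT // -(Fm 2%N) eqxx ?orbT.
Qed.

Lemma Alt_stab_ex q (g : {perm 'I_(3 * q)}) : 7 <= q -> odd q -> q = 1 %[mod 3] ->
  g \in 'Alt_('I_(3 * q)) ->
  (exists B : {set 'I_(3 * q)}, [/\ 0 < #|B|, #|B| <= q - 2 & g \in 'N(B | 'P)]) \/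
  (exists2 P, unif 3 q P & g \in 'N(P | 'P^*)).
Proof.
move=> q7 oq q1 gA; have q0 : 0 < q by move: q7; clear; lia.
case: (boolP [exists x, #|porbit g x| <= q - 2]) => [/existsP[x xq] | nx].
  left; exists (porbit g x); split=> //; first by rewrite lt0n card_porbit_neq0.
  by rewrite mem_stabset porbit_im.
right; have cT := card_ord (3 * q).
case: (boolP [forall x, 3 %| #|porbit g x|]) => [/forallP d3 | nd3].
  exact: stab_ex_div3 q0 cT d3.
have {nx} big A : A \in porbits g -> q <= #|A|.+1.
  case/imsetP=> x _ ->; rewrite leqNgt; apply: contra nx => lt.
  by apply/existsP; exists x; move: lt; clear; lia.
have pP := porbits_partition g.
have sumP := card_partition pP; rewrite cardsT card_ord in sumP.
have oP : odd #|porbits g|.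
  by move: gA; rewrite Alt_even /odd_perm card_ord oddM oq addTb negbK.
have c3 : #|porbits g| = 3.
  have le : #|porbits g| * (q.-1) <= 3 * q.
    rewrite -sum_nat_const; apply: leq_trans (eq_leq (esym sumP)); apply: leq_sum => A /big.
    by move: q7; clear; lia.
  have c4 : #|porbits g| < 4.
    rewrite ltnNge; apply/negP=> c4; have := leq_trans (leq_mul c4 (leqnn q.-1)) le.
    by move: q7; clear; lia.
  have c1 : #|porbits g| != 1%N.
    apply/negP=> /cards1P[A E]; case/negP: nd3; apply/forallP=> x.
    have : porbit g x \in porbits g by apply: imset_f.
    move: sumP; rewrite E big_set1 inE => sA /eqP ->.
    by rewrite -sA dvdn_mulr.
  by case: #|porbits g| oP c1 c4 => [|[|[|[|]]]].
have [A [B [C [AB AC BC E]]]] := cards3P c3.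
have tP : trivIset [set A; B; C] by case/and3P: pP => _; rewrite E.
have mA : A \in [set A; B; C] by rewrite !inE eqxx.
have mB : B \in [set A; B; C] by rewrite !inE eqxx orbT.
have mC : C \in [set A; B; C] by rewrite !inE eqxx orbT.
have dAB := trivIsetP tP _ _ mA mB AB; have dAC := trivIsetP tP _ _ mA mC AC.
have dBC := trivIsetP tP _ _ mB mC BC.
have sz : (#|A| + #|B| + #|C| = 3 * q)%N.
  move: sumP; rewrite E -setUA big_setU1 ?inE ?negb_or ?AB ?AC //=.
  by rewrite big_setU1 ?inE //= big_set1 addnA => sz; apply: esym.
have gO (O : {set _}) : O \in [set A; B; C] -> g @: O = O.
  by rewrite -E => /imsetP[x _ ->]; apply: porbit_im.

(* Lengths at least q - 1 with sum 3 q and none equal to q must be q - 1, q - 1 and q + 2, all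
   divisible by 3, which has been excluded. *)
have exq : exists2 O, O \in [set A; B; C] & #|O| = q.
  have [a3 b3 c3'] : [/\ q <= #|A|.+1, q <= #|B|.+1 & q <= #|C|.+1].
    by split; apply: big; rewrite E.
  case/forallPn: nd3 => x; have : porbit g x \in [set A; B; C] by rewrite -E imset_f.
  case: (eqVneq #|A| q) => [|nA]; first by exists A.
  case: (eqVneq #|B| q) => [|nB]; first by exists B.
  case: (eqVneq #|C| q) => [|nC]; first by exists C.
  move: sz a3 b3 c3' nA nB nC; rewrite /dvdn => sz a3 b3 c3' nA nB nC.
  case/set3P=> ->; move: (#|A|) (#|B|) (#|C|) sz a3 b3 c3' nA nB nC => a b c; move: q1 q7; clear; lia.
case: exq => O mO cO.
case: (boolP [forall A' in [set A; B; C], #|A'| == q]) => [/forall_inP allq | nall].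
  exists [set A; B; C]; first by apply: unif3; rewrite ?cT //; apply/eqP/allq.
  by apply: stabpart3; rewrite gO.
(* The two other cycles have the even lengths q - 1 and q + 1. *)
apply: (stab_ex_even q0 cT (gO _ mO) cO) => x xO.
have : porbit g x \in [set A; B; C] by rewrite -E imset_f.
have [a3 b3 c3'] : [/\ q <= #|A|.+1, q <= #|B|.+1 & q <= #|C|.+1].
  by split; apply: big; rewrite E.
have nO : porbit g x != O by apply: contraNneq xO => <-; apply: porbit_id.
have {nall} nall : ~~ [&& #|A| == q, #|B| == q & #|C| == q].
  apply: contra nall => /and3P[a b c]; by apply/forall_inP=> A' /set3P[] ->.
rewrite dvdn2 => xP; move: nO cO.
case/set3P: xP => ->; case/set3P: mO => ->; rewrite ?eqxx // => _;
  move: (#|A|) (#|B|) (#|C|) sz a3 b3 c3' nall => a b c; move: oq; clear; lia.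
Qed.

(** * The minimal covering *)

(** The converse of |F| <= N is the lower bound applied to F itself. Hence the size of the family
    needs only an upper estimate, and that distinct sets or partitions have distinct stabilizers
    follows from equality. *)
Lemma sigma_eq (gT : finGroupType) (G : {group gT}) (F : {set {group gT}}) N :
  is_covering G F -> (forall C, is_covering G C -> N <= #|C|) -> #|F| <= N ->
  sigma G = N /\ is_minimal_covering G F.
Proof.
move=> covF lbN FN; have cF : #|F| = N by apply/eqP; rewrite eqn_leq FN lbN.
suff E : sigma G = N by rewrite /is_minimal_covering covF E cF eqxx.
(* The minimum in [sigma] is meaningful only if its starting family is a covering; it contains F. *)
have cov0 : is_covering G [set H : {group gT} | H \proper G].
  case/andP: covF => /forall_inP pF /eqP FG; apply/andP; split.
    by apply/forall_inP=> H; rewrite inE.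
  rewrite eqEsubset; apply/andP; split.
    by apply/bigcupsP=> H; rewrite inE => /proper_sub.
  rewrite -FG; apply/bigcupsP=> H HF; apply: (bigcup_sup H).
  by rewrite inE FG pF.
rewrite /sigma; case: arg_minnP => // C covC minC.
by apply/eqP; rewrite eqn_leq lbN // -cF andbT minC.
Qed.

Lemma card_bigcup_le (I T : finType) (P : pred I) (F : I -> {set T}) :
  #|\bigcup_(i | P i) F i| <= \sum_(i | P i) #|F i|.
Proof.
elim/big_rec2: _ => [|i A k _ le]; first by rewrite cards0.
by apply: leq_trans (leq_card_setU _ _) _; rewrite leq_add2l.
Qed.

Section Families.

Variable q : nat.
Hypotheses (q7 : 7 <= q) (oq : odd q) (q1 : q = 1 %[mod 3]) (q13 : q = 7 \/ 13 <= q).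

Local Notation n := (3 * q)%N.

Definition intransitive_stabs :=
  \bigcup_(i : 'I_(3 * q) | 1 <= i <= q - 2) subset_stabs (3 * q) i.

Lemma intransitive_stabsP (H : {group {perm 'I_n}}) : reflect
  (exists2 B : {set 'I_n}, H = 'N_('Alt_('I_n))(B | 'P)%G & 0 < #|B| <= q - 2)
  (H \in intransitive_stabs).
Proof.
apply: (iffP bigcupP) => [[i iq /imsetP[B]] | [B -> Bq]].
  by rewrite inE => /eqP E ->; exists B; rewrite // E.
have Bn : #|B| < n by move: Bq q7; clear; lia.
by exists (Ordinal Bn) => //; apply/imsetP; exists B; rewrite ?inE.
Qed.

Lemma partition_stabsP (H : {group {perm 'I_n}}) : reflect
  (exists2 P, H = 'N_('Alt_('I_n))(P | 'P^*)%G & unif 3 q P)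
  (H \in partition_stabs (3 * q) 3 q).
Proof.
apply: (iffP imsetP) => [[P] | [P -> uP]]; first by rewrite inE => uP ->; exists P.
by exists P; rewrite ?inE.
Qed.

Lemma intransitive_stabs_maximal (H : {group {perm 'I_n}}) : H \in intransitive_stabs ->
  maximal H 'Alt_('I_n) /\ ~~ [transitive H, on [set: 'I_n] | 'P].
Proof.
case/intransitive_stabsP=> B -> /andP[B0 Bq]; split.
  by apply: stabset_maximal; rewrite -?card_gt0 ?card_ord //; move: Bq q7; clear; lia.
have /card_gt0P[x xB] := B0.
have [y yB] : exists y, y \notin B.
  have : B \proper [set: 'I_n].
    by rewrite properEcard subsetT cardsT card_ord; move: Bq q7; clear; lia.
  by case/properP=> _ [y _ yB]; exists y.
apply/(transP _ x) => /(_ x y)[s /setIP[_ sN] sE].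
by rewrite -sE (acts_mem x sN) xB in yB.
Qed.

Lemma partition_stabs_maximal P : unif 3 q P -> maximal ('N_('Alt_('I_n))(P | 'P^*)) 'Alt_('I_n).
Proof. by move=> uP; apply: (stabpart_maximal uP) => //; apply: leq_trans q7. Qed.

(** For the converse, transitivity gives the three blocks equal size, and H, contained in the proper
    subgroup stabilizing them, equals it by maximality. *)
Lemma maximal_part_stab (H : {group {perm 'I_n}}) : H \in partition_stabs (3 * q) 3 q <->
  [/\ maximal H 'Alt_('I_n), [transitive H, on [set: 'I_n] | 'P]
    & exists2 Q : {set {set 'I_n}}, imprimitivity_system H [set: 'I_n] 'P Q & #|Q| = 3].
Proof.
have n0 : 0 < #|'I_n| by rewrite card_ord; move: q7; clear; lia.
have q4 : 3 < q by apply: leq_trans q7.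
split=> [/partition_stabsP[P -> uP] | [mH tH [Q sQ cQ]]].
  have [pP cP bP] := unifP _ _ _ uP.
  split; [exact: partition_stabs_maximal | exact: (stabpart_trans uP q4 n0) | exists P => //].
  rewrite /imprimitivity_system pP cP cardsT card_ord subsetIr /=.
  by move: q7; clear; lia.
have /card_gt0P[x0 _] := n0.
case/and3P: sQ => pQ aQ _.
have eqB A B : A \in Q -> B \in Q -> #|A| = #|B|.
  move=> AQ BQ.
  have ne C : C \in Q -> exists x, x \in C.
    by move=> CQ; apply/set0Pn; apply: contraTneq CQ => ->; case/and3P: pQ.
  have [x xA] := ne A AQ; have [y yB] := ne B BQ.
  have [h hH hx] := transP _ x0 tH x y.
  have := subsetP aQ h hH; rewrite mem_stabpart => /forall_inP/(_ A AQ) hA.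
  have -> : B = h @: A by apply: (part_uniq pQ BQ hA yB); rewrite -hx mem_imperm.
  by rewrite card_imperm.
have uQ : unif 3 q Q.
  apply/unifP; split=> // B BQ; have := card_partition pQ.
  rewrite (eq_bigr (fun=> #|B|)) => [|A AQ]; last exact: eqB.
  by rewrite sum_nat_const cQ cardsT card_ord => /eqP; rewrite eqn_pmul2l // => /eqP.
apply/partition_stabsP; exists Q => //; apply: val_inj => /=.
case/maxgroupP: mH => pH maxH; apply/esym/maxH.
  exact: (stabpart_proper uQ isT q4).
by rewrite subsetI (proper_sub pH).
Qed.

Lemma covering_family : is_covering 'Alt_('I_n) (intransitive_stabs :|: partition_stabs (3 * q) 3 q).
Proof.
have pF H : H \in intransitive_stabs :|: partition_stabs (3 * q) 3 q -> H \proper 'Alt_('I_n).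
  case/setUP=> [/intransitive_stabs_maximal[] | /maximal_part_stab[]] /maxgroupp //.
apply/andP; split; first by apply/forall_inP=> H /pF.
rewrite eqEsubset; apply/andP; split.
  by apply/bigcupsP=> H /pF/proper_sub.
apply/subsetP=> g gA; have [[B [B0 Bq gB]] | [P uP gP]] := Alt_stab_ex q7 oq q1 gA.
  apply/bigcupP; exists 'N_('Alt_('I_n))(B | 'P)%G; last by apply/setIP.
  by apply/setUP; left; apply/intransitive_stabsP; exists B; rewrite ?B0.
apply/bigcupP; exists 'N_('Alt_('I_n))(P | 'P^*)%G; last by apply/setIP.
by apply/setUP; right; apply/partition_stabsP; exists P.
Qed.

Lemma card_family : #|intransitive_stabs :|: partition_stabs (3 * q) 3 q| <=
  \sum_(1 <= i < q.-1) 'C(3 * q, i) + nparts q.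
Proof.
apply: leq_trans (leq_card_setU _ _) _; apply: leq_add; last first.
  by apply: leq_trans (leq_imset_card _ _) _; apply: eq_leq; apply: eq_card => P; rewrite !inE.
apply: leq_trans (card_bigcup_le _ _) _.
rewrite (@big_nat_widen _ _ _ 1 q.-1 n); last by move: q7; clear; lia.
rewrite big_geq_mkord /=.
rewrite [X in _ <= X](eq_bigl (fun i : 'I_n => 1 <= i <= q - 2)); last first.
  by move=> i /=; move: q7; clear; lia.
apply: leq_sum => i _; rewrite -[X in _ <= 'C(X, _)]card_ord -card_draws.
by apply: leq_trans (leq_imset_card _ _) _; apply: eq_leq; apply: eq_card => B; rewrite !inE.
Qed.

Lemma sigma_Alt : sigma 'Alt_('I_n) = (\sum_(1 <= i < q.-1) 'C(3 * q, i) + nparts q)%N /\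
  is_minimal_covering 'Alt_('I_n) (intransitive_stabs :|: partition_stabs (3 * q) 3 q).
Proof.
apply: sigma_eq card_family; first exact: covering_family.
move=> C covC; rewrite big_geq_mkord.
exact: covering_lower_bound.
Qed.

Lemma natr_nparts : ((nparts q)%:R = 1 / 6%:R * (n`!%:R / q`!%:R ^+ 3) :> rat)%R.
Proof.
rewrite -(nparts_eq q7) natrM natrM natrX.
have : (q`!%:R != 0 :> rat)%R by rewrite pnatr_eq0 -lt0n fact_gt0.
by move: (q`!%:R)%R => x x0; field.
Qed.

End Families.

Theorem theorem2 (n : nat) (hn : 3 < n) (hmod : n = 3 %[mod 18]) :
  let q := n %/ 3 in
  let An := ('Alt_('I_n))%G in
  let intransitive_family :=
    \bigcup_(i : 'I_n | 1 <= i <= q - 2) subset_stabs n i in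
  let imprimitive_family := partition_stabs n 3 q in
  [/\ ((sigma An)%:R : rat)%R =
        (\sum_(1 <= i < (q - 2).+1) 'C(n, i)%:R
          + 1 / 6%:R * (n`!%:R / q`!%:R ^+ 3))%R,
      is_minimal_covering An (intransitive_family :|: imprimitive_family),
      (forall H : {group {perm 'I_n}}, H \in intransitive_family ->
         maximal H An /\ ~~ [transitive H, on [set: 'I_n] | 'P%act]),
      (forall H : {group {perm 'I_n}}, H \in imprimitive_family <->
         [/\ maximal H An, [transitive H, on [set: 'I_n] | 'P%act]
           & exists2 Q : {set {set 'I_n}},
               imprimitivity_system H [set: 'I_n] 'P%act Q & #|Q| = 3])
    & (forall H : {group {perm 'I_n}}, H \in imprimitive_family ->
         (H \isog wreath 'I_q 'I_3 :&: 'Alt_('I_3 * 'I_q))%g)].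
Proof.
(* With n = 18 m + 3 one has q = 6 m + 1, and n > 3 gives m >= 1: the values are 7, 13, 19 and so
   on. *)
have [q [nq q7 q13 oq q1]] : exists q, [/\ n = (3 * q)%N, 7 <= q, q = 7 \/ 13 <= q, odd q & q = 1 %[mod 3]].
  exists (6 * (n %/ 18)).+1; split; move: hn hmod; clear; lia.
subst n; rewrite mulKn //; move=> q' An F1 F2; rewrite {}/q' in F1 F2 *.
have [sE mE] := sigma_Alt q7 oq q1 q13.
split.
- rewrite sE natrD natr_sum (natr_nparts q7); congr (_ + _)%R.
  by have -> : (q - 2).+1 = q.-1 by move: q7; clear; lia.
- exact: mE.
- by move=> H; apply: intransitive_stabs_maximal.
- by move=> H; apply: maximal_part_stab.
move=> H /partition_stabsP[P -> uP] /=.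
have [|iso _] := stabpart_isog _ uP; first by rewrite card_ord; move: q7; clear; lia.
by rewrite setIC.
Qed.
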